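(* Let $\nu\in\mathscr{P}(M)$ be a Borel probability measure on $M$. The image of the map $\mathfrak{F}_{\mathfrak a}:\mathrm{A}\cdot\nu\rightarrow\mathfrak a$ is an open convex subset of an affine subspace of $\mathfrak a$ with direction $\mathfrak a_\nu^\perp$ (open in that affine subspace). Moreover, $\mathfrak{F}_{\mathfrak a}(\overline{\mathrm{A}\cdot\nu})$ is the convex hull of $\mathfrak{F}_{\mathfrak a}(\overline{\mathrm{A}\cdot\nu}\cap\mathscr{P}(M)^{\mathrm A})$, where $\mathscr{P}(M)^{\mathrm A}$ is the set of measures in $\mathscr{P}(M)$ fixed by $\mathrm{A}$ and the closure is taken in the weak$^*$ topology of $\mathscr{P}(M)$.
   Context: Setting. $(Z,J,\omega)$ is a compact connected Kähler manifold, $\mathrm U$ is a compact connected Lie group with Lie algebra $\mathfrak u$ and complexification $\mathrm U^{\mathbb C}$, with Cartan decomposition $\mathrm U^{\mathbb C}=\mathrm U\exp(i\mathfrak u)$. $\mathrm U^{\mathbb C}$ acts holomorphically on $Z$, and $\mathrm U$ preserves $\omega$ and acts in a Hamiltonian fashion with $\mathrm U$-equivariant momentum mapping $\mu:Z\to\mathfrak u^*\cong\mathfrak u$ (identification via an $\mathrm{Ad}(\mathrm U)$-invariant scalar product). $B$ is a nondegenerate $\mathrm{Ad}(\mathrm U^{\mathbb C})$-invariant symmetric $\mathbb R$-bilinear form on $\mathfrak u^{\mathbb C}=\mathfrak u\oplus i\mathfrak u$, positive definite on $i\mathfrak u$, negative definite on $\mathfrak u$, with $\mathfrak u\perp i\mathfrak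 u$; $\langle\cdot,\cdot\rangle$ is its restriction to $i\mathfrak u$. $\mathrm G\subseteq\mathrm U^{\mathbb C}$ is a compatible subgroup, i.e. a closed connected subgroup with $\mathrm G=\mathrm K\exp(\mathfrak p)$, where $\mathrm K=\mathrm G\cap\mathrm U$ and $\mathfrak p=\mathfrak g\cap i\mathfrak u$ is $\mathrm K$-stable. The $\mathrm G$-gradient map $\mu_{\mathfrak p}:Z\to\mathfrak p$ is $-i$ times the orthogonal projection of $\mu$ onto $i\mathfrak p\subset\mathfrak u$; conventions are normalized so that for every $\beta\in\mathfrak p$ the fundamental vector field $\beta_Z$, $\beta_Z(z)=\frac{d}{dt}|_{t=0}\exp(t\beta)\cdot z$, is the gradient of $\mu_{\mathfrak p}^\beta=\langle\mu_{\mathfrak p},\beta\rangle$ for the Kähler metric determined by $\omega$ and $J$. $M\subset Z$ is a compact $\mathrm G$-stable real submanifold, and $\mu_{\mathfrak p}$ also denotes the restriction to $M$. Measures. $\mathscr P(M)$ is the set of Borel probability measures on $M$ with the weak$^*$ topology (as a subset of the dual of $C(M)$); $\mathrm G$ acts on it by pushforward, $g\cdot\nu=g_*\nu$. Abelian subgroup. $\mathfrak a\subset\mathfrak p$ is a Lie subalgebra of $\mathfrak g$ (necessarily Abelian), $\mathrm A=\exp(\mathfrak a)$, $\mu_{\mathfrak a}=\pi_{\mathfrak a}\circ\mu_{\mathfrak p}:M\to\mathfrak a$ with $\pi_{\mathfrak a}$ the orthogonal projection onto $\mathfrak a$, and $\mathfrak F_{\mathfrak a}:\mathscr P(M)\to\mathfrak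 a$, $\mathfrak F_{\mathfrak a}(\nu)=\int_M\mu_{\mathfrak a}(x)\,d\nu(x)$. For $\nu\in\mathscr P(M)$, $\mathrm A_\nu$ is the isotropy group of $\nu$ in $\mathrm A$, $\mathfrak a_\nu$ its Lie algebra, and $\mathfrak a_\nu^\perp$ the orthogonal complement of $\mathfrak a_\nu$ in $\mathfrak a$ with respect to $\langle\cdot,\cdot\rangle$. *)

(* Defs.v *)
From HB Require Import structures.
From mathcomp Require Import all_boot all_order all_algebra.
From mathcomp Require Import all_classical all_reals all_analysis.

Set Implicit Arguments.
Unset Strict Implicit.
Unset Printing Implicit Defensive.

Import Order.TTheory GRing.Theory Num.Theory.
Import numFieldNormedType.Exports.

Local Open Scope classical_set_scope.
Local Open Scope ring_scope.

(** * Smooth and holomorphic maps between open sets of normed spaces *)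

Section Smooth.
Context {R : realType}.

Fixpoint Ck {V W : normedModType R} (k : nat) (D : set V) (f : V -> W) : Prop :=
  if k is k'.+1 then
    (forall x, D x -> differentiable f x) /\ forall v : V, Ck k' D ('D_v f)
  else forall x, D x -> {for x, continuous f}.

(* [D] is meant to be open and [V] finite-dimensional. *)
Definition smooth_on {V W : normedModType R} (D : set V) (f : V -> W) : Prop :=
  forall k, Ck k D f.

(* [JV] and [JW] are the multiplications by the imaginary unit. *)
Definition holo_on {V W : normedModType R} (JV : V -> V) (JW : W -> W)
    (D : set V) (f : V -> W) : Prop :=
  smooth_on D f /\
  forall x, D x -> forall v, 'd f x (JV v) = JW ('d f x v).

End Smooth.

(** * Manifolds *)

(* The complex space of dimension n: the pair (x, y) stands for x + iy. *)
Notation Cn R n := ('rV[R]_n * 'rV[R]_n)%type.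

Definition Jc {R : realType} {n : nat} (v : Cn R n) : Cn R n := (- v.2, v.1).

Definition Jc2 {R : realType} {m n : nat} (v : Cn R m * Cn R n) :
  Cn R m * Cn R n := (Jc v.1, Jc v.2).

(* A chart with its inverse, both extended arbitrarily to total functions. *)
Record chart (T V : Type) := Chart {
  cdom : set T ;
  cmap : T -> V ;
  cinv : V -> T }.

Definition ccod {T V : Type} (c : chart T V) : set V := cmap c @` cdom c.

Section Manifold.
Context {R : realType}.

Definition is_chart {T : topologicalType} {V : normedModType R}
    (c : chart T V) : Prop :=
  [/\ open (cdom c), open (ccod c),
      forall x, cdom c x -> cinv c (cmap c x) = x,
      forall x, cdom c x -> {for x, continuous (cmap c)} &
      forall v, ccod c v -> {for v, continuous (cinv c)}].

Definition overlap {T V V' : Type} (c : chart T V) (c' : chart T V') : set V :=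
  cmap c @` (cdom c `&` cdom c').

Definition transition {T V V' : Type} (c : chart T V) (c' : chart T V') :
  V -> V' := cmap c' \o cinv c.

Definition complex_manifold {T : topologicalType} {n : nat}
    (A : set (chart T (Cn R n))) : Prop :=
  [/\ hausdorff_space T, @second_countable T,
      forall c, A c -> is_chart c,
      forall x, exists2 c, A c & cdom c x &
      forall c c', A c -> A c' ->
        holo_on Jc Jc (overlap c c') (transition c c')].

Definition holo_map {T T' : topologicalType} {n n' : nat}
    (A : set (chart T (Cn R n))) (A' : set (chart T' (Cn R n')))
    (f : T -> T') : Prop :=
  continuous f /\
  forall c c', A c -> A' c' ->
    holo_on Jc Jc [set v | ccod c v /\ cdom c' (f (cinv c v))]
      (fun v => cmap c' (f (cinv c v))).

(* Holomorphic maps on the product of two manifolds. *)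
Definition holo_map2 {T1 T2 T' : topologicalType} {n1 n2 n' : nat}
    (A1 : set (chart T1 (Cn R n1))) (A2 : set (chart T2 (Cn R n2)))
    (A' : set (chart T' (Cn R n'))) (f : T1 -> T2 -> T') : Prop :=
  continuous (fun x : T1 * T2 => f x.1 x.2) /\
  forall c1 c2 c', A1 c1 -> A2 c2 -> A' c' ->
    holo_on Jc2 Jc
      [set v : Cn R n1 * Cn R n2 |
        [/\ ccod c1 v.1, ccod c2 v.2 & cdom c' (f (cinv c1 v.1) (cinv c2 v.2))]]
      (fun v => cmap c' (f (cinv c1 v.1) (cinv c2 v.2))).

Definition smooth_fun {T : topologicalType} {n : nat} {W : normedModType R}
    (A : set (chart T (Cn R n))) (f : T -> W) : Prop :=
  forall c, A c -> smooth_on (ccod c) (f \o cinv c).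

(* Embedded real submanifold of dimension d: near each of its points there is
   a slice chart of the underlying real manifold. *)
Definition submanifold {T : topologicalType} {n : nat}
    (A : set (chart T (Cn R n))) (d : nat) (M : set T) : Prop :=
  forall x, M x -> exists (k : nat) (s : chart T ('rV[R]_d * 'rV[R]_k)),
    [/\ is_chart s, cdom s x,
        forall c, A c -> smooth_on (overlap c s) (transition c s) /\
                         smooth_on (overlap s c) (transition s c) &
        M `&` cdom s = [set y | cdom s y /\ (cmap s y).2 = 0]].

(* A tangent vector at z is represented by its coordinates in a chart around
   z; [om c z v w] is the value of the form at z on the tangent vectors with
   coordinates v and w in the chart c. *)
Definition kahler_form {T : topologicalType} {n : nat}
    (A : set (chart T (Cn R n)))
    (om : chart T (Cn R n) -> T -> Cn R n -> Cn R n -> R) : Prop :=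
  [/\ forall c z, A c -> cdom c z ->
        (forall a u v w, om c z (a *: u + v) w = a * om c z u w + om c z v w) /\
        (forall u v, om c z u v = - om c z v u),
      forall c c' z, A c -> A c' -> cdom c z -> cdom c' z ->
        let d := 'd (transition c c') (cmap c z) in
        forall u v, om c' z (d u) (d v) = om c z u v,
      forall c, A c -> forall u v,
        smooth_on (ccod c) (fun x => om c (cinv c x) u v : R^o),
      forall c z, A c -> cdom c z -> forall u v w,
        let f v1 v2 := fun x => om c (cinv c x) v1 v2 : R^o in
        'D_u (f v w) (cmap c z) + 'D_v (f w u) (cmap c z)
          + 'D_w (f u v) (cmap c z) = 0 &
      forall c z, A c -> cdom c z ->
        (forall u v, om c z (Jc u) (Jc v) = om c z u v) /\
        (forall u, u != 0 -> 0 < om c z u (Jc u))].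

(* The Kähler metric omega(-, J -). *)
Definition kahler_metric {T : topologicalType} {n : nat}
    (om : chart T (Cn R n) -> T -> Cn R n -> Cn R n -> R)
    (c : chart T (Cn R n)) (z : T) (u v : Cn R n) : R := om c z u (Jc v).

End Manifold.

(** * Linear algebra *)

Section LinearAlgebra.
Context {R : realType} {V : lmodType R}.

Definition linear_subspace (S : set V) : Prop :=
  S 0 /\ forall (a : R) u v, S u -> S v -> S (a *: u + v).

Definition symmetric_bilinear_on (S : set V) (q : V -> V -> R) : Prop :=
  (forall a u v w, S u -> S v -> S w ->
     q (a *: u + v) w = a * q u w + q v w) /\
  (forall u v, S u -> S v -> q u v = q v u).

Definition scalar_product_on (S : set V) (q : V -> V -> R) : Prop :=
  symmetric_bilinear_on S q /\ forall u, S u -> u != 0 -> 0 < q u u.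

(* The element of S with v - w orthogonal to S. *)
Definition orth_proj (q : V -> V -> R) (S : set V) (v : V) : V :=
  xget 0 [set w | S w /\ forall s, S s -> q (v - w) s = 0].

End LinearAlgebra.

(** * Lie groups *)

#[short(type="topGroupType")]
HB.structure Definition TopGroup := {G of Group G & Topological G}.

Section LieGroup.
Context {R : realType}.

Definition complex_Lie_group {G : topGroupType} {m : nat}
    (A : set (chart G (Cn R m))) : Prop :=
  [/\ complex_manifold A,
      holo_map2 A A A (fun x y : G => (x * y)%g) &
      holo_map A A (fun x : G => (x^-1)%g)].

Definition subgroup {G : topGroupType} (H : set G) : Prop :=
  H 1%g /\ forall x y, H x -> H y -> H (x * y^-1)%g.

(* The Lie algebra of G is the tangent space at 1, identified with the model
   space by the chart e; exp (t xi) is the one-parameter subgroup of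
   velocity xi. *)
Definition is_exp {G : topGroupType} {m : nat} (e : chart G (Cn R m))
    (exp : Cn R m -> G) : Prop :=
  forall xi,
  [/\ forall s t : R, exp ((s + t) *: xi) = (exp (s *: xi) * exp (t *: xi))%g,
      continuous (fun t : R => exp (t *: xi)) &
      is_derive (0 : R) 1 (fun t : R => cmap e (exp (t *: xi))) xi].

Definition lie_algebra {G : topGroupType} {m : nat} (exp : Cn R m -> G)
  (H : set G) : set (Cn R m) := [set xi | forall t : R, H (exp (t *: xi))].

Definition Ad {G : topGroupType} {m : nat} (e : chart G (Cn R m))
    (exp : Cn R m -> G) (g : G) (xi : Cn R m) : Cn R m :=
  derive1 (fun t : R => cmap e (g * exp (t *: xi) * g^-1)%g) 0.

(* [xi, eta] = ad xi eta, where ad is the derivative of Ad at 1. *)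
Definition bracket {G : topGroupType} {m : nat} (e : chart G (Cn R m))
    (exp : Cn R m -> G) (xi eta : Cn R m) : Cn R m :=
  derive1 (fun t : R => Ad e exp (exp (t *: xi)) eta) 0.

(* Universal property: each continuous homomorphism from U to a complex Lie
   group extends uniquely to a holomorphic homomorphism on UC. *)
Definition complexification {UC : topGroupType} {m : nat}
    (A : set (chart UC (Cn R m))) (U : set UC) : Prop :=
  forall (k : nat) (H : topGroupType) (AH : set (chart H (Cn R k))),
    complex_Lie_group AH ->
    forall f : UC -> H, {within U, continuous f} ->
      (forall x y, U x -> U y -> f (x * y)%g = (f x * f y)%g) ->
      exists! F : UC -> H,
        [/\ holo_map A AH F, forall x y, F (x * y)%g = (F x * F y)%g &
            forall x, U x -> F x = f x].

(* uC is the direct sum of the real subspaces u and iu, and UC = U exp(iu). *)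
Definition cartan_decomposition {UC : topGroupType} {m : nat}
    (exp : Cn R m -> UC) (U : set UC) : Prop :=
  let u := lie_algebra exp U in
  [/\ linear_subspace u,
      forall xi, exists! w : Cn R m * Cn R m,
        [/\ u w.1, u w.2 & xi = w.1 + Jc w.2] &
      forall g, exists! w : UC * Cn R m,
        [/\ U w.1, u w.2 & g = (w.1 * exp (Jc w.2))%g]].

Definition invariant_form {UC : topGroupType} {m : nat}
    (e : chart UC (Cn R m)) (exp : Cn R m -> UC) (U : set UC)
    (B : Cn R m -> Cn R m -> R) : Prop :=
  let u := lie_algebra exp U in
  [/\ symmetric_bilinear_on setT B,
      forall xi, (forall eta, B xi eta = 0) -> xi = 0,
      forall g xi eta, B (Ad e exp g xi) (Ad e exp g eta) = B xi eta,
      forall xi, u xi -> xi != 0 -> 0 < B (Jc xi) (Jc xi) /\ B xi xi < 0 &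
      forall xi eta, u xi -> u eta -> B xi (Jc eta) = 0].

(* p = g /\ iu *)
Definition cartan_p {UC : topGroupType} {m : nat} (exp : Cn R m -> UC)
    (U G : set UC) : set (Cn R m) :=
  lie_algebra exp G `&` Jc @` lie_algebra exp U.

Definition compatible_subgroup {UC : topGroupType} {m : nat}
    (e : chart UC (Cn R m)) (exp : Cn R m -> UC) (U G : set UC) : Prop :=
  [/\ subgroup G, closed G, connected G,
      G = [set g | exists k beta,
             [/\ (G `&` U) k, cartan_p exp U G beta & g = (k * exp beta)%g]] &
      forall k beta, (G `&` U) k -> cartan_p exp U G beta ->
        cartan_p exp U G (Ad e exp k beta)].

Definition lie_subalgebra_of {G : topGroupType} {m : nat}
    (e : chart G (Cn R m)) (exp : Cn R m -> G)
    (S a : set (Cn R m)) : Prop :=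
  [/\ linear_subspace a, a `<=` S &
      forall xi eta, a xi -> a eta -> a (bracket e exp xi eta)].

End LieGroup.

(** * Hamiltonian actions and gradient maps *)

Section Action.
Context {R : realType} {UC : topGroupType} {m : nat}.
Context {Z : topologicalType} {n : nat}.
Variables (e : chart UC (Cn R m)) (exp : Cn R m -> UC).
Variable AZ : set (chart Z (Cn R n)).
Variable om : chart Z (Cn R n) -> Z -> Cn R n -> Cn R n -> R.
Variable act : UC -> Z -> Z.

Definition holomorphic_action (AU : set (chart UC (Cn R m))) : Prop :=
  [/\ forall z, act 1%g z = z,
      forall g h z, act (g * h)%g z = act g (act h z) &
      holo_map2 AU AZ AZ act].

Definition preserves_form (U : set UC) : Prop :=
  forall g c c' z, U g -> AZ c -> AZ c' -> cdom c z -> cdom c' (act g z) ->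
    let d := 'd (fun v => cmap c' (act g (cinv c v))) (cmap c z) in
    forall u v, om c' (act g z) (d u) (d v) = om c z u v.

(* Coordinates in the chart c of the fundamental vector field of xi at z. *)
Definition fund_field (c : chart Z (Cn R n)) (xi : Cn R m) (z : Z) : Cn R n :=
  derive1 (fun t : R => cmap c (act (exp (t *: xi)) z)) 0.

(* Momentum map, seen in u through the Ad(U)-invariant scalar product q on u.
   With the metric omega(-, J -), the sign d mu^xi = omega(-, xi_Z) is the one
   for which grad mu^(i beta) = beta_Z. *)
Definition momentum_map (U : set UC) (q : Cn R m -> Cn R m -> R)
    (mu : Z -> Cn R m) : Prop :=
  let u := lie_algebra exp U in
  [/\ scalar_product_on u q /\
      (forall g xi eta, U g -> u xi -> u eta ->
         q (Ad e exp g xi) (Ad e exp g eta) = q xi eta),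
      forall z, u (mu z),
      smooth_fun AZ mu,
      forall g z, U g -> mu (act g z) = Ad e exp g (mu z) &
      forall xi c z, u xi -> AZ c -> cdom c z ->
        is_diff (cmap c z) (fun x => q (mu (cinv c x)) xi : R^o)
          (fun v => om c z v (fund_field c xi z))].

(* - i times the orthogonal projection of mu onto ip *)
Definition gradient_map (U G : set UC) (q : Cn R m -> Cn R m -> R)
    (mu : Z -> Cn R m) (z : Z) : Cn R m :=
  - Jc (orth_proj q (Jc @` cartan_p exp U G) (mu z)).

(* beta_Z is the gradient of <mup, beta> for all beta in p. *)
Definition is_gradient (p : set (Cn R m)) (B : Cn R m -> Cn R m -> R)
    (mup : Z -> Cn R m) : Prop :=
  forall beta c z, p beta -> AZ c -> cdom c z ->
    is_diff (cmap c z) (fun x => B (mup (cinv c x)) beta : R^o)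
      (fun v => kahler_metric om c z v (fund_field c beta z)).

Definition stable (G : set UC) (M : set Z) : Prop :=
  forall g z, G g -> M z -> M (act g z).

(* The action restricted to M; the default value x of [insubd] is never
   reached when g preserves M. *)
Definition act_on (M : set Z) (g : UC) (x : M) : M :=
  insubd x (act g (val x)).

End Action.

(** * Probability measures on a subspace *)

Definition pointed_sub {T : topologicalType} {M : set T} (x0 : M) :
  pointedType := HB.pack (set_type M) (isPointed.Build (set_type M) x0).

(* M, with the Borel sigma-algebra of the subspace topology; a measurableType
   is pointed, whence the argument x0. *)
Notation borel_sub M x0 :=
  (g_sigma_algebraType (@open M : set (set (pointed_sub (x0 : M))))).

Section Measures.
Context {R : realType} {UC : topGroupType} {Z : topologicalType}.
Context {M : set Z}.
Variables (act : UC -> Z -> Z) (x0 : M).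

(* The set of Borel probability measures on M with the weak* topology: the
   coarsest topology for which nu |-> \int f dnu is continuous for each f in
   C(M). *)
Definition weak_prob : topologicalType :=
  initial_topology
    (fun nu : probability (borel_sub M x0) R =>
       (fun f : continuousType M R => \int[nu]_x f x)
         : prod_topology (fun _ : continuousType M R => R)).

(* nu' is the pushforward g_* nu. *)
Definition pushes (g : UC) (nu nu' : probability (borel_sub M x0) R) : Prop :=
  forall E : set (borel_sub M x0), measurable E ->
    nu' E = pushforward (T1 := borel_sub M x0) (T2 := borel_sub M x0)
              nu (act_on act g) E.

Definition measure_orbit (A : set UC) (nu : probability (borel_sub M x0) R) :
  set weak_prob := [set nu' | exists2 g, A g & pushes g nu nu'].

Definition fixed_measures (A : set UC) : set weak_prob :=
  [set nu | forall g, A g -> pushes g nu nu].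

Definition measure_isotropy (A : set UC) (nu : probability (borel_sub M x0) R) :
  set UC := [set g | A g /\ pushes g nu nu].

(* Coordinatewise integral of a vector-valued function. *)
Definition mean {m : nat} (f : M -> Cn R m)
    (nu : probability (borel_sub M x0) R) : Cn R m :=
  (\row_j \int[nu]_(x in [set: borel_sub M x0]) ((f x).1 ord0 j),
   \row_j \int[nu]_(x in [set: borel_sub M x0]) ((f x).2 ord0 j)).

End Measures.

Arguments weak_prob R {Z M} x0.

Section AbelianPart.
Context {R : realType} {UC : topGroupType} {m : nat}.

(* Lie algebra of a subgroup H of exp(a), as a subalgebra of a. *)
Definition lie_algebra_in (exp : Cn R m -> UC) (a : set (Cn R m))
  (H : set UC) : set (Cn R m) := a `&` lie_algebra exp H.

Definition orth_compl_in (B : Cn R m -> Cn R m -> R)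
    (a b : set (Cn R m)) : set (Cn R m) :=
  [set xi | a xi /\ forall eta, b eta -> B xi eta = 0].

(* C is an open convex subset of an affine subspace of a with direction d. *)
Definition open_convex_in_affine (a d C : set (Cn R m)) : Prop :=
  convex_set C /\
  exists (p : Cn R m) (O : set (Cn R m)),
    [/\ a p, open O & C = O `&` [set p + v | v in d]].

Definition convex_hull (S : set (Cn R m)) : set (Cn R m) :=
  smallest (@convex_set R (Cn R m)) S.

End AbelianPart.

(* Main.v *)
Require Import Defs.
From HB Require Import structures.
From mathcomp Require Import all_boot all_order all_algebra.
From mathcomp Require Import all_classical all_reals all_analysis.
From mathcomp Require Import measurable_realfun ring lra.

Set Implicit Arguments.
Unset Strict Implicit.
Unset Printing Implicit Defensive.

Import Order.TTheory GRing.Theory Num.Theory.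
Import numFieldNormedType.Exports.

Local Open Scope classical_set_scope.
Local Open Scope ring_scope.

(* The bracket of two elements of a lies in u, because [iu, iu] is contained in u
   by invariance of B, and in iu; hence it vanishes, exp is additive on a, and an
   orthonormal basis of (a, B) turns A into a flow of R^k on M along which
   d/dt <mu_a, beta> is the Kaehler metric paired on fundamental fields: the
   derivative of u |-> mu_a(exp(u) x) is symmetric and positive semidefinite, and
   its kernel consists of the directions that fix x.

   Integrating against nu, the map T(u) = F_a(exp(u) nu) is the gradient of a
   convex function; T is constant along a_nu and strictly monotone in the other
   directions. The image of T is the set of p in T(0) + a_nu^perp for which the
   convex function minus p is coercive modulo a_nu; it is open and convex there.

   P(M) is weak* compact by the Riesz representation theorem, so F_a of the orbit
   closure is compact and convex. If F_a(sigma) is an extreme point of it, the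
   open convex set F_a(A sigma) reduces to that point; hence a_sigma = a, that is,
   sigma is fixed by A, and Minkowski's theorem gives the convex hull. *)

(** * Convex analysis in coordinates *)

(** The convex function attached to [nu] is not the integral of the pointwise potentials, which
    would first require their measurability in the point. For a single point the potential is a
    radial integral, and it makes closed chain sums of u |-> mu_a(exp(u) x) nonpositive. Chain sums
    are finite sums of continuous functions of x, so this sign survives integration, and
    Rockafellar's construction then produces a convex function with [T] as a selection of its
    subdifferential.

    Such a function is known only through its subgradient inequality. The convex analysis therefore
    rests on four properties of [T]: boundedness, invariance along a_nu, strictness modulo a_nu, and
    a one-sided Lipschitz bound in each direction. The last one takes the place of
    differentiability: it identifies [p] with the value of [T] at a minimizer of the convex function
    minus [p].

    The geometry enters the measure-theoretic part only through the clauses of [flow_gradient];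
    likewise there is no ODE theory, since curves are compared by showing that a suitable quotient
    has zero velocity. *)

Section OrthonormalBasis.
Context {R : realType} {V : vectType R} (S : set V) (q : V -> V -> R).
Hypothesis hS : linear_subspace S.
Hypothesis hq : scalar_product_on S q.

Lemma subspace_scale c u : S u -> S (c *: u).
Proof. by move=> Su; have := hS.2 c u 0 Su hS.1; rewrite addr0. Qed.

Lemma subspace_add u v : S u -> S v -> S (u + v).
Proof. by move=> Su Sv; have := hS.2 1 u v Su Sv; rewrite scale1r. Qed.

Lemma subspace_sub u v : S u -> S v -> S (u - v).
Proof.
by move=> Su Sv; rewrite -scaleN1r; apply: subspace_add => //; exact: subspace_scale.
Qed.

Lemma subspace_sum k (f : 'I_k -> V) : (forall i, S (f i)) -> S (\sum_i f i).
Proof.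
by move=> Sf; elim/big_ind: _ => //; [exact: hS.1|exact: subspace_add].
Qed.

Lemma form_sym u v : S u -> S v -> q u v = q v u.
Proof. exact: hq.1.2. Qed.

Lemma formDl u v w : S u -> S v -> S w -> q (u + v) w = q u w + q v w.
Proof. by move=> Su Sv Sw; have := hq.1.1 1 u v w Su Sv Sw; rewrite scale1r mul1r. Qed.

Lemma form0l w : S w -> q 0 w = 0.
Proof.
move=> Sw; have := formDl hS.1 hS.1 Sw; rewrite addr0 => /eqP.
by rewrite eq_sym addrC -subr_eq0 addrK => /eqP.
Qed.

Lemma formZl c u w : S u -> S w -> q (c *: u) w = c * q u w.
Proof.
by move=> Su Sw; have := hq.1.1 c u 0 w Su hS.1 Sw; rewrite addr0 form0l// addr0.
Qed.

Lemma form_suml k (f : 'I_k -> V) w : (forall i, S (f i)) -> S w ->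
  q (\sum_i f i) w = \sum_i q (f i) w.
Proof.
move=> Sf Sw.
suff [] : S (\sum_i f i) /\ q (\sum_i f i) w = \sum_i q (f i) w by [].
elim/big_rec2 : _ => [|i x y _ [Sy e]]; first by split; [exact: hS.1|exact: form0l].
by split; [exact: subspace_add|rewrite formDl// e].
Qed.

Lemma orthonormal_coord k (b : 'I_k -> V) (c : 'I_k -> R) i :
  (forall i, S (b i)) -> (forall i j, q (b i) (b j) = (i == j)%:R) ->
  q (\sum_j c j *: b j) (b i) = c i.
Proof.
move=> Sb qb; rewrite form_suml//; last by move=> j; exact: subspace_scale.
rewrite (bigD1 i)//= formZl// qb eqxx mulr1 big1 ?addr0// => j ji.
by rewrite formZl// qb (negbTE ji) mulr0.
Qed.

(** A longest orthonormal family in [S] exists because orthonormal families are free, hence of size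
    at most [\dim {:V}]. It spans [S]: the residual of a vector outside its span, once normalized,
    would prolong it. *)
Lemma orthonormal_basis : exists k (b : 'I_k -> V),
  [/\ forall i, S (b i), forall i j, q (b i) (b j) = (i == j)%:R &
      forall x, S x -> x = \sum_i q x (b i) *: b i].
Proof.
pose P k := `[< exists b : 'I_k -> V,
  (forall i, S (b i)) /\ (forall i j, q (b i) (b j) = (i == j)%:R) >].
have P0 : exists k, P k.
  by exists 0%N; apply/asboolP; exists (fun _ => 0); split=> -[].
have Pb k : P k -> (k <= \dim {:V})%N.
  move=> /asboolP[b [Sb qb]].
  have fb : free [tuple b i | i < k].
    apply/freeP => c cb0 i; rewrite -(orthonormal_coord c i Sb qb).
    rewrite (_ : \sum__ _ = 0) ?form0l//.
    by rewrite -[RHS]cb0; apply: eq_bigr => j _; rewrite (nth_map j) ?size_enum_ord// nth_ord_enum.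
  by have := dimvS (subvf <<[tuple b i | i < k]>>%VS); move: fb; rewrite /free size_tuple => /eqP ->.
case: (ex_maxnP P0 Pb) => k /asboolP[b [Sb qb]] kmax.
exists k, b; split=> // x Sx; apply/eqP; rewrite -subr_eq0; apply/negPn/negP => y0.
set y := x - _ in y0.
have Sy : S y.
  rewrite /y -scaleN1r; apply: subspace_add => //; apply: subspace_scale.
  by apply: subspace_sum => i; exact: subspace_scale.
have qyb i : q y (b i) = 0.
  rewrite /y formDl//; last first.
    by rewrite -scaleN1r; apply: subspace_scale; apply: subspace_sum => j; exact: subspace_scale.
  rewrite -scaleN1r formZl//; last by apply: subspace_sum => j; exact: subspace_scale.
  by rewrite orthonormal_coord// mulN1r subrr.
have qyy := hq.2 y Sy y0.
pose z := (Num.sqrt (q y y))^-1 *: y.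
have Sz : S z by exact: subspace_scale.
have qzb i : q z (b i) = 0 by rewrite formZl// qyb mulr0.
have qzz : q z z = 1.
  rewrite /z formZl// form_sym// formZl// mulrA -invfM -expr2 sqr_sqrtr ?ltW//.
  by rewrite mulVf ?gt_eqF.
have : P k.+1.
  apply/asboolP; exists (fun i => if unlift ord0 i is Some j then b j else z).
  split=> [i|i j]; first by case: unliftP.
  case: unliftP => [i' ->|->]; case: unliftP => [j' ->|->] //=.
  - by rewrite form_sym.
by move=> /kmax; rewrite ltnn.
Qed.

End OrthonormalBasis.

(** * The Euclidean product on row vectors *)

Section Dot.
Context {R : realType} {k : nat}.
Implicit Types u v w : 'rV[R]_k.

Definition dotv u v : R := \sum_i u ord0 i * v ord0 i.

Lemma dotvC u v : dotv u v = dotv v u.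
Proof. by apply: eq_bigr => i _; rewrite mulrC. Qed.

Lemma dotvDl u v w : dotv (u + v) w = dotv u w + dotv v w.
Proof. by rewrite -big_split; apply: eq_bigr => i _; rewrite mxE mulrDl. Qed.

Lemma dotvZl c u w : dotv (c *: u) w = c * dotv u w.
Proof. by rewrite mulr_sumr; apply: eq_bigr => i _; rewrite mxE mulrA. Qed.

Lemma dotvDr u v w : dotv w (u + v) = dotv w u + dotv w v.
Proof. by rewrite dotvC dotvDl !(dotvC w). Qed.

Lemma dotvZr c u w : dotv w (c *: u) = c * dotv w u.
Proof. by rewrite dotvC dotvZl (dotvC w). Qed.

Lemma dotvNl u w : dotv (- u) w = - dotv u w.
Proof. by rewrite -scaleN1r dotvZl mulN1r. Qed.

Lemma dotvNr u w : dotv w (- u) = - dotv w u.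
Proof. by rewrite dotvC dotvNl dotvC. Qed.

Lemma dotvBl u v w : dotv (u - v) w = dotv u w - dotv v w.
Proof. by rewrite dotvDl dotvNl. Qed.

Lemma dotvBr u v w : dotv w (u - v) = dotv w u - dotv w v.
Proof. by rewrite dotvDr dotvNr. Qed.

Lemma dotv0l w : dotv 0 w = 0.
Proof. by rewrite -(scale0r 0) dotvZl mul0r. Qed.

Lemma dotv0r w : dotv w 0 = 0.
Proof. by rewrite dotvC dotv0l. Qed.

Lemma dotv_ge0 u : 0 <= dotv u u.
Proof. by apply: sumr_ge0 => i _; rewrite -expr2 sqr_ge0. Qed.

Lemma dotv_eq0 u : dotv u u = 0 -> u = 0.
Proof.
move=> /eqP; rewrite psumr_eq0; last by move=> i _; rewrite -expr2 sqr_ge0.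
move=> /allP u0; apply/rowP => i; rewrite mxE.
by have := u0 i (mem_index_enum i); rewrite /= -expr2 sqrf_eq0 => /eqP.
Qed.

Lemma coord_le_norm u i : `|u ord0 i| <= `|u|.
Proof.
have /mapP[j Hj ->] : `|u ord0 i| \in [seq `|u x.1 x.2| | x : 'I_1 * 'I_k].
  by apply/mapP; exists (ord0, i) => //=; rewrite mem_enum.
by rewrite [leRHS]/Num.norm /= mx_normrE; apply/bigmax_geP; right => /=; exists j.
Qed.

(** The norm of row vectors is the max norm, so each of the [k] products is at most [|u| * |v|]. The
    factor [k] recurs in all later estimates. *)
Lemma norm_dotv_le u v : `|dotv u v| <= k%:R * `|u| * `|v|.
Proof.
apply: (le_trans (ler_norm_sum _ _ _)).
have -> : k%:R * `|u| * `|v| = \sum_(i < k) `|u| * `|v|.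
  by rewrite sumr_const card_ord -mulrA mulr_natl.
by apply: ler_sum => i _; rewrite normrM ler_pM// coord_le_norm.
Qed.

Lemma dotv_le u v : dotv u v <= k%:R * `|u| * `|v|.
Proof. exact: le_trans (ler_norm _) (norm_dotv_le _ _). Qed.

Lemma lipschitz_cont (f : 'rV[R]_k -> R) (C : R) :
  (forall u v, f u - f v <= C * `|u - v|) -> continuous f.
Proof.
move=> fC u; apply/(@cvgrPdist_lt _ _ _ (nbhs u) (nbhs_filter u)) => e e0.
(* [C] may be zero or negative; [|C| + 1] is a positive constant that serves equally well. *)
have C1 : 0 < `|C| + 1 by rewrite ltr_wpDl.
have nu : \forall v \near u, `|u - v| < e / (`|C| + 1).
  apply/nbhs_ballP; exists (e / (`|C| + 1)) => /=; first exact: divr_gt0.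
  by move=> v; rewrite -ball_normE.
apply: filterS nu => v uv.
have H x y : f x - f y <= (`|C| + 1) * `|x - y|.
  apply: (le_trans (fC _ _)); apply: ler_wpM2r => //.
  by rewrite (le_trans (ler_norm _))// lerDl.
rewrite ltr_norml; apply/andP; split.
  rewrite ltrNl opprB; apply: le_lt_trans (H _ _) _.
  by rewrite distrC mulrC -ltr_pdivlMr.
by apply: le_lt_trans (H _ _) _; rewrite mulrC -ltr_pdivlMr.
Qed.

Lemma dotv_continuous v : continuous (dotv ^~ v).
Proof.
apply: (@lipschitz_cont _ (k%:R * `|v|)) => x y.
by rewrite -dotvBl (le_trans (dotv_le _ _))// mulrAC.
Qed.

Lemma dotvr_continuous v : continuous (dotv v).
Proof.
by rewrite (_ : dotv v = dotv ^~ v) ?funeqE; [exact: dotv_continuous|move=> u; exact: dotvC].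
Qed.

Lemma dotv_scalar_product (S : set 'rV[R]_k) : scalar_product_on S dotv.
Proof.
split; first by split => [a u v w _ _ _|u v _ _]; rewrite ?dotvDl ?dotvZl// dotvC.
move=> u _ u0; rewrite lt_neqAle dotv_ge0 andbT eq_sym.
by apply/eqP => /dotv_eq0 /eqP; rewrite (negbTE u0).
Qed.

Lemma orth_decomp (W : set 'rV[R]_k) u : linear_subspace W ->
  exists2 w, W w & forall w', W w' -> dotv (u - w) w' = 0.
Proof.
move=> lW; have [n [b [Wb bb bx]]] := orthonormal_basis lW (dotv_scalar_product W).
exists (\sum_i dotv u (b i) *: b i).
  by apply: subspace_sum => // i; exact: subspace_scale.
move=> w' Ww'; rewrite (bx _ Ww') dotvC (@form_suml _ _ setT)//; last exact: dotv_scalar_product.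
apply: big1 => i _; rewrite dotvZl [X in _ * X](_ : _ = 0) ?mulr0//.
rewrite dotvC dotvBl (orthonormal_coord lW (dotv_scalar_product W))//.
by rewrite subrr.
Qed.

End Dot.

(** * The image of a subgradient selection of a convex function *)

Section GradientImage.
Context {R : realType} {k : nat}.
Notation V := 'rV[R]_k.
Variables (T : V -> V) (phi : V -> R) (W : set V) (C : R) (Cl : V -> R).
Hypothesis phi_sub : forall u v, phi u + dotv (T u) (v - u) <= phi v.
Hypothesis T_bound : forall u, `|T u| <= C.
Hypothesis T_lip : forall u w e, 0 <= e ->
  dotv (T (u + e *: w)) w <= dotv (T u) w + e * Cl w.
Hypothesis lW : linear_subspace W.
Hypothesis phi_strict : forall u v,
  phi v = phi u + dotv (T u) (v - u) -> W (v - u).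
Hypothesis T_W : forall u v, W v -> T (u + v) = T u.

Let Wp : set V := [set v | forall w, W w -> dotv v w = 0].

Let lWp : linear_subspace Wp.
Proof.
split=> [w _|a u v Wu Wv w Ww]; first by rewrite dotv0l.
by rewrite dotvDl dotvZl Wu// Wv// mulr0 addr0.
Qed.

Let Wp_closed : closed Wp.
Proof.
rewrite (_ : Wp = \bigcap_(w in W) (dotv ^~ w @^-1` [set 0])).
  apply: closed_bigI => w _; apply: closed_comp; last exact: closed_eq.
  by move=> x _; exact: dotv_continuous.
by apply/seteqP; split.
Qed.

Let W_Wp0 u : W u -> Wp u -> u = 0.
Proof. by move=> Wu /(_ _ Wu) /dotv_eq0. Qed.

Let phi_cont : continuous phi.
Proof.
apply: (@lipschitz_cont _ _ _ (k%:R * C)) => u v.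
have := phi_sub u v; rewrite -(opprB u v) dotvNr => h.
have := dotv_le (T u) (u - v).
have : k%:R * `|T u| * `|u - v| <= k%:R * C * `|u - v|.
  by rewrite ler_wpM2r// ler_wpM2l.
lra.
Qed.

(** Weighted sum of the subgradient inequalities from the intermediate point [x + t *: y] towards
    the two ends. *)
Let phi_convex x y t : 0 <= t -> t <= 1 ->
  phi (x + t *: y) <= t * phi (x + y) + (1 - t) * phi x.
Proof.
move=> t0 t1.
have h1 := phi_sub (x + t *: y) (x + y).
have h2 := phi_sub (x + t *: y) x.
have e1 : x + y - (x + t *: y) = (1 - t) *: y.
  by rewrite opprD addrACA subrr add0r scalerBl scale1r.
have e2 : x - (x + t *: y) = - (t *: y) by rewrite opprD addrA subrr add0r.
rewrite e1 dotvZr in h1; rewrite e2 dotvNr dotvZr in h2.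
have := ler_wpM2l t0 h1; have : 0 <= 1 - t by lra.
move=> t1' h3; have := ler_wpM2l t1' h2; nra.
Qed.

(** The subgradient inequalities from [u] to [u + w] and back have the same slope, [T] being
    constant along [W]. *)
Let phi_W u w : W w -> phi (u + w) = phi u + dotv (T u) w.
Proof.
move=> Ww; apply/eqP; rewrite eq_le; apply/andP; split.
  have := phi_sub (u + w) u; rewrite T_W// opprD addrA subrr add0r dotvNr; lra.
by have := phi_sub u (u + w); rewrite addrAC subrr add0r.
Qed.

(* phi is affine along W, with slope T v at every point v; letting s tend to
   +oo and -oo in the subgradient inequality between u and v + s w forces the
   slopes at u and v to agree. *)
Let T_dotW u v w : W w -> dotv (T u) w = dotv (T v) w.
Proof.
move=> Ww; apply/eqP; rewrite -subr_eq0; apply/negPn/negP => d0.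
set d := _ - _ in d0.
have H s : s * d <= phi v - phi u - dotv (T u) (v - u).
  have := phi_sub u (v + s *: w).
  rewrite phi_W; last exact: subspace_scale.
  rewrite -addrA [_ *: w - u]addrC addrA !dotvDr !dotvZr /d; lra.
pose K := phi v - phi u - dotv (T u) (v - u).
have := H ((`|K| + 1) / d); rewrite divfK// => h.
by have := ler_norm K; rewrite -/K in h; lra.
Qed.

Let T_aff u : Wp (T u - T 0).
Proof. by move=> w Ww; rewrite dotvBl (T_dotW u 0 Ww) subrr. Qed.

(* p is the gradient of phi at some point iff phi - p is coercive modulo W *)
Let good (p : V) := exists d c, 0 < d /\
  forall x, Wp x -> dotv p x + d * `|x| - c <= phi x.

Let good_open : open good.
Proof.
rewrite openE => p [d [c [d0 H]]].
have K1 : 0 < k%:R + 1 :> R by rewrite ltr_wpDl.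
(* With this radius, replacing [p] by [p'] changes the pairing with [x] by at most [d / 2 * |x|],
   which leaves the coercivity constant [d / 2]. *)
apply/nbhs_ballP; exists (d / 2 / (k%:R + 1)); first by rewrite /= !divr_gt0.
move=> p'; rewrite -ball_normE/= => /ltW pp.
exists (d / 2), c; split; first by rewrite divr_gt0.
move=> x Wx; have := H x Wx.
have := dotv_le (p' - p) x; rewrite dotvBl distrC.
have : (k%:R + 1) * `|p - p'| <= d / 2 by rewrite mulrC -ler_pdivlMr.
move=> h; have := ler_wpM2r (normr_ge0 x) h.
by have := normr_ge0 x; have := mulr_ge0 (normr_ge0 (p - p')) (normr_ge0 x); lra.
Qed.

(** After [u] is replaced by its component [x0] orthogonal to [W], let [f] be the gap between [phi]
    and its affine support at [x0]. It is convex, nonnegative and zero at 0, and strictness makes it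
    positive on the unit sphere of [Wp]. Its minimum there is the constant [d]: by convexity [f]
    grows at least linearly outside the unit ball. *)
Let good_T u : good (T u).
Proof.
have [w Ww uw] := orth_decomp u lW.
set x0 := u - w in uw.
have Tx0 : T u = T x0 by rewrite -(T_W x0 Ww) subrK.
rewrite Tx0.
pose f y := phi (x0 + y) - phi x0 - dotv (T x0) y.
have f0 y : 0 <= f y.
  by have := phi_sub x0 (x0 + y); rewrite addrAC subrr add0r /f; lra.
have fcont : continuous f.
  have phic : continuous (fun y => phi (x0 + y)).
    move=> y; apply: (@continuous_comp _ _ _ (fun z => x0 + z) phi); last exact: phi_cont.
    by apply: (@continuousD _ _ _ (fun=> x0) id); [exact: cst_continuous|exact: cvg_id].
  move=> y; apply: (@continuousB _ _ _ (fun y => phi (x0 + y) - phi x0)); last exact: dotvr_continuous.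
  by apply: (@continuousB _ _ _ _ (fun=> phi x0)); [exact: phic|exact: cst_continuous].
suff [d [d0 fd]] : exists d, 0 < d /\ forall y, Wp y -> d * `|y| - d <= f y.
  exists d, (d + d * `|x0| - phi x0 + dotv (T x0) x0); split=> // x Wx.
  have := fd (x - x0) (subspace_sub lWp Wx uw).
  rewrite /f addrCA subrr addr0 dotvBr => h.
  have := ler_wpM2l (ltW d0) (lerB_dist x x0); lra.
pose S := Wp `&` [set y | `|y| = 1].
(* If the sphere is empty, [Wp] contains only 0 and [d = 1] will do. *)
have [[s Ss]|/set0P/negP/negPn/eqP S0] := pselect (S !=set0); last first.
  exists 1; split=> // y Wy; have [->|y0] := eqVneq y 0.
    by rewrite normr0; have := f0 0; lra.
  suff : S (`|y|^-1 *: y) by rewrite S0.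
  split; first exact: (subspace_scale lWp).
  by rewrite /= normrZ normfV normr_id mulVf// normr_eq0.
have cS : compact S.
  apply: bounded_closed_compact.
    exists 1; split=> // z z1 y [_ /= ->]; exact: ltW.
  apply: (closedI Wp_closed); apply: ((continuous_closedP (@Num.norm R V)).1 _ [set x | x = 1]) => //.
  exact: norm_continuous.
have [|y /set_mem[Wy y1] ymin] := @compact_EVT_min _ R f S (ex_intro _ s Ss) cS _.
  exact: continuous_subspaceT.
exists (f y); split.
  rewrite lt_neqAle f0 andbT eq_sym; apply/eqP => fy0.
  have : W (x0 + y - x0).
    apply: phi_strict; rewrite (addrAC x0 y) subrr add0r.
    by move: fy0; rewrite /f; lra.
  rewrite addrAC subrr add0r => /W_Wp0 /(_ Wy) y0.
  by move: y1; rewrite /= y0 normr0 => /eqP; rewrite eq_sym oner_eq0.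
move=> z Wz; have [z1|z1] := leP `|z| 1.
  have : f y * `|z| <= f y * 1 by rewrite ler_wpM2l.
  by have := f0 z; lra.
have z0 : 0 < `|z| by lra.
have /ymin h : `|z|^-1 *: z \in S.
  apply/mem_set; split; first exact: (subspace_scale lWp).
  by rewrite /= normrZ normfV normr_id mulVf// gt_eqF.
have : f (`|z|^-1 *: z) <= `|z|^-1 * f z.
  have := @phi_convex x0 z (`|z|^-1) _ _.
  rewrite invr_ge0 ltW// => /(_ isT); rewrite invf_le1// ltW// => /(_ isT).
  by rewrite /f dotvZr; lra.
move=> /(le_trans h); rewrite mulrC ler_pdivlMr//.
have := f0 y; lra.
Qed.

(** Coercivity gives a minimizer [x0] of [psi] on [Wp]; it is a global one because [psi] does not
    vary along [W]. A minimizer satisfies [T x0 = p], by a small step from [x0] in the direction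
    [p - T x0]. *)
Let good_range v : Wp v -> good (T 0 + v) -> exists u, T u = T 0 + v.
Proof.
set p := T 0 + v => Wv [d [c [d0 H]]].
pose psi x := phi x - dotv p x.
have psic : continuous psi.
  move=> y; apply: (@continuousB _ _ _ phi); first exact: phi_cont.
  exact: dotvr_continuous.
(* Beyond radius [r] coercivity yields [psi x > psi 0], so minimizing over the ball [D] is
   enough. *)
pose r := (psi 0 + c) / d.
have r0 : 0 <= r.
  rewrite divr_ge0 ?(ltW d0)//.
  by have := H 0 lWp.1; rewrite normr0 mulr0 /psi dotv0r; lra.
pose D := Wp `&` [set x | `|x| <= r].
have cD : compact D.
  apply: bounded_closed_compact.
    by exists r; split=> [|z rz y [_ /= yr]]; [exact: num_real|exact: le_trans yr (ltW rz)].
  apply: (closedI Wp_closed); apply: ((continuous_closedP (@Num.norm R V)).1 _ [set x | x <= r]) => //.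
  exact: norm_continuous.
have D0 : D 0 by split; [exact: lWp.1|rewrite /= normr0].
have [|x0 /set_mem[Wx0 _] xmin] := @compact_EVT_min _ R psi D (ex_intro _ 0 D0) cD _.
  exact: continuous_subspaceT.
have min1 x : Wp x -> psi x0 <= psi x.
  move=> Wx; have [xr|xr] := leP `|x| r; first exact/xmin/mem_set.
  have h0 : psi x0 <= psi 0 by exact/xmin/mem_set.
  have := H x Wx; move: xr; rewrite /r ltr_pdivrMr//.
  by rewrite /psi in h0 *; lra.
have min2 x : psi x0 <= psi x.
  have [w Ww xw] := orth_decomp x lW.
  have e : dotv p w = dotv (T 0) w by rewrite /p dotvDl Wv// addr0.
  have := min1 _ xw; have := phi_W (x - w) Ww.
  by rewrite subrK (T_dotW (x - w) 0 Ww) /psi (dotvBr x w p) e; lra.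
exists x0; apply/eqP; rewrite -subr_eq0; apply/eqP/dotv_eq0.
apply/eqP; rewrite eq_le dotv_ge0 andbT.
(* It suffices that [dotv p w <= dotv (T x0) w]. Minimality compares [p] with [T] at [x0 + ee *: w],
   and [T_lip] returns from there to [x0] at cost [ee * Cl w <= e]. *)
set w := - (T x0 - p).
rewrite -oppr_ge0 -dotvNr -/w dotvBl subr_ge0.
apply/ler_addgt0Pr => e e0.
pose ee := e / (`|Cl w| + 1).
have C1 : 0 < `|Cl w| + 1 by rewrite ltr_wpDl.
have ee0 : 0 < ee by rewrite divr_gt0.
have h1 := phi_sub (x0 + ee *: w) x0.
rewrite opprD addrA subrr add0r dotvNr dotvZr in h1.
have h2 := min2 (x0 + ee *: w); rewrite /psi dotvDr dotvZr in h2.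
have h3 : ee * dotv p w <= ee * dotv (T (x0 + ee *: w)) w by lra.
rewrite ler_pM2l// in h3.
have h4 := T_lip x0 w (ltW ee0).
apply: (le_trans (le_trans h3 h4)); rewrite lerD2l /ee.
rewrite mulrAC ler_pdivrMr// ler_pM2l//.
by rewrite (le_trans (ler_norm _))// lerDl.
Qed.

Lemma gradient_image_open : exists2 O : set V, open O &
  range T = O `&` [set T 0 + v | v in [set v | forall w, W w -> dotv v w = 0]].
Proof.
exists good; first exact: good_open.
apply/seteqP; split=> [_ [u _ <-]|p [gp [v Wv vp]]].
  by split; [exact: good_T|exists (T u - T 0); [exact: T_aff|rewrite addrC subrK]].
by have [|u Tu] := @good_range v Wv; [rewrite vp|exists u; rewrite // Tu].
Qed.

(** Being [good] is a convex condition: the coercivity constants of the two points combine with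
    weights [t] and [1 - t]. *)
Lemma gradient_image_convex u v t : 0 <= t -> t <= 1 ->
  exists w, T w = t *: T u + (1 - t) *: T v.
Proof.
move=> t0 t1; set p := _ + _.
have ep : p = T 0 + (t *: (T u - T 0) + (1 - t) *: (T v - T 0)).
  by rewrite /p; apply/rowP => i; rewrite !mxE; ring.
rewrite ep; apply: good_range.
  by apply: (subspace_add lWp); apply: (subspace_scale lWp); exact: T_aff.
rewrite -ep.
have [d1 [c1 [d10 h1]]] := good_T u; have [d2 [c2 [d20 h2]]] := good_T v.
exists (t * d1 + (1 - t) * d2), (t * c1 + (1 - t) * c2); split.
  have [->|t0'] := eqVneq t 0; first by rewrite mul0r subr0 mul1r add0r.
  by rewrite ltr_pwDl// ?mulr_gt0// ?mulr_ge0 ?subr_ge0 ?(ltW d20)// lt_neqAle eq_sym t0' t0.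
move=> x Wx; have := ler_wpM2l t0 (h1 x Wx).
have t1' : 0 <= 1 - t by rewrite subr_ge0.
by have := ler_wpM2l t1' (h2 x Wx); rewrite /p dotvDl !dotvZl; lra.
Qed.

End GradientImage.

(** * Minkowski's theorem on extreme points *)

Section Minkowski.
Context {R : realType} {k : nat}.
Notation V := 'rV[R]_k.

(** Convexity with a plain real weight, where [convex_set] takes its weights in a bundled interval
    type. *)
Definition cvx {E : lmodType R} (D : set E) := forall x y (t : R),
  0 <= t -> t <= 1 -> D x -> D y -> D (t *: x + (1 - t) *: y).

Lemma convex_setP {E : lmodType R} (D : set E) : convex_set D <-> cvx D.
Proof.
split=> [cD x y t t0 t1 Dx Dy|cD x y t /set_mem Dx /set_mem Dy].
  have t01 : Itv.spec (@Itv.num_sem R) (Itv.Real `[0%Z, 1%Z]) t.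
    by apply/and3P; split; rewrite ?num_real// ?bnd_simp.
  have := cD x y (Itv.mk t01) (mem_set Dx) (mem_set Dy).
  by move/set_mem.
apply/mem_set; apply: cD => //.
Qed.

Variable C : set V.
Hypothesis Ccl : closed C.
Hypothesis Cbd : bounded_set C.
Hypothesis Ccv : cvx C.

(* The direction of the smallest face of C that contains x. *)
Definition face_dir (x : V) : set V :=
  [set v | exists2 e : R, 0 < e & C (x + e *: v) /\ C (x - e *: v)].

Let face_le x v e e' : C x -> 0 < e' -> e' <= e ->
  C (x + e *: v) -> C (x + e' *: v).
Proof.
move=> Cx e'0 ee h; have e0 := lt_le_trans e'0 ee.
have r0 : 0 <= e' / e by rewrite divr_ge0// ltW.
have r1 : e' / e <= 1 by rewrite ler_pdivrMr// mul1r.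
have := Ccv r0 r1 h Cx; congr C; rewrite scalerDr scalerA divfK ?gt_eqF// addrAC -scalerDl.
by rewrite addrC [e' / e + _]addrC subrK scale1r addrC.
Qed.

(** A scalar rescales the step, a negative one also exchanging the two end points; a sum is handled
    by midpoints, which halves the common step. *)
Let face_lin x : C x -> linear_subspace (face_dir x).
Proof.
move=> Cx; split; first by exists 1 => //; rewrite scaler0 addr0 subr0.
move=> a u v [e e0 [h1 h2]] [d d0 [h3 h4]].
have fz c w s : 0 < s -> C (x + s *: w) -> C (x - s *: w) ->
    exists2 s', 0 < s' & C (x + s' *: (c *: w)) /\ C (x - s' *: (c *: w)).
  move=> s0 hp hm; have [->|c0] := eqVneq c 0.
    by exists 1 => //; rewrite scale0r scaler0 addr0 subr0.
  exists (s / `|c|); first by rewrite divr_gt0 ?normr_gt0.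
  rewrite scalerA; have [cp|cn|c0'] := ltgtP c 0; last by rewrite c0' eqxx in c0.
    rewrite ltr0_norm// invrN mulrN mulNr divfK// scaleNr opprK; split=> //.
  by rewrite gtr0_norm// divfK.
have [s s0 [h5 h6]] := fz a u e e0 h1 h2.
pose r := Num.min s d.
have r0 : 0 < r by rewrite lt_min s0 d0.
have rs : r <= s by rewrite ge_min lexx.
have rd : r <= d by rewrite ge_min lexx orbT.
have face_leN w e1 e2 : 0 < e1 -> e1 <= e2 -> C (x - e2 *: w) -> C (x - e1 *: w).
  move=> e10 e12; rewrite -!scalerN; exact: face_le.
have half01 : 0 <= (2^-1 : R) by rewrite invr_ge0.
have half11 : (2^-1 : R) <= 1 by rewrite invf_le1// ler1n.
exists (r / 2); first by rewrite divr_gt0.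
split.
  have := Ccv half01 half11 (face_le Cx r0 rs h5) (face_le Cx r0 rd h3).
  by congr C; apply/rowP => i; rewrite !mxE; field.
have := Ccv half01 half11 (face_leN _ _ _ r0 rs h6) (face_leN _ _ _ r0 rd h4).
by congr C; apply/rowP => i; rewrite !mxE; field.
Qed.

Let line_compact x v : v != 0 -> compact [set t : R | C (x + t *: v)].
Proof.
move=> v0.
have vn0 : 0 < `|v| by rewrite normr_gt0.
have fc : continuous (fun t : R => x + t *: v).
  move=> t; apply: (@continuousD _ _ _ (fun=> x) (fun t : R => t *: v)).
    exact: cst_continuous.
  exact: scalel_continuous.
have tcl : closed [set t : R | C (x + t *: v)].
  exact: (continuous_closedP _).1 fc _ Ccl.
have [M [Mr CM]] := Cbd.
pose K := (`|M| + 1 + `|x|) / `|v|.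
apply: (subclosed_compact tcl (@segment_compact _ (- K) K)) => t Ct.
rewrite /= in_itv/= -ler_norml /K ler_pdivlMr// -normrZ.
have MM : M < `|M| + 1 by rewrite (le_lt_trans (ler_norm _))// ltrDl.
have h1 : `|x + t *: v| <= `|M| + 1 := CM _ MM _ Ct.
rewrite -[t *: v](addKr x) addrC.
by apply: (le_trans (ler_normB _ _)); rewrite lerD2r.
Qed.

(** The extreme points are those with trivial [face_dir]. If [x] has a nonzero face direction [v],
    the line through [x] along [v] meets [C] in a segment around [x], and [x] is a convex
    combination of its ends. These have the face directions of [x] at most, and no longer [v], so
    induction on the dimension of the face applies to them. *)
Lemma minkowski_extreme (D : set V) : cvx D ->
  (forall x, C x -> (forall v, face_dir x v -> v = 0) -> D x) -> C `<=` D.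
Proof.
move=> Dcv Dext x Cx.
(* The induction parameter [n] bounds the dimension of [face_dir x], expressed by the sizes of free
   families in it. *)
suff H n : forall x, C x ->
    (forall s : seq V, free s -> (forall v, v \in s -> face_dir x v) -> (size s <= n)%N) ->
    D x.
  apply: (H (\dim {:V})) => // s fs _.
  by have := dimvS (subvf (span s)); move: fs; rewrite /free => /eqP ->.
elim: n => [|n IH] {Cx}x Cx Hs.
  apply: Dext => // v Fv; apply/eqP/negPn/negP => v0.
  have : (size [:: v] <= 0)%N.
    by apply: Hs; [rewrite seq1_free|move=> w; rewrite inE => /eqP ->].
  by [].
have [[v [Fv v0]]|/forallNP nF] := pselect (exists v, face_dir x v /\ v != 0); last first.
  apply: Dext => // v Fv; apply/eqP/negPn/negP => v0; exact: (nF v).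
have [e e0 [Cp Cm]] := Fv.
have cl := line_compact (x := x) v0.
have ne : [set t : R | C (x + t *: v)] !=set0 by exists e.
have [|c /set_mem/= Cc cmax] := @compact_EVT_max _ R id _ ne cl.
  by apply: continuous_subspaceT => t; exact: cvg_id.
have [|c' /set_mem/= Cc' cmin] := @compact_EVT_min _ R id _ ne cl.
  by apply: continuous_subspaceT => t; exact: cvg_id.
have ec : e <= c by apply: cmax; exact/mem_set.
have ec' : c' <= - e by apply: cmin; apply/mem_set; rewrite /= scaleNr.
have sub y w z l : 0 < l -> l < 1 -> C z -> x = l *: y + (1 - l) *: z ->
    face_dir y w -> face_dir x w.
  move=> l0 l1 Cz -> [d d0 [hp hm]]; exists (l * d); first exact: mulr_gt0.
  split.
    have := Ccv (ltW l0) (ltW l1) hp Cz.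
    by congr C; apply/rowP => i; rewrite !mxE; ring.
  have := Ccv (ltW l0) (ltW l1) hm Cz.
  by congr C; apply/rowP => i; rewrite !mxE; ring.
(* Prepending [v] to a free family of face directions of [y] keeps it free and lands in
   [face_dir x], so the bound drops by one. *)
have step y z l : 0 < l -> l < 1 -> C y -> C z -> x = l *: y + (1 - l) *: z ->
    ~ face_dir y v -> D y.
  move=> l0 l1 Cy Cz xyz nFv; apply: IH => // s fs Fs.
  rewrite -ltnS; apply: (Hs (v :: s)).
    rewrite free_cons fs andbT; apply/negP => vs; apply: nFv.
    rewrite (@coord_span _ _ _ (in_tuple s) _ vs); apply: subspace_sum; first exact: face_lin.
    move=> i; apply: subspace_scale; first exact: face_lin.
    by apply: Fs; rewrite mem_nth.
  move=> w; rewrite inE => /orP[/eqP -> //|/Fs]; exact: sub l0 l1 Cz xyz.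
(* Since [c' < 0 < c], this is the weight for which [l * c + (1 - l) * c' = 0]. *)
pose l := - c' / (c - c').
have cc : 0 < c - c' by lra.
have l0 : 0 < l by rewrite divr_gt0//; lra.
have l1 : l < 1 by rewrite /l ltr_pdivrMr//; lra.
have xe : x = l *: (x + c *: v) + (1 - l) *: (x + c' *: v).
  apply/rowP => i; rewrite !mxE /l; field; lra.
have xe' : x = (1 - l) *: (x + c' *: v) + (1 - (1 - l)) *: (x + c *: v).
  by rewrite subKr addrC -xe.
rewrite xe; apply: Dcv; [exact: ltW|exact: ltW| |].
  apply: (step _ (x + c' *: v) l) => //.
  case=> d d0 [+ _]; rewrite -addrA -scalerDl => Ccd.
  by have := cmax (c + d); rewrite inE => /(_ Ccd); lra.
apply: (step _ (x + c *: v) (1 - l)) => //; [by lra|by lra|].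
case=> d d0 [_ +]; rewrite -addrA -scalerBl => Ccd.
by have := cmin (c' - d); rewrite inE => /(_ Ccd); lra.
Qed.

End Minkowski.

(** * The space of probability measures *)

Section RieszOuterMeasure.
Context {R : realType} {T : topologicalType}.
Hypothesis cT : compact [set: T].
Implicit Types (f g h : T -> R) (c : R) (O : set T).

(** Only vanishing off [O] is required, not a support inside [O]; thresholds such as [f < d] do the
    work of compact supports. *)
Definition bump_fun (O : set T) (f : T -> R) :=
  [/\ continuous f, forall x, 0 <= f x <= 1 & forall x, ~ O x -> f x = 0].

(** The value 1 is reached at a finite stage. This lets finitely many [g] dominate a bump function
    up to [e], and lets the sets [g n = 1] exhaust [O] when two measures are compared. *)
Definition open_exhaustible := forall O : set T, open O -> exists g : nat -> T -> R,
  [/\ forall n, bump_fun O (g n), forall n x, g n x <= g n.+1 x &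
      forall x, O x -> exists n, g n x = 1].

Definition positive_functional (L : (T -> R) -> R) :=
  [/\ forall f g, continuous f -> continuous g -> L (fun x => f x + g x) = L f + L g,
      forall c f, continuous f -> L (fun x => c * f x) = c * L f,
      forall f, continuous f -> (forall x, 0 <= f x) -> 0 <= L f &
      L (fun=> 1) = 1].

Hypothesis exh : open_exhaustible.
Variable L : (T -> R) -> R.
Hypothesis hL : positive_functional L.

Let LD f g : continuous f -> continuous g -> L (fun x => f x + g x) = L f + L g.
Proof. by case: hL => + _ _ _; exact. Qed.

Let LZ c f : continuous f -> L (fun x => c * f x) = c * L f.
Proof. by case: hL => _ + _ _; exact. Qed.

Let Lge0 f : continuous f -> (forall x, 0 <= f x) -> 0 <= L f.
Proof. by case: hL => _ _ + _; exact. Qed.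

Let L1 : L (fun=> 1) = 1.
Proof. by case: hL. Qed.

Let cstc c : continuous (fun _ : T => c : R).
Proof. exact: cst_continuous. Qed.

Lemma functional_cst c : L (fun=> c) = c.
Proof.
by have := LZ c (@cstc 1); rewrite L1 mulr1.
Qed.

Lemma functional_le f g : continuous f -> continuous g ->
  (forall x, f x <= g x) -> L f <= L g.
Proof.
move=> cf cg fg; rewrite -subr_ge0.
have cnf : continuous (fun x => -1 * f x).
  by move=> x; apply: (@continuousM _ _ (fun=> -1) f); [exact: cst_continuous|exact: cf].
rewrite -mulN1r -LZ// -LD//; apply: Lge0; last by move=> x; rewrite mulN1r subr_ge0.
by move=> x; apply: (@continuousD _ _ _ g (fun x => -1 * f x)); [exact: cg|exact: cnf].
Qed.

Lemma continuous_sumf (I : Type) (s : seq I) (f : I -> T -> R) :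
  (forall i, continuous (f i)) -> continuous (fun x => \sum_(i <- s) f i x).
Proof.
move=> cf; elim: s => [|i s IH].
  by under eq_fun do rewrite big_nil; exact: cst_continuous.
under eq_fun do rewrite big_cons; move=> x.
by apply: (@continuousD _ _ _ (f i) (fun x => \sum_(j <- s) f j x)); [exact: cf|exact: IH].
Qed.

Lemma functional_sum (I : Type) (s : seq I) (f : I -> T -> R) :
  (forall i, continuous (f i)) -> L (fun x => \sum_(i <- s) f i x) = \sum_(i <- s) L (f i).
Proof.
move=> cf; elim: s => [|i s IH].
  by under eq_fun do rewrite big_nil; rewrite big_nil functional_cst.
by under eq_fun do rewrite big_cons; rewrite big_cons LD// ?IH//; exact: continuous_sumf.
Qed.

Definition open_mass (O : set T) : R := sup [set L f | f in bump_fun O].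

Let mass_has_sup O : has_sup [set L f | f in bump_fun O].
Proof.
split.
  exists (L (fun=> 0)), (fun=> 0) => //; split; [exact: cst_continuous| |by []].
  by move=> x; rewrite lexx ler01.
exists 1 => _ [f [cf f01 _] <-]; rewrite -L1; apply: functional_le => //.
by move=> x; case/andP: (f01 x).
Qed.

Lemma open_mass_ge O f : bump_fun O f -> L f <= open_mass O.
Proof. by move=> bf; apply: sup_upper_bound; [exact: mass_has_sup|exists f]. Qed.

Lemma open_mass_le O c : (forall f, bump_fun O f -> L f <= c) -> open_mass O <= c.
Proof.
move=> H; apply: ge_sup; first by have [] := mass_has_sup O.
by move=> _ [f bf <-]; exact: H.
Qed.

Lemma open_mass_ge0 O : 0 <= open_mass O.
Proof.
rewrite -(functional_cst 0); apply: open_mass_ge; split; [exact: cst_continuous| |by []].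
by move=> x; rewrite lexx ler01.
Qed.

Lemma le_open_mass O O' : O `<=` O' -> open_mass O <= open_mass O'.
Proof.
move=> OO'; apply: open_mass_le => f [cf f01 f0]; apply: open_mass_ge; split=> //.
by move=> x nO; apply: f0 => /OO'.
Qed.

Lemma open_massT : open_mass setT = 1.
Proof.
apply/eqP; rewrite eq_le; apply/andP; split.
  apply: open_mass_le => f [cf f01 _]; rewrite -L1; apply: functional_le => //.
  by move=> x; case/andP: (f01 x).
rewrite -L1; apply: open_mass_ge; split; first exact: cst_continuous.
  by move=> x; rewrite ler01 lexx.
by move=> x /(_ I).
Qed.

(** A Dini argument. Let [f] be a bump function of the union. At each point [f < G n + e] for some
    [n]: off the union [f] vanishes, and on [O i] some [g i n] reaches 1. The inequality persists
    nearby and for larger [n], so compactness gives one [n] for all points, and [L] turns it into a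
    bound by finitely many masses. *)
Lemma open_mass_sigma_subadditive (O : nat -> set T) : (forall n, open (O n)) ->
  ((open_mass (\bigcup_n O n))%:E <= \sum_(n <oo) (open_mass (O n))%:E)%E.
Proof.
move=> oO; apply/lee_addgt0Pr => e e0.
have S0 : (0 <= \sum_(n <oo) (open_mass (O n))%:E)%E.
  by apply: nneseries_ge0 => n _ _; rewrite lee_fin open_mass_ge0.
case Se : (\sum_(n <oo) (open_mass (O n))%:E)%E S0 => [s| |]// _; last first.
  by rewrite addye// leey.
rewrite -EFinD lee_fin; apply: open_mass_le => f [cf f01 f0].
have [g gP] : {g : nat -> nat -> T -> R & forall i,
  [/\ forall n, bump_fun (O i) (g i n), forall n x, g i n x <= g i n.+1 x &
      forall x, O i x -> exists n, g i n x = 1]}.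
  apply: (@choice _ _ (fun i (gi : nat -> T -> R) =>
    [/\ forall n, bump_fun (O i) (gi n), forall n x, gi n x <= gi n.+1 x &
      forall x, O i x -> exists n, gi n x = 1])) => i.
  exact/exh/oO.
have gc i n : continuous (g i n) by have [/(_ n) [] ] := gP i.
have g0 i n x : 0 <= g i n x by have [/(_ n) [_ /(_ x)/andP[] ]] := gP i.
have gm i n m x : (n <= m)%N -> g i n x <= g i m x.
  move=> /subnK <-; elim: (m - n)%N => // p IH.
  by rewrite addSn (le_trans IH)//; have [_ + _] := gP i; exact.
(* The same [n] counts the open sets and the stage of their exhaustions, which makes [G]
   nondecreasing in [n]. *)
pose G n x := \sum_(i < n) g i n x.
have Gc n : continuous (G n) by apply: continuous_sumf => i; exact: gc.
have Gm n m x : (n <= m)%N -> G n x <= G m x.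
  move=> nm; rewrite /G (big_ord_widen m (fun i => g i n x))// big_mkcond/=.
  by apply: ler_sum => i _; case: ifP => // _; exact: gm.
have near_f : \forall n \near \oo, [set: T] `<=` (fun x => f x < G n x + e).
  have /compact_near_coveringP/(_ nat \oo (fun n x => f x < G n x + e)) := cT; apply.
  move=> x _.
  have [n0 hn0] : exists n, f x < G n x + e.
    have [[i _ Oix]|nO] := pselect ((\bigcup_n O n) x); last first.
      by exists 0%N; rewrite f0// /G big_ord0 add0r.
    have [_ _ /(_ x Oix)[n gn]] := gP i.
    exists (maxn i.+1 n); have im : (i < maxn i.+1 n)%N by rewrite leq_maxl.
    have : g i (maxn i.+1 n) x <= G (maxn i.+1 n) x.
      by rewrite /G (bigD1 (Ordinal im))//= lerDl sumr_ge0.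
    have := gm i n (maxn i.+1 n) x (leq_maxr _ _).
    by case/andP: (f01 x); lra.
  have hx : \forall x' \near x, f x' < G n0 x' + e.
    have : continuous (fun x => G n0 x + e - f x).
      move=> y; apply: (@continuousB _ _ _ (fun x => G n0 x + e) f); last exact: cf.
      by apply: (@continuousD _ _ _ (G n0) (fun=> e)); [exact: Gc|exact: cst_continuous].
    move=> /(_ x); move/(cvgr_gt (G n0 x + e - f x)) => /(_ 0).
    rewrite subr_gt0 => /(_ hn0); apply: filterS => y.
    by rewrite subr_gt0.
  exists ([set x' | f x' < G n0 x' + e], [set n | (n0 <= n)%N]).
    by split=> //=; exists n0 => //=.
  move=> [x' n] /= [h nn]; apply: (lt_le_trans h); rewrite lerD2r.
  exact: Gm.
have [n /(_ _ I) fG] : exists n, forall x, setT x -> f x < G n x + e.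
  by have [n0 _ /(_ n0 (leqnn _))] := near_f; exists n0.
have : L f <= \sum_(i < n) L (g i n) + e.
  rewrite -(functional_cst e) -functional_sum// -LD//; last exact: Gc.
  apply: functional_le => //; last by move=> x; exact: ltW.
  by move=> y; apply: (@continuousD _ _ _ (G n) (fun=> e)); [exact: Gc|exact: cst_continuous].
move/le_trans; apply; rewrite lerD2r.
apply: (@le_trans _ _ (\sum_(i < n) open_mass (O i))).
  by apply: ler_sum => i _; apply: open_mass_ge; have [/(_ n)] := gP i.
rewrite -lee_fin -Se -sumEFin -(big_mkord xpredT (fun i => (open_mass (O i))%:E)).
by apply: nneseries_lim_ge => k _ _; rewrite lee_fin open_mass_ge0.
Qed.

Definition riesz_outer (E : set T) : \bar R :=
  ereal_inf [set (open_mass O)%:E | O in [set O | open O /\ E `<=` O]].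

Local Open Scope ereal_scope.

Lemma riesz_outer_ge0 E : 0 <= riesz_outer E.
Proof. by apply: le_ereal_inf_tmp => _ [ O _ <-]; rewrite lee_fin open_mass_ge0. Qed.

Lemma riesz_outer_open O : open O -> riesz_outer O = (open_mass O)%:E.
Proof.
move=> oO; apply/eqP; rewrite eq_le; apply/andP; split.
  by apply: ereal_inf_lbound; exists O => //; split.
by apply: le_ereal_inf_tmp => _ [ O' [_ OO'] <-]; rewrite lee_fin le_open_mass.
Qed.

Lemma le_riesz_outer : {homo riesz_outer : A B / A `<=` B >-> A <= B}.
Proof.
move=> A B AB; apply/ereal_inf_le_tmp => _ [ O [oO BO] <-].
by exists O => //; split => //; exact: subset_trans AB BO.
Qed.

Lemma riesz_outer0 : riesz_outer set0 = 0.
Proof.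
rewrite riesz_outer_open; last exact: open0.
congr EFin; apply/eqP; rewrite eq_le open_mass_ge0 andbT.
apply: open_mass_le => f [_ _ f0].
by rewrite (_ : f = fun=> 0%R) ?functional_cst//; apply/funext => x; exact: f0.
Qed.

Lemma riesz_outer_fin E : riesz_outer E \is a fin_num.
Proof.
rewrite ge0_fin_numE ?riesz_outer_ge0//.
apply: (@le_lt_trans _ _ (riesz_outer setT)); first exact: le_riesz_outer.
by rewrite riesz_outer_open ?ltry//; exact: openT.
Qed.

Lemma riesz_outer_adherent E (e : R) : (0 < e)%R -> exists O,
  [/\ open O, E `<=` O & (open_mass O)%:E <= riesz_outer E + e%:E].
Proof.
move=> e0; have [_ [ O [oO EO] <-] h] := lb_ereal_inf_adherent e0 (riesz_outer_fin E).
by exists O; split => //; exact: ltW.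
Qed.

Lemma riesz_outer_sigma_subadditive : sigma_subadditive riesz_outer.
Proof.
move=> A; apply/lee_addgt0Pr => e e0.
apply: le_trans (epsilon_trick xpredT _ (ltW e0)); last by move=> n; exact: riesz_outer_ge0.
have [ O OP] : {O : nat -> set T & forall n, [/\ open (O n), A n `<=` O n &
    (open_mass (O n))%:E <= riesz_outer (A n) + (e / (2 ^ n.+1)%:R)%:E]}.
  apply: (@choice _ _ (fun n On => [/\ open On, A n `<=` On &
    (open_mass On)%:E <= riesz_outer (A n) + (e / (2 ^ n.+1)%:R)%:E])) => n.
  by apply: riesz_outer_adherent; rewrite divr_gt0// ltr0n expn_gt0.
apply: (@le_trans _ _ (open_mass (\bigcup_n O n))%:E).
  apply: ereal_inf_lbound; exists (\bigcup_n O n) => //; split.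
    by apply: bigcup_open => n _; have [] := OP n.
  by move=> x [n _ Ax]; exists n => //; have [_ + _] := OP n; exact.
apply: (le_trans (open_mass_sigma_subadditive _)); first by move=> n; have [] := OP n.
apply: lee_nneseries => n _; first by rewrite lee_fin open_mass_ge0.
by have [] := OP n.
Qed.

HB.instance Definition _ := isOuterMeasure.Build R T riesz_outer
  riesz_outer0 riesz_outer_ge0 le_riesz_outer riesz_outer_sigma_subadditive.

Definition riesz_outer_measure : {outer_measure set T -> \bar R} := riesz_outer.

(** Take an open [O'] around [X] of nearly the same mass and a bump function [f] of the intersection
    of [O'] and [O]. The part [O2] of [O'] where [f < d] is open and contains the rest of [O']. If
    [h] is a bump function of [O2], then [(h + f) / (1 + d)] is one of [O'], since [h] vanishes
    wherever [f >= d]; so the masses add up to at most [(1 + d)] times that of [O']. *)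
Lemma open_riesz_caratheodory O : open O -> riesz_outer.-caratheodory O.
Proof.
move=> oO; apply: le_caratheodory_measurable => X.
apply/lee_addgt0Pr => e e0.
have [ O' [oO' XO' O'e]] := riesz_outer_adherent X e0.
apply: (le_trans _ O'e).
apply: (@le_trans _ _ (riesz_outer (O' `&` O) + riesz_outer (O' `&` ~` O))).
  by apply: leeD; apply: le_riesz_outer; exact: setSI.
rewrite riesz_outer_open; last exact: openI.
rewrite -(fineK (riesz_outer_fin (O' `&` ~` O))) -EFinD lee_fin.
set r := fine _; have re : riesz_outer (O' `&` ~` O) = r%:E by rewrite fineK// riesz_outer_fin.
suff H f : bump_fun (O' `&` O) f -> (L f + r <= open_mass O')%R.
  by rewrite -lerBrDr; apply: open_mass_le => f /H; rewrite -lerBrDr.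
move=> [cf f01 f0]; apply/ler_addgt0Pr => d d0.
pose O2 := O' `&` [set x | (f x < d)%R].
have oO2 : open O2.
  apply: openI => //; apply: (@open_comp _ _ f [set x | (x < d)%R]); first by move=> x _; exact: cf.
  exact: open_lt.
have rO2 : (r <= open_mass O2)%R.
  rewrite -lee_fin -re -riesz_outer_open//; apply: le_riesz_outer => x [ O'x nOx].
  by split => //=; rewrite f0// => -[].
suff : (open_mass O2 <= (1 + d) * open_mass O' - L f)%R.
  have : (open_mass O' <= 1)%R by rewrite -open_massT le_open_mass.
  by have := open_mass_ge0 O'; nra.
apply: open_mass_le => h [ch h01 h0]; rewrite lerBrDr -LD//.
have d1 : (0 < 1 + d)%R by rewrite addr_gt0.
have chf : continuous (fun x => h x + f x)%R.
  by move=> x; apply: (@continuousD _ _ _ h f); [exact: ch|exact: cf].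
rewrite mulrC -ler_pdivrMr// mulrC -LZ//; apply: open_mass_ge; split.
- by move=> x; apply: (@continuousM _ _ (fun=> (1 + d)^-1)%R (fun x => h x + f x)%R); [exact: cst_continuous|exact: chf].
- move=> x; rewrite mulrC divr_ge0 ?(ltW d1)//=; last first.
    by apply: addr_ge0; [have /andP[] := h01 x|have /andP[] := f01 x].
  rewrite ler_pdivrMr// mul1r.
  have [fd|fd] := ltP (f x) d; first by have /andP[_ ?] := h01 x; lra.
  rewrite h0; first by have /andP[_ ?] := f01 x; lra.
  by case=> _ /=; rewrite ltNge fd.
- move=> x nO'; rewrite h0; last by case.
  by rewrite f0 ?addr0 ?mulr0//; case.
Qed.

End RieszOuterMeasure.

(** * Exhaustion of open sets by Urysohn functions *)

Section Exhaustion.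
Context {R : realType} {T : topologicalType}.
Hypothesis cT : compact [set: T].
Hypothesis hT : hausdorff_space T.

Lemma bump_max (O : set T) (f g : T -> R) :
  bump_fun O f -> bump_fun O g -> bump_fun O (fun x => Num.max (f x) (g x)).
Proof.
move=> [cf f01 f0] [cg g01 g0]; split.
- by move=> x; apply: continuous_max; [exact: cf|exact: cg].
- move=> x; have /andP[? ?] := f01 x; have /andP[? ?] := g01 x.
  by rewrite le_max ge_max; apply/andP; split; [apply/orP; left|apply/andP].
- by move=> x nO; rewrite f0// g0// maxxx.
Qed.

(** Each basic open set with closure inside [O] has a Urysohn function equal to 1 on that closure
    and 0 off [O]; indices without such a set get the zero function. Running maxima give the
    sequence, and regularity puts every point of [O] in such a basic set. *)
Lemma second_countable_exhaustible : @second_countable T -> @open_exhaustible R T.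
Proof.
move=> [B cB [Bo Bb]] O oO.
have nT : normal_space T by exact: compact_normal.
have /countable_injP[i iB] := cB.
pose good n (U : set T) := [/\ B U, i U = n & closure U `<=` O].
have sep n : exists f : T -> R, bump_fun O f /\
    forall U, good n U -> forall x, closure U x -> f x = 1.
  have [[U gU]|/forallNP nU] := pselect (exists U, good n U); last first.
    exists (fun=> 0); split; last by move=> U /nU.
    split=> // [x|x]; [exact: cst_continuous|by rewrite lexx ler01].
  have [BU iU cU] := gU.
  have sU : uniform_separator (~` O) (closure U).
    apply: normal_uniform_separator => //; [exact: open_closedC|exact: closed_closure|].
    by apply/disjoints_subset => x nO /cU.
  exists (Urysohn (~` O) (closure U)); split.
    split; first exact: Urysohn_continuous.
      move=> x; have : range (@Urysohn T R (~` O) (closure U)) (Urysohn (~` O) (closure U) x) by exists x.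
      by move=> /Urysohn_range; rewrite /= in_itv.
    move=> x nO; have : [set @Urysohn T R (~` O) (closure U) y | y in ~` O] (Urysohn (~` O) (closure U) x) by exists x.
    by move=> /(Urysohn_sub0 sU).
  move=> U' [BU' iU' cU'] x cx.
  have UU' : U' = U by apply: iB; rewrite ?inE// iU iU'.
  have : [set @Urysohn T R (~` O) (closure U) y | y in closure U] (Urysohn (~` O) (closure U) x).
    by exists x; rewrite // -UU'.
  by move=> /(Urysohn_sub1 sU).
have [f fP] : {f : nat -> T -> R & forall n, bump_fun O (f n) /\
    forall U, good n U -> forall x, closure U x -> f n x = 1}.
  exact: (@choice _ _ (fun n (fn : T -> R) => bump_fun O fn /\
    forall U, good n U -> forall x, closure U x -> fn x = 1)).
pose g := fix g n := if n is n'.+1 then fun x => Num.max (g n' x) (f n x) else f 0%N.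
have gb n : bump_fun O (g n).
  elim: n => [|n IH]; first exact: (fP 0%N).1.
  exact: bump_max IH (fP n.+1).1.
exists g; split=> //.
  by move=> n x; rewrite /= le_max lexx.
move=> x Ox.
have [U [BU Ux cU]] : exists U, [/\ B U, U x & closure U `<=` O].
  have clx : closed [set x] by apply: accessible_closed_set1; exact: hausdorff_accessible.
  have nO : set_nbhs [set x] O by move=> y ->; exact: open_nbhs_nbhs.
  have [V sV VO] := nT _ clx _ nO.
  have /Bb[U [BU Ux] UV] : nbhs x V by exact: sV.
  by exists U; split => //; apply: subset_trans VO; exact: closureS.
exists (i U).
have fU : f (i U) x = 1.
  by apply: (fP (i U)).2 (subset_closure Ux); split.
have g1 : g (i U) x <= 1 by have [_ /(_ x)/andP[]] := gb (i U).
apply/eqP; rewrite eq_le g1/= -fU.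
by case: (i U) => //= n; rewrite le_max lexx orbT.
Qed.

End Exhaustion.

Lemma min_slice {R : realType} (y c d : R) : 0 <= d ->
  let s := Num.min y (c + d) - Num.min y c in
  [/\ 0 <= s, s <= d, y <= c -> s = 0 & c + d < y -> s = d].
Proof.
by move=> d0 /=; have [h1|h1] := leP y c; have [h2|h2] := leP y (c + d); split; lra.
Qed.

(** * Borel probability measures on [M] and the Riesz representation *)

Section BorelSub.
Context {R : realType} {Z : topologicalType} {M : set Z} (x0 : M).
Hypothesis cM : compact [set: M].
Notation BT := (borel_sub M x0).
Implicit Types P Q : probability BT R.

Lemma open_borel (O : set M) : open O -> measurable (O : set BT).
Proof. by move=> oO; apply: sub_sigma_algebra. Qed.

Lemma continuous_borel (f : M -> R) : continuous f ->
  measurable_fun [set: BT] (f : BT -> R).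
Proof.
move=> cf; apply: (measurability _ (RGenOInfty.measurableE R)).
move=> _ [_ [y ->] <-]; rewrite setTI; apply: open_borel.
by apply: open_comp; [move=> x _; exact: cf|exact: interval_open].
Qed.

Lemma continuous_compact_bounded (f : M -> R) : continuous f ->
  exists2 K, 0 < K & forall x, `|f x| <= K.
Proof.
move=> cf; have : compact (f @` setT).
  by apply: continuous_compact => //; exact: continuous_subspaceT.
move=> /compact_bounded [K [_ Kf]].
exists (`|K| + 1); first by rewrite ltr_wpDl.
move=> x; apply: (Kf (`|K| + 1)); last by exists x.
by rewrite (le_lt_trans (ler_norm _))// ltrDl.
Qed.

Lemma continuous_integrable P (f : M -> R) : continuous f ->
  P.-integrable [set: BT] (EFin \o f).
Proof.
move=> cf; apply: measurable_bounded_integrable => //.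
- by rewrite fin_num_fun_lty//; exact: fin_num_measure.
- exact: continuous_borel.
have [K K0 fK] := continuous_compact_bounded cf.
exists K; split=> [|z Kz x _]; first exact: num_real.
exact: le_trans (fK x) (ltW Kz).
Qed.

Lemma mean_positive_functional P :
  positive_functional (fun f : M -> R => \int[P]_x (f : BT -> R) x).
Proof.
split.
- by move=> f g cf cg; rewrite RintegralD//; exact: continuous_integrable.
- by move=> c f cf; rewrite RintegralZl//; exact: continuous_integrable.
- by move=> f cf f0; apply: Rintegral_ge0 => x _; exact: f0.
- by rewrite Rintegral_cst// mul1r -[RHS]/(fine 1%:E); congr fine; exact: probability_setT.
Qed.

Section RieszMeasure.
Hypothesis exh : @open_exhaustible R M.
Variable L : (M -> R) -> R.
Hypothesis hL : positive_functional L.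

Let mu : {outer_measure set (pointed_sub x0) -> \bar R} := riesz_outer_measure cM exh hL.

Let borel_caratheodory (A : set BT) : measurable A -> mu.-caratheodory A.
Proof.
have cs : sigma_algebra setT mu.-caratheodory.
  exact: (@sigma_algebra_measurable _ (caratheodory_type mu)).
by apply: (smallest_sub cs) => O oO; exact: open_riesz_caratheodory.
Qed.

Definition riesz_measure (A : set BT) : \bar R := riesz_outer L A.

Let riesz_measure0 : riesz_measure set0 = 0%E.
Proof. exact: riesz_outer0 hL. Qed.

Let riesz_measure_ge0 A : (0 <= riesz_measure A)%E.
Proof. exact: riesz_outer_ge0 hL A. Qed.

Let riesz_measure_sigma_additive : semi_sigma_additive riesz_measure.
Proof.
move=> A mA tA mbA; apply: (@caratheodory_measure_sigma_additive _ _ mu) => //.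
  by move=> i; exact: borel_caratheodory.
exact: borel_caratheodory.
Qed.

HB.instance Definition _ := isMeasure.Build _ BT R riesz_measure
  riesz_measure0 riesz_measure_ge0 riesz_measure_sigma_additive.

Let riesz_measureT : riesz_measure setT = 1%E.
Proof.
by rewrite /riesz_measure (riesz_outer_open hL); [rewrite (open_massT hL)|exact: openT].
Qed.

HB.instance Definition _ :=
  Measure_isProbability.Build _ BT R riesz_measure riesz_measureT.

Definition riesz_prob : probability BT R := riesz_measure.

Let riesz_prob_open O : open O -> riesz_prob O = (open_mass L O)%:E.
Proof. by move=> oO; rewrite /riesz_prob/= /riesz_measure (riesz_outer_open hL). Qed.

Let I (f : M -> R) := \int[riesz_prob]_x (f : BT -> R) x.

Let hI : positive_functional I.
Proof. exact: mean_positive_functional. Qed.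

(* Layer cake: f is cut at the levels i/N. N times the slice between i/N and
   (i+1)/N is a bump function on {f > i/N} and is at least the indicator of
   {f > (i+1)/N}. *)
Let riesz_le01 (f : M -> R) : continuous f -> (forall x, 0 <= f x <= 1) ->
  L f <= I f.
Proof.
move=> cf f01; apply/ler_addgt0Pr => e e0.
(* The number of levels is chosen so that [1 / N <= e]. *)
pose N := (Num.trunc e^-1).+1.
have N0 : 0 < N%:R :> R by rewrite ltr0n.
have Ne : N%:R^-1 <= e.
  by rewrite invf_ple ?posrE// ltW// truncnS_gt.
pose m (i : nat) (x : M) : R := Num.min (f x) (i%:R / N%:R).
pose s (i : nat) (x : M) : R := m i.+1 x - m i x.
have mc i : continuous (m i).
  by move=> x; apply: (@continuous_min _ _ f (fun=> i%:R / N%:R)); [exact: cf|exact: cst_continuous].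
have sc i : continuous (s i).
  by move=> x; apply: (@continuousB _ _ _ (m i.+1) (m i)); exact: mc.
have lev i : i.+1%:R / N%:R = i%:R / N%:R + N%:R^-1 :> R.
  by rewrite -natr1 mulrDl mul1r.
have iN : 0 < N%:R^-1 :> R by rewrite invr_gt0.
have sl i x := min_slice (f x) (i%:R / N%:R) (ltW iN).
have s0 i x : 0 <= s i x by rewrite /s /m lev; have [] := sl i x.
have s1 i x : s i x <= N%:R^-1 by rewrite /s /m lev; have [] := sl i x.
have sup i x : ~ (i%:R / N%:R < f x) -> s i x = 0.
  by move=> /negP; rewrite -leNgt /s /m lev; have [_ _ + _] := sl i x.
have sbig i x : i.+1%:R / N%:R < f x -> s i x = N%:R^-1.
  by rewrite /s /m lev; have [_ _ _] := sl i x.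
pose O i := [set x | i%:R / N%:R < f x].
have oO i : open (O i).
  apply: (@open_comp _ _ f [set y | i%:R / N%:R < y]); last exact: open_gt.
  by move=> x _; exact: cf.
have bO i : measurable (O i : set BT) by apply: open_borel; exact: (oO i).
have fs x : f x = \sum_(i < N) s i x.
  rewrite -(big_mkord xpredT (fun i => s i x)) telescope_sumr// /m mul0r divff ?gt_eqF//.
  have /andP[f0 f1] := f01 x.
  by rewrite (min_idPl f1) (min_idPr f0) subr0.
have LN i : N%:R * L (s i) <= open_mass L (O i).
  have [_ LZ _ _] := hL; rewrite -LZ//; apply: (open_mass_ge hL); split.
  - by move=> x; apply: (@continuousM _ _ (fun=> N%:R) (s i)); [exact: cst_continuous|exact: sc].
  - move=> x; rewrite mulr_ge0 ?ler0n// ?s0//= mulrC -ler_pdivlMr// mul1r; exact: s1.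
  - by move=> x nO; rewrite sup// mulr0.
have IN i : open_mass L (O i.+1) <= N%:R * I (s i).
  have [_ IZ _ _] := hI; rewrite -(IZ _ _ (@sc i)).
  have -> : open_mass L (O i.+1) = \int[riesz_prob]_x (\1_(O i.+1) x).
    rewrite /Rintegral integral_indic//.
    rewrite setIT -[LHS]/(fine (open_mass L (O i.+1))%:E); congr fine.
    exact: (esym (riesz_prob_open (oO i.+1))).
  apply: le_Rintegral => //.
  - apply: integrable_indic => //.
  - apply: continuous_integrable.
    by move=> x; apply: (@continuousM _ _ (fun=> N%:R) (s i)); [exact: cst_continuous|exact: sc].
  - move=> x _; rewrite indicE; case: (boolP (x \in _)) => [/set_mem Ox|_] /=.
      by rewrite sbig// mulfV ?gt_eqF.
    by rewrite mulr_ge0 ?ler0n ?s0.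
have fE : f = fun x => \sum_(i < N) s i x by apply/funext.
have Lf : L f = \sum_(i < N) L (s i) by rewrite [in LHS]fE (functional_sum hL).
have If : I f = \sum_(i < N) I (s i) by rewrite [in LHS]fE (functional_sum hI).
have I0 i : 0 <= I (s i) by have [_ _ + _] := hI; apply.
suff : N%:R * L f <= 1 + N%:R * I f.
  move=> h; rewrite -(ler_pM2l N0); apply: (le_trans h).
  rewrite mulrDr addrC lerD2l -ler_pdivrMl//.
  by rewrite mulr1.
rewrite Lf If !mulr_sumr.
apply: (@le_trans _ _ (\sum_(i < N) open_mass L (O i))).
  by apply: ler_sum => i _; exact: LN.
(* The masses bounding [L] start at level 0, those bounded by [I] at level 1. The shift leaves over
   the mass of [O 0], at most 1, which becomes [1 / N] after division. *)
rewrite /N big_ord_recl big_ord_recr/= lerD//.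
  by rewrite -(open_massT hL); exact: (le_open_mass hL).
rewrite -[leLHS]addr0 lerD//; last by rewrite mulr_ge0 ?ler0n.
by apply: ler_sum => i _; exact: IN.
Qed.

(** With [c = (2 * K)^-1] and its opposite, [c * f + 2^-1] takes values in [0, 1]; the one-sided
    inequality applied to both signs gives equality. *)
Lemma riesz_representation (f : M -> R) : continuous f ->
  \int[riesz_prob]_x (f : BT -> R) x = L f.
Proof.
move=> cf; have [K K0 fK] := continuous_compact_bounded cf.
have [LD LZ _ L1] := hL; have [ID IZ _ I1] := hI.
suff H c : `|c| = (2 * K)^-1 -> L (fun x => c * f x + 2^-1) <= I (fun x => c * f x + 2^-1).
  have aff J (hJ : positive_functional J) c : J (fun x => c * f x + 2^-1) = c * J f + 2^-1.
    have [JD JZ _ _] := hJ; rewrite JD ?JZ// ?(functional_cst hJ)//; last exact: cst_continuous.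
    by move=> x; apply: (@continuousM _ _ (fun=> c) f); [exact: cst_continuous|exact: cf].
  have c0 : 0 < (2 * K)^-1 by rewrite invr_gt0 mulr_gt0.
  apply/eqP; rewrite eq_le -/(I f); apply/andP; split.
    have := H (- (2 * K)^-1); rewrite normrN gtr0_norm// => /(_ erefl).
    by rewrite !aff// lerD2r !mulNr lerN2 ler_pM2l.
  have := H (2 * K)^-1; rewrite gtr0_norm// => /(_ erefl).
  by rewrite !aff// lerD2r ler_pM2l.
move=> ce; apply: riesz_le01.
  move=> x; apply: (@continuousD _ _ _ (fun x => c * f x) (fun=> 2^-1)); last exact: cst_continuous.
  by apply: (@continuousM _ _ (fun=> c) f); [exact: cst_continuous|exact: cf].
move=> x; have : `|c * f x| <= 2^-1.
  by rewrite normrM ce invfM -mulrA ler_piMr// mulrC ler_pdivrMr// mul1r.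
by rewrite ler_norml; lra.
Qed.

End RieszMeasure.

End BorelSub.

Lemma real_cvg_unique {R : realType} {T : Type} {F : set_system T}
    {FF : ProperFilter F} (h : T -> R) (a b : R) :
  h @ F --> a -> h @ F --> b -> a = b.
Proof. by move=> ha hb; exact: (cvg_unique (@Rhausdorff R) ha hb). Qed.

(** * Weak* compactness and pushforward of probability measures *)

Section WeakTopology.
Context {R : realType} {Z : topologicalType} {M : set Z} (x0 : M).
Hypothesis cM : compact [set: M].
Hypothesis hM : hausdorff_space M.
Hypothesis scM : @second_countable M.
Notation BT := (borel_sub M x0).
Implicit Types P Q nu : probability BT R.

Let exh : @open_exhaustible R M.
Proof. exact: second_countable_exhaustible. Qed.

Lemma cvg_initial (S : choiceType) (T : topologicalType) (f : S -> T)
    (F : set_system S) (s : S) : Filter F ->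
  f @ F --> f s -> F --> (s : initial_topology f).
Proof.
move=> FF cvF A /= [_ [[B Bop <-] Bfs sBfA]].
by apply: filterS sBfA _; apply: cvF; exact: open_nbhs_nbhs.
Qed.

Let mean_at (f : M -> R) (Q : weak_prob R x0) : R := \int[Q]_x (f : BT -> R) x.

Lemma weak_prob_cvg (F : set_system (weak_prob R x0)) P : Filter F ->
  (forall f : M -> R, continuous f ->
     mean_at f @ F --> mean_at f P) ->
  F --> (P : weak_prob R x0).
Proof.
move=> FF H; apply: cvg_initial; apply/cvg_sup => f; apply: cvg_initial.
by apply: (H f); exact: cts_fun.
Qed.

Lemma weak_prob_mean_continuous (f : M -> R) : continuous f ->
  continuous (fun Q : weak_prob R x0 => \int[Q]_x (f : BT -> R) x).
Proof.
move=> cf; pose g : continuousType M R := mkcts cf.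
rewrite (_ : (fun _ => _) = @proj _ (fun _ : continuousType M R => R) g \o
   (fun nu : probability BT R => (fun f : continuousType M R => \int[nu]_x f x)
      : prod_topology (fun _ : continuousType M R => R))) //.
move=> Q; apply: (@continuous_comp (weak_prob R x0)
    (prod_topology (fun _ : continuousType M R => R)) R).
  exact: initial_continuous.
exact: proj_continuous.
Qed.

Lemma mean_bound P (f : M -> R) K : continuous f -> (forall x, `|f x| <= K) ->
  `|\int[P]_x (f : BT -> R) x| <= K.
Proof.
move=> cf fK; have hP := mean_positive_functional cM P.
have fK' x : - K <= f x <= K by rewrite -ler_norml.
rewrite ler_norml; apply/andP; split.
  rewrite -(functional_cst hP (- K)); apply: (functional_le hP) => //.
    exact: cst_continuous.
  by move=> x; case/andP: (fK' x).
rewrite -[leRHS](functional_cst hP K); apply: (functional_le hP) => //.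
  exact: cst_continuous.
by move=> x; case/andP: (fK' x).
Qed.

(** Along an ultrafilter the means of each continuous [f] stay in a segment and so converge. The
    limits form a positive functional, and its Riesz measure is the limit of the ultrafilter. *)
Lemma weak_prob_compact : compact [set: weak_prob R x0].
Proof.
rewrite compact_ultra => F UF _.
have exlim (f : M -> R) : continuous f ->
    exists l : R, mean_at f @ F --> l.
  move=> cf; have [K K0 fK] := continuous_compact_bounded cM cf.
  set h := mean_at f.
  have Fs : (h @ F) `[- K, K]%classic.
    apply: (@filterS _ F _ setT); last exact: filterT.
    by move=> Q _; rewrite /= in_itv/= -ler_norml; exact: mean_bound.
  (* A cluster point is a limit here, because an ultrafilter contains the preimage of [U] or its
     complement. *)
  have [l [_ cl]] := @segment_compact R (- K) K _ (fmap_proper_filter h _) Fs.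
  exists l => U nU; rewrite /fmap /=.
  have [//|nF] := in_ultra_setVsetC (h @^-1` U) UF.
  by have [y [/= ny Uy]] := cl (~` U) U nF nU.
pose L (f : M -> R) := lim (mean_at f @ F).
have Lc f : continuous f -> mean_at f @ F --> L f.
  by move=> /exlim /cvg_ex.
have hL : positive_functional L.
  have uq (h : weak_prob R x0 -> R) (a b : R) : h @ F --> a -> h @ F --> b -> a = b.
    exact: real_cvg_unique.
  have hP Q := mean_positive_functional (R := R) (x0 := x0) cM Q.
  split.
  - move=> f g cf cg.
    have cfg : continuous (fun x => f x + g x).
      by move=> x; apply: (@continuousD _ _ _ f g); [exact: cf|exact: cg].
    apply: uq (Lc _ cfg) _.
    rewrite (_ : mean_at _ = (fun Q => mean_at f Q + mean_at g Q)).
      by apply: cvgD; exact: Lc.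
    by apply/funext => Q; have [+ _ _ _] := hP Q; exact.
  - move=> c f cf.
    have ccf : continuous (fun x => c * f x).
      by move=> x; apply: (@continuousM _ _ (fun=> c) f); [exact: cst_continuous|exact: cf].
    apply: uq (Lc _ ccf) _.
    rewrite (_ : mean_at _ = (fun Q => c * mean_at f Q)).
      by apply: cvgM; [exact: cvg_cst|exact: Lc].
    by apply/funext => Q; have [_ + _ _] := hP Q; exact.
  - move=> f cf f0.
    have /cvg_lim <- // := Lc f cf.
    apply: limr_ge; first by apply/cvg_ex; exists (L f); exact: Lc.
    by near=> Q; apply: Rintegral_ge0 => x _; exact: f0.
  - have c1 : continuous (fun _ : M => 1 : R) by exact: cst_continuous.
    apply: uq (Lc _ c1) _.
    rewrite (_ : mean_at _ = (fun Q => 1)); first exact: cvg_cst.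
    by apply/funext => Q; have [_ _ _ +] := hP Q.
exists (riesz_prob x0 cM exh hL); split => //.
apply: weak_prob_cvg => f cf; rewrite /mean_at (riesz_representation x0 cM exh hL cf).
exact: Lc.
Unshelve. all: by end_near. Qed.

Lemma mean_indic P (A : set BT) : measurable A -> (\int[P]_x \1_A x)%:E = P A.
Proof.
move=> mA; rewrite /Rintegral integral_indic// setIT fineK//; exact: fin_num_measure.
Qed.

(** The open sets form a pi-system, so equality on them is enough. For open [O] exhausted by [g],
    the measure of [g n = 1] is at most the mean of [g n], which is common to both measures and at
    most the measure of [O]. *)
Lemma borel_prob_unique P Q :
  (forall f : M -> R, continuous f -> \int[P]_x (f : BT -> R) x = \int[Q]_x (f : BT -> R) x) ->
  forall E : set BT, measurable E -> P E = Q E.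
Proof.
move=> PQ.
have le P' Q' : (forall f : M -> R, continuous f ->
      \int[P']_x (f : BT -> R) x = \int[Q']_x (f : BT -> R) x) ->
    forall O : set M, open O -> (P' (O : set BT) <= Q' (O : set BT))%E.
  move=> {}PQ O oO; have [g [gb gm g1]] := exh oO.
  pose E n : set M := [set x | g n x = 1].
  have gc n : continuous (g n) by have [] := gb n.
  have mO : measurable (O : set BT) by exact: open_borel.
  have mE n : measurable (E n : set BT).
    rewrite (_ : E n = ~` (g n @^-1` [set~ 1])); last first.
      by apply/seteqP; split=> x /=; rewrite ?notK//; move=> /contrapT.
    apply: measurableC; apply: open_borel.
    apply: (@open_comp _ _ (g n) [set~ 1]); first by move=> x _; exact: gc.
    by rewrite openC; exact: closed_eq.
  have EO n : E n `<=` O.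
    move=> x gx; apply: contrapT => nO; have [_ _ /(_ x nO)] := gb n.
    by rewrite gx => /eqP; rewrite oner_eq0.
  have OE : \bigcup_n E n = O.
    by apply/seteqP; split=> [x [n _ /EO]//|x /g1[n gn]]; exists n.
  have ndE : nondecreasing_seq E.
    apply/nondecreasing_seqP => n; apply/subsetPset => x gx; apply/eqP.
    have [_ /(_ x)/andP[_ g1']  _] := gb n.+1.
    by rewrite eq_le g1'/= -{1}gx; exact: gm.
  have := @nondecreasing_cvg_mu _ _ _ P' E mE; rewrite OE => /(_ mO ndE) cv.
  have PE n : (P' (E n : set BT) <= Q' (O : set BT))%E.
    rewrite -!mean_indic// lee_fin.
    apply: (@le_trans _ _ (\int[P']_x (g n : BT -> R) x)).
      apply: le_Rintegral => //; [exact: integrable_indic|exact: continuous_integrable|].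
      move=> x _; rewrite indicE; case: (boolP (x \in _)) => [/set_mem -> //|_] /=.
      by have [_ /(_ x)/andP[]] := gb n.
    rewrite PQ//; apply: le_Rintegral => //; [exact: continuous_integrable|exact: integrable_indic|].
    move=> x _; rewrite indicE; case: (boolP (x \in _)) => [_|/negP nO] /=.
      by have [_ /(_ x)/andP[]] := gb n.
    by have [_ _ ->] := gb n => // /mem_set.
  rewrite -(cvg_lim (@ereal_hausdorff _) cv); apply: lime_le.
    by apply/cvg_ex; exists (P' (O : set BT)).
  by apply: nearW => n; exact: PE.
move=> E mE; apply: (@measure_unique _ R BT (@open M) (fun=> setT) _ _ _ _ P Q) => //.
- exact: openI.
- by move=> _; exact: openT.
- by rewrite bigcup_const.
- move=> O oO; apply/eqP; rewrite eq_le; apply/andP; split; apply: le => // f cf.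
  by rewrite PQ.
- by move=> _; rewrite fin_num_fun_lty//; exact: fin_num_measure.
Qed.

(** The relation [pushes] for an arbitrary self-map, so that flows can be treated without reference
    to the group. *)
Definition is_push (phi : M -> M) (nu nu' : probability BT R) : Prop :=
  forall E : set BT, measurable E ->
    nu' E = pushforward (T1 := BT) (T2 := BT) nu phi E.

Lemma continuous_borel_map (phi : M -> M) : continuous phi ->
  measurable_fun [set: BT] (phi : BT -> BT).
Proof.
move=> cphi; apply: (@measurability _ _ BT BT setT phi (@open M)) => //.
move=> _ [ O oO <-]; rewrite setTI; apply: open_borel.
by apply: open_comp => // x _; exact: cphi.
Qed.

Lemma push_exists (phi : M -> M) nu : continuous phi -> exists nu' : probability BT R, is_push phi nu nu'.
Proof.
move=> cphi.
pose X : {mfun BT >-> BT} := HB.pack (phi : BT -> BT)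
  (@isMeasurableFun.Build _ _ BT BT (phi : BT -> BT) (continuous_borel_map cphi)).
by exists (distribution nu X).
Qed.

Lemma push_integral (phi : M -> M) nu (nu' : probability BT R) (f : M -> R) : continuous phi ->
  is_push phi nu nu' -> continuous f ->
  \int[nu']_x (f : BT -> R) x = \int[nu]_x ((f \o phi) : BT -> R) x.
Proof.
move=> cphi h cf; congr fine.
transitivity (\int[pushforward (T1 := BT) (T2 := BT) nu phi]_x (EFin \o (f : BT -> R)) x)%E.
  apply: eq_measure_integral; first exact: continuous_borel_map.
  by move=> ? A mA _; exact: h.
rewrite (integral_pushforward (continuous_borel_map cphi)) ?preimage_setT//.
  by apply/measurable_EFinP; exact: continuous_borel.
apply: (@continuous_integrable _ _ _ x0 cM nu (f \o phi)).
by move=> x; apply: continuous_comp; [exact: cphi|exact: cf].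
Qed.

Lemma is_pushP (phi : M -> M) nu (nu' : probability BT R) : continuous phi ->
  (forall f : M -> R, continuous f ->
    \int[nu']_x (f : BT -> R) x = \int[nu]_x ((f \o phi) : BT -> R) x) ->
  is_push phi nu nu'.
Proof.
move=> cphi H; have [nu2 h2] := push_exists nu cphi.
move=> E mE; rewrite -h2//; apply: borel_prob_unique => // f cf.
by rewrite H// (push_integral cphi h2).
Qed.

End WeakTopology.

(** * Gradient flows of a vector group *)

Section RadialIntegral.
Context {R : realType}.
Notation leb := (@lebesgue_measure R).
Implicit Types t s : R.
(** In use, [K t s] is the integrand of [flow_potential] at [u + t *: v], [L t s] the moment paired
    with [v] at the same point, and [sg] the derivative of [L] in [s]. The bound is asked on an open
    interval containing [0, 1]. *)
Variables (K L sg : R -> R -> R) (C : R).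
Hypothesis dK : forall t s, is_derive t 1 (K ^~ s) (s * sg t s + L t s).
Hypothesis dL : forall t s, is_derive s 1 (L t) (sg t s).
Hypothesis cK : forall t, continuous (K t).
Hypothesis csg : forall t, continuous (sg t).
Hypothesis bnd : forall t s, -1 < t -> t < 2 -> 0 <= s -> s <= 1 ->
  `|s * sg t s + L t s| <= C.

(* The integrand of the derivative is d/ds (s L(t, s)). *)
Lemma radial_integral_derive t0 : -1 < t0 -> t0 < 2 ->
  is_derive t0 1 (fun t => \int[leb]_(s in `[0, 1]) K t s) (L t0 1).
Proof.
move=> t0l t0u.
have cint (f : R -> R) : continuous f -> leb.-integrable `[0, 1] (EFin \o f).
  by move=> cf; apply: continuous_compact_integrable; [exact: segment_compact|exact: continuous_subspaceT].
have It0 : `]-1, 2[%classic t0 by rewrite /= in_itv/= t0l t0u.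
have dKt t s : derivable (K ^~ s) t 1 by have [] := dK t s.
have d1 t s : partial1of2 K t s = s * sg t s + L t s.
  by rewrite partial1of2E; have [_ ->] := dK t s.
have C0 : 0 <= C.
  by apply: le_trans (bnd t0l t0u (lexx 0) ler01).
have mI : measurable (`[0, 1]%classic : set (measurableTypeR R)) by exact: measurable_itv.
have intC : leb.-integrable `[0, 1] (EFin \o (fun=> C)) by exact/cint/cst_continuous.
have intK t : `]-1, 2[%classic t -> leb.-integrable `[0, 1] (EFin \o K t).
  by move=> _; apply: cint.
have dI t s : `]-1, 2[%classic t -> `[0, 1]%classic s -> derivable (K ^~ s) t 1 by [].
have bI t s : `]-1, 2[%classic t -> `[0, 1]%classic s -> `|partial1of2 K t s| <= C.
  by rewrite /= !in_itv/= d1 => /andP[? ?] /andP[? ?]; exact: bnd.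
apply: DeriveDef; first exact: (@derivable_under_integral R _ (measurableTypeR R) leb K _ mI _ _ _ It0 intK dI _ (fun=> C0) intC bI).
rewrite -derive1E (@differentiation_under_integral R _ (measurableTypeR R) leb K _ mI _ _ _ It0 intK dI _ (fun=> C0) intC bI).
pose F s := s * L t0 s.
have dF s : is_derive s 1 F (s * sg t0 s + L t0 s).
  have h := dL t0 s; rewrite /F.
  by apply: is_derive_eq; rewrite /GRing.scale/= mulr1.
have cL : continuous (L t0).
  by move=> s; apply/differentiable_continuous/derivable1_diffP; have [] := dL t0 s.
have cF : continuous F.
  by move=> s; apply/differentiable_continuous/derivable1_diffP; have [] := dF s.
have cf : continuous (fun s => s * sg t0 s + L t0 s).
  move=> s; apply: (@continuousD _ _ _ (fun s => s * sg t0 s) (L t0)); last exact: cL.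
  by apply: (@continuousM _ _ id (sg t0)); [exact: cvg_id|exact: csg].
rewrite /Rintegral.
under eq_integral do rewrite d1.
rewrite (@continuous_FTC2 _ (fun s => s * sg t0 s + L t0 s) F 0 1) //.
- by rewrite -EFinB /= /F mul0r subr0 mul1r.
- exact: continuous_subspaceT.
- split; first by move=> s _; have [] := dF s.
  + by apply: cvg_at_right_filter; exact: cF.
  + by apply: cvg_at_left_filter; exact: cF.
- by move=> s _; rewrite derive1E; have [_ ->] := dF s.
Qed.

End RadialIntegral.

(** * Flows whose moment has a symmetric nonnegative derivative *)

Section FlowGradient.
Context {R : realType} {k : nat} {T : topologicalType}.
Notation V := 'rV[R]_k.
Implicit Types (x : T) (u v w : V) (a b t s : R).
Variables (phi : V -> T -> T) (h : T -> V) (S : T -> V -> V -> R).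

(** [S x u w] stands for the Riemannian pairing at [x] of the fundamental fields of [u] and [w], so
    [S x u u = 0] means that the field of [u] vanishes at [x]. *)
Definition flow_gradient := [/\ forall x, phi 0 x = x,
  forall u v x, phi (u + v) x = phi u (phi v x),
  forall u, continuous (phi u),
  forall u x, continuous (fun t : R => phi (t *: u) x) &
  forall w, continuous (fun x => dotv (h x) w)] /\
  [/\ forall x u w t, is_derive t 1 (fun t : R => dotv (h (phi (t *: u) x)) w)
        (S (phi (t *: u) x) u w),
      forall u w, continuous (fun x => S x u w),
      forall x u w, S x u w = S x w u,
      forall x u, 0 <= S x u u &
      forall x u, S x u u = 0 -> forall t, phi (t *: u) x = x].

Hypothesis cT : compact [set: T].
Hypothesis hflow : flow_gradient.

Let phi0 x : phi 0 x = x. Proof. by have [[]] := hflow. Qed.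
Let phiD u v x : phi (u + v) x = phi u (phi v x).
Proof. by have [[_ + _ _ _] _] := hflow; apply. Qed.
Let phic u x : continuous (fun t : R => phi (t *: u) x).
Proof. by have [[_ _ _ + _] _] := hflow; apply. Qed.
Let hc w : continuous (fun x => dotv (h x) w).
Proof. by have [[_ _ _ _ +] _] := hflow; apply. Qed.
Let hS x u w t : is_derive t 1 (fun t : R => dotv (h (phi (t *: u) x)) w)
  (S (phi (t *: u) x) u w).
Proof. by have [_ [+ _ _ _ _]] := hflow; apply. Qed.
Let Sc u w : continuous (fun x => S x u w).
Proof. by have [_ [_ + _ _ _]] := hflow; apply. Qed.
Let Ssym x u w : S x u w = S x w u.
Proof. by have [_ [_ _ + _ _]] := hflow; apply. Qed.
Let Spos x u : 0 <= S x u u.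
Proof. by have [_ [_ _ _ + _]] := hflow; apply. Qed.
Let Sfix x u : S x u u = 0 -> forall t, phi (t *: u) x = x.
Proof. by have [_ [_ _ _ _ +]] := hflow; apply. Qed.

Lemma flowC u v x : phi u (phi v x) = phi v (phi u x).
Proof. by rewrite -!phiD addrC. Qed.

Lemma flowK u x : phi (- u) (phi u x) = x.
Proof. by rewrite -phiD addNr phi0. Qed.

Lemma flow_bounded (f : T -> R) : continuous f -> exists2 K, 0 < K & forall x, `|f x| <= K.
Proof.
move=> cf; have : compact (f @` setT).
  by apply: continuous_compact => //; exact: continuous_subspaceT.
move=> /compact_bounded [K [_ Kf]].
exists (`|K| + 1); first by rewrite ltr_wpDl.
move=> x; apply: (Kf (`|K| + 1)); last by exists x.
by rewrite (le_lt_trans (ler_norm _))// ltrDl.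
Qed.

Lemma flow_derive (a b : V) w x t :
  is_derive t 1 (fun t : R => dotv (h (phi (a + t *: b) x)) w)
    (S (phi (a + t *: b) x) b w).
Proof.
have := hS (phi a x) b w t; rewrite -phiD addrC.
by under [X in is_derive _ _ X _]eq_fun do rewrite -phiD addrC.
Qed.

(** Linearity is inherited from [dotv], because [S x u w] is the derivative at 0 of a moment paired
    with [w]. Symmetry then transfers it to the first argument. *)
Lemma S_linear x u a w w' : S x u (a *: w + w') = a * S x u w + S x u w'.
Proof.
have h0 v : S x u v = 'D_1 (fun t : R => dotv (h (phi (t *: u) x)) v) 0.
  by have [_ ->] := hS x u v 0; rewrite scale0r phi0.
rewrite h0; have h1 := hS x u w 0; have h2 := hS x u w' 0.
rewrite scale0r phi0 in h1 h2.
rewrite (_ : (fun _ => _) = (fun t : R => a * dotv (h (phi (t *: u) x)) w +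
    dotv (h (phi (t *: u) x)) w')); last first.
  by apply/funext => t; rewrite dotvDr dotvZr.
have h3 : is_derive (0 : R) 1 (fun t : R => a * dotv (h (phi (t *: u) x)) w +
    dotv (h (phi (t *: u) x)) w') (a * S x u w + S x u w').
  by apply: is_derive_eq; rewrite /GRing.scale/=.
by have [_ ->] := h3.
Qed.

Lemma S_scalel x u w a : S x (a *: u) w = a * S x u w.
Proof.
rewrite Ssym -[a *: u]addr0 S_linear.
have : S x w 0 = 0.
  by have := S_linear x w (-1) 0 0; rewrite scaler0 addr0 mulN1r; lra.
by move=> ->; rewrite addr0 (Ssym x w).
Qed.

Lemma flow_MVT u v x a b : a < b -> exists c,
  dotv (h (phi (u + b *: v) x)) v - dotv (h (phi (u + a *: v) x)) v =
  S (phi (u + c *: v) x) v v * (b - a).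
Proof.
move=> ab.
have [| |c _ e] := @MVT _ (fun t : R => dotv (h (phi (u + t *: v) x)) v)
  (fun t => S (phi (u + t *: v) x) v v) a b ab.
- by move=> t _; exact: flow_derive.
- apply: continuous_subspaceT => t.
  by apply/differentiable_continuous/derivable1_diffP; have [] := flow_derive u v v x t.
by exists c.
Qed.

Lemma flow_monotone u v x a b : a <= b ->
  dotv (h (phi (u + a *: v) x)) v <= dotv (h (phi (u + b *: v) x)) v.
Proof.
rewrite le_eqVlt => /predU1P[->//|ab].
have [c e] := flow_MVT u v x ab.
by rewrite -subr_ge0 e mulr_ge0 ?Spos// subr_ge0 ltW.
Qed.

(** By the mean value theorem [S] vanishes on [v] at some point of the orbit, which is thus fixed in
    direction [v]; commutativity carries this back to [x]. *)
Lemma flow_rigid u v x a b : a < b ->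
  dotv (h (phi (u + b *: v) x)) v = dotv (h (phi (u + a *: v) x)) v ->
  forall t, phi (t *: v) x = x.
Proof.
move=> ab e t; have [c] := flow_MVT u v x ab; rewrite e subrr => /esym/eqP.
rewrite mulf_eq0 [X in _ || X]gt_eqF ?subr_gt0// orbF => /eqP /Sfix /(_ t).
by rewrite flowC => /(congr1 (phi (- (u + c *: v)))); rewrite !flowK.
Qed.

Lemma flow_lipschitz v : exists C, forall u x e, 0 <= e ->
  dotv (h (phi (u + e *: v) x)) v <= dotv (h (phi u x)) v + e * C.
Proof.
have [C C0 SC] := flow_bounded (@Sc v v).
exists C => u x e; rewrite le_eqVlt => /predU1P[<-|e0].
  by rewrite scale0r mul0r !addr0.
have [c] := flow_MVT u v x e0; rewrite scale0r addr0 subr0 => /eqP.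
rewrite subr_eq => /eqP ->; rewrite addrC lerD2l mulrC ler_pM2l//.
by rewrite (le_trans (ler_norm _)).
Qed.

(** The radial primitive, as in the Poincare lemma, of the 1-form on [V] given by the moment along
    the orbit of [x]; the form is closed by symmetry of [S]. It is a Kempf-Ness function. *)
Definition flow_potential (x : T) (u : V) : R :=
  \int[lebesgue_measure]_(s in `[0, 1]) dotv (h (phi (s *: u) x)) u.

(** Along [u + t *: v] the potential has derivative the moment paired with [v], which is
    nondecreasing in [t]; the mean value theorem on [0, 1] concludes. *)
Lemma flow_potential_sub x u v :
  flow_potential x u + dotv (h (phi u x)) v <= flow_potential x (u + v).
Proof.
pose K t s := dotv (h (phi (s *: (u + t *: v)) x)) (u + t *: v).
pose L t s := dotv (h (phi (s *: (u + t *: v)) x)) v.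
pose sg t s := S (phi (s *: (u + t *: v)) x) v (u + t *: v).
have es t s : s *: (u + t *: v) = s *: u + t *: (s *: v).
  by rewrite scalerDr !scalerA mulrC.
have dK t s : is_derive t 1 (K ^~ s) (s * sg t s + L t s).
  have h1 := flow_derive (s *: u) (s *: v) u x t.
  have h2 := flow_derive (s *: u) (s *: v) v x t.
  rewrite (_ : K^~ s = fun t => dotv (h (phi (s *: u + t *: (s *: v)) x)) u +
     t * dotv (h (phi (s *: u + t *: (s *: v)) x)) v); last first.
    by apply/funext => t'; rewrite /K es dotvDr dotvZr.
  apply: is_derive_eq; rewrite /GRing.scale/= /sg /L es addrC -/(u + t *: v).
  rewrite [u + _]addrC S_linear !S_scalel; ring.
have dL t s : is_derive s 1 (L t) (sg t s).
  by rewrite /sg Ssym; exact: hS.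
have cphi t : continuous (fun s : R => phi (s *: (u + t *: v)) x) by exact: phic.
have cK t : continuous (K t).
  move=> s; apply: (@continuous_comp _ _ _ (fun s : R => phi (s *: (u + t *: v)) x)
    (fun y => dotv (h y) (u + t *: v))); [exact: cphi|exact: hc].
have csg t : continuous (sg t).
  move=> s; apply: (@continuous_comp _ _ _ (fun s : R => phi (s *: (u + t *: v)) x)
    (fun y => S y v (u + t *: v))); [exact: cphi|exact: Sc].
have [C1 C10 b1] := flow_bounded (@Sc v u).
have [C2 C20 b2] := flow_bounded (@Sc v v).
have [C3 C30 b3] := flow_bounded (@hc v).
(* [sg] splits as the pairing of [v] with [u] plus [t] times that of [v] with itself, and
   [|t| <= 2]. *)
have bnd t s : -1 < t -> t < 2 -> 0 <= s -> s <= 1 ->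
    `|s * sg t s + L t s| <= C1 + 2 * C2 + C3.
  move=> t1 t2 s0 s1; apply: (le_trans (ler_normD _ _)); apply: lerD; last exact: b3.
  rewrite normrM (ger0_norm s0) -[leRHS]mul1r; apply: ler_pM => //.
  rewrite /sg [u + _]addrC S_linear; apply: (le_trans (ler_normD _ _)).
  rewrite [leRHS]addrC; apply: lerD; last exact: b1.
  by rewrite normrM; apply: ler_pM => //; rewrite ler_norml; lra.
have dG t : -1 < t -> t < 2 -> is_derive t 1 (fun t => flow_potential x (u + t *: v)) (L t 1).
  by move=> t1 t2; exact: (radial_integral_derive dK dL cK csg bnd).
have [| |c c01] := @MVT _ (fun t => flow_potential x (u + t *: v)) (fun t => L t 1) 0 1 ltr01.
- by move=> t; rewrite in_itv/= => /andP[? ?]; apply: dG; lra.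
- apply: derivable_within_continuous => t; rewrite in_itv/= => /andP[? ?].
  have t1 : -1 < t by lra.
  have t2 : t < 2 by lra.
  by have [] := dG t t1 t2.
rewrite scale1r scale0r addr0 subr0 mulr1 => e.
rewrite addrC -lerBrDr e /L scale1r.
have c0 : 0 <= c by move: c01; rewrite in_itv/= => /andP[/ltW].
by have := flow_monotone u v x c0; rewrite scale0r addr0.
Qed.

End FlowGradient.

(** * Cyclic monotonicity *)

Section CyclicMonotone.
Context {R : realType} {k : nat}.
Notation V := 'rV[R]_k.

Fixpoint chainsum (T : V -> V) (u : V) (s : seq V) : R :=
  if s is w :: s' then dotv (T u) (w - u) + chainsum T w s' else 0.

Lemma chainsum_rcons T u s w :
  chainsum T u (rcons s w) = chainsum T u s + dotv (T (last u s)) (w - last u s).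
Proof.
by elim: s u => [|v s IH] u /=; [rewrite addr0 add0r|rewrite IH addrA].
Qed.

Lemma chainsum_le_potential T (f : V -> R) u s :
  (forall u v, f u + dotv (T u) v <= f (u + v)) -> chainsum T u s <= f (last u s) - f u.
Proof.
move=> H; elim: s u => [|w s IH] u /=; first by rewrite subrr.
by have := IH w; have := H u (w - u); rewrite addrCA subrr addr0; lra.
Qed.

(* Rockafellar: a cyclically monotone map is a selection of a subdifferential. *)
Lemma cyclic_monotone_potential (T : V -> V) :
  (forall u s, last u s = u -> chainsum T u s <= 0) ->
  exists f : V -> R, forall u v, f u + dotv (T u) (v - u) <= f v.
Proof.
move=> cyc.
(* The potential at [u] is the supremum over chains from 0 to [u]. Closing such a chain by a last
   step to 0 bounds its sum by [dotv (T u) u]. *)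
pose A u := [set r | exists s, r = chainsum T 0 (rcons s u)].
have ub u : has_sup (A u).
  split; first by exists (chainsum T 0 (rcons [::] u)), [::].
  exists (dotv (T u) u) => _ [s ->].
  have := cyc 0 (rcons (rcons s u) 0); rewrite last_rcons => /(_ erefl).
  by rewrite chainsum_rcons last_rcons sub0r dotvNr; lra.
exists (fun u => sup (A u)) => u v.
rewrite -lerBrDr; apply: ge_sup; first by have [] := ub u.
move=> _ [s ->]; rewrite lerBrDr.
apply: sup_upper_bound => //; exists (rcons s u).
by rewrite [RHS]chainsum_rcons last_rcons.
Qed.

End CyclicMonotone.

Lemma rV_cvg {R : realType} {k : nat} {T : Type} {F : set_system T} {FF : Filter F}
    (g : T -> 'rV[R]_k) (l : 'rV[R]_k) :
  (forall i, (fun x => g x ord0 i) @ F --> l ord0 i) -> g @ F --> l.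
Proof.
move=> H; apply/cvgrPdist_lt => e e0.
have : \forall x \near F, forall i, `|l ord0 i - g x ord0 i| < e.
  apply: filter_forall => i; have /cvgrPdist_lt := H i; exact.
apply: filterS => x xe; rewrite [ltLHS]/Num.norm /= mx_normrE.
by apply: bigmax_lt => // -[i j] _ /=; rewrite (ord1 i) !mxE.
Qed.

Lemma closure_cvx {R : realType} {k : nat} (A : set 'rV[R]_k) : cvx A -> cvx (closure A).
Proof.
move=> cA x y t t0 t1 Ax Ay.
have cl (z : 'rV[R]_k) : closure A z <-> forall e, 0 < e -> exists2 a, A a & `|z - a| < e.
  split=> [Az e e0|H B /nbhs_ballP[e e0 eB]].
    have [a [Aa za]] := Az _ (nbhsx_ballx z e e0).
    by exists a => //; move: za; rewrite -ball_normE.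
  by have [a Aa za] := H e e0; exists a; split => //; apply: eB; rewrite -ball_normE.
apply/cl => e e0; have [a Aa xa] := (cl x).1 Ax e e0; have [b Ab yb] := (cl y).1 Ay e e0.
exists (t *: a + (1 - t) *: b); first exact: cA.
rewrite opprD addrACA -!scalerBr; apply: (le_lt_trans (ler_normD _ _)).
have t1' : 0 <= 1 - t by rewrite subr_ge0.
rewrite !normrZ (ger0_norm t0) (ger0_norm t1').
have [->|tn0] := eqVneq t 0; first by rewrite mul0r add0r subr0 mul1r.
have tp : 0 < t by rewrite lt_neqAle eq_sym tn0.
have : t * `|x - a| < t * e by rewrite ltr_pM2l.
have : (1 - t) * `|y - b| <= (1 - t) * e by rewrite ler_wpM2l// ltW.
lra.
Qed.

(** * Orbits of probability measures under a gradient flow *)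

Section FlowMeasures.
Context {R : realType} {k : nat} {Z : topologicalType} {M : set Z} (x0 : M).
Notation V := 'rV[R]_k.
Notation BT := (borel_sub M x0).
Hypothesis cM : compact [set: M].
Hypothesis hM : hausdorff_space M.
Hypothesis scM : @second_countable M.
Variables (phi : V -> M -> M) (h : M -> V) (S : M -> V -> V -> R).
Hypothesis hflow : flow_gradient phi h S.
Implicit Types (nu sigma : probability BT R) (u v w : V).

Let phi0 x : phi 0 x = x. Proof. by have [[]] := hflow. Qed.
Let phiD u v x : phi (u + v) x = phi u (phi v x).
Proof. by have [[_ + _ _ _] _] := hflow; apply. Qed.
Let phic u : continuous (phi u).
Proof. by have [[_ _ + _ _] _] := hflow; apply. Qed.
Let hc w : continuous (fun x => dotv (h x) w).
Proof. by have [[_ _ _ _ +] _] := hflow; apply. Qed.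

Definition row_mean sigma : V := \row_i \int[sigma]_x ((h : BT -> V) x ord0 i).

Definition flow_orbit nu : set (weak_prob R x0) :=
  [set sigma | exists u, is_push (phi u) nu sigma].

Definition flow_isotropy nu : set V :=
  [set v | forall t : R, is_push (phi (t *: v)) nu nu].

Definition flow_fixed : set (weak_prob R x0) :=
  [set sigma | forall u, is_push (phi u) sigma sigma].

(** The mean moment of the pushforward by [phi u], written against the fixed [nu] so that no
    pushforward has to be chosen. *)
Let T nu u : V := \row_i \int[nu]_x ((h \o phi u : BT -> V) x ord0 i).

Let dotv_delta (u : V) i : dotv u (delta_mx ord0 i) = u ord0 i.
Proof.
rewrite /dotv (bigD1 i)//= mxE !eqxx mulr1 big1 ?addr0// => j ji.
by rewrite mxE eqxx (negbTE ji) mulr0.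
Qed.

Let hci i : continuous (fun x => h x ord0 i).
Proof.
by under eq_fun do rewrite -dotv_delta; exact: hc.
Qed.

Let hphic u w : continuous (fun x => dotv (h (phi u x)) w).
Proof.
move=> x; apply: (@continuous_comp _ _ _ (phi u) (fun y => dotv (h y) w)).
  exact: phic.
exact: hc.
Qed.

Let dotv_mean nu (g : M -> V) w : (forall i, continuous (fun x => g x ord0 i)) ->
  dotv (\row_i \int[nu]_x ((g : BT -> V) x ord0 i)) w =
  \int[nu]_x (dotv (g x) w).
Proof.
move=> gc; have hP := mean_positive_functional cM nu; have [_ PZ _ _] := hP.
transitivity (\int[nu]_x ((fun x : M => \sum_i (w ord0 i * g x ord0 i)) : BT -> R) x).
  rewrite (functional_sum hP).
    by apply: eq_bigr => i _; rewrite mxE PZ// mulrC.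
  by move=> i x; apply: (@continuousM _ _ (fun=> w ord0 i)); [exact: cst_continuous|exact: gc].
by congr fine; apply: eq_integral => x _; congr EFin; apply: eq_bigr => i _; rewrite mulrC.
Qed.

Let dotv_T nu u w : dotv (T nu u) w = \int[nu]_x ((fun x => dotv (h (phi u x)) w) : BT -> R) x.
Proof.
rewrite /T dotv_mean// => i.
by under eq_fun do rewrite -dotv_delta; exact: hphic.
Qed.

Lemma row_mean_push nu sigma u : is_push (phi u) nu sigma -> row_mean sigma = T nu u.
Proof.
move=> hp; apply/rowP => i; rewrite !mxE.
have hi : continuous (fun x => h x ord0 i) by exact: hci.
refine (@push_integral _ _ _ x0 cM (phi u) nu sigma (fun x => h x ord0 i) _ hp hi).
exact: phic.
Qed.

Let row_mean0 nu : row_mean nu = T nu 0.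
Proof. by apply: row_mean_push => E mE; rewrite /pushforward (_ : _ @^-1` E = E)//; apply/seteqP; split=> x /=; rewrite phi0. Qed.

Let T_range nu : range (T nu) = row_mean @` flow_orbit nu.
Proof.
apply/seteqP; split=> [_ [u _ <-]|_ [sigma [u hu] <-]].
  have [s hs] := push_exists nu (@phic u).
  by exists s; [exists u|exact: row_mean_push].
by exists u => //; rewrite (row_mean_push hu).
Qed.

Let chain_integral nu u (s : seq V) :
  continuous (fun x => chainsum (fun u => h (phi u x)) u s) /\
  chainsum (T nu) u s =
    \int[nu]_x ((fun x : M => chainsum (fun u => h (phi u x)) u s) : BT -> R) x.
Proof.
have hP := mean_positive_functional cM nu; have [PD _ _ _] := hP.
elim: s u => [|w s IH] u /=.
  by split; [exact: cst_continuous|rewrite (functional_cst hP)].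
have [c e] := IH w; split.
  move=> x; apply: (@continuousD _ _ _ (fun x => dotv (h (phi u x)) (w - u))
   (fun x => chainsum (fun u => h (phi u x)) w s)); [exact: hphic|exact: c].
by rewrite e dotv_T -PD//; exact: hphic.
Qed.

(** A closed chain sum of [T nu] is the integral of the chain sums at the points [x], each
    nonpositive thanks to [flow_potential x]. *)
Let potential nu : exists f : V -> R, forall u v, f u + dotv (T nu u) (v - u) <= f v.
Proof.
apply: cyclic_monotone_potential => u s us.
have [c ->] := chain_integral nu u s.
have hP := mean_positive_functional cM nu.
rewrite -[leRHS](functional_cst hP); apply: (functional_le hP) => //.
  exact: cst_continuous.
move=> x; have := chainsum_le_potential (T := fun u => h (phi u x)) u s
  (flow_potential_sub cM hflow x).
by rewrite us subrr.
Qed.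

Let T_bound nu : exists C, forall u, `|T nu u| <= C.
Proof.
have /choice[K hK] : forall i : 'I_k, exists C, 0 <= C /\ forall x, `|h x ord0 i| <= C.
  move=> i; have [C C0 hC] := continuous_compact_bounded cM (@hci i).
  by exists C; split => //; exact: ltW.
exists (\sum_i K i) => u.
have K0 : 0 <= \sum_i K i by apply: sumr_ge0 => i _; have [] := hK i.
rewrite [leLHS]/Num.norm /= mx_normrE; apply: bigmax_le => // -[i j] _ /=.
rewrite (ord1 i) mxE.
apply: (@le_trans _ _ (K j)); last first.
  by rewrite (bigD1 j)//= lerDl sumr_ge0// => l _; have [] := hK l.
apply: (@mean_bound R Z M x0 cM nu (fun x => h (phi u x) ord0 j)).
  by under eq_fun do rewrite -dotv_delta; exact: hphic.
by move=> x; have [_ +] := hK j; exact.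
Qed.

Let T_lip nu w : exists C, forall u e, 0 <= e ->
  dotv (T nu (u + e *: w)) w <= dotv (T nu u) w + e * C.
Proof.
have [C hC] := flow_lipschitz cM hflow w; exists C => u e e0.
have hP := mean_positive_functional cM nu; have [PD _ _ _] := hP.
rewrite !dotv_T -(functional_cst hP (e * C)) -PD; last 2 first.
- exact: hphic.
- exact: cst_continuous.
apply: (functional_le hP).
- exact: hphic.
- move=> x; apply: (@continuousD _ _ _ (fun x => dotv (h (phi u x)) w) (fun=> e * C)).
    exact: hphic.
  exact: cst_continuous.
- by move=> x; exact: hC.
Qed.

Lemma is_push_comp u v nu s t : is_push (phi u) nu s -> is_push (phi v) s t ->
  is_push (phi (v + u)) nu t.
Proof.
move=> h1 h2 E mE; rewrite h2// /pushforward h1; last first.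
  by have := continuous_borel_map (x0 := x0) (@phic v) measurableT mE; rewrite setTI.
by rewrite /pushforward; congr (nu _); apply/seteqP; split=> x /=; rewrite phiD.
Qed.

Let isotropy_linear nu : linear_subspace (flow_isotropy nu).
Proof.
split=> [t E mE|a u v Wu Wv t].
  rewrite scaler0 /pushforward; congr (nu _).
  by apply/seteqP; split=> x /=; rewrite phi0.
by rewrite scalerDr scalerA; apply: is_push_comp (Wv t) (Wu (t * a)).
Qed.

Let T_isotropy nu u v : flow_isotropy nu v -> T nu (u + v) = T nu u.
Proof.
move=> /(_ 1); rewrite scale1r => hv; have [s hs] := push_exists nu (@phic u).
by rewrite -(row_mean_push hs) -(row_mean_push (is_push_comp hv hs)).
Qed.

(* If T(u).w = T(u + w/2).w, then nu-almost every point is fixed by the flow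
   in direction w. *)
Let isotropy_rigid nu u w :
  dotv (T nu (u + 2^-1 *: w)) w = dotv (T nu u) w -> flow_isotropy nu w.
Proof.
rewrite !dotv_T => e t.
pose g x := dotv (h (phi (u + 2^-1 *: w) x)) w - dotv (h (phi u x)) w.
have gc : continuous g.
  move=> x; apply: (@continuousB _ _ _ (fun x => dotv (h (phi (u + 2^-1 *: w) x)) w)
    (fun x => dotv (h (phi u x)) w)); exact: hphic.
have g0 x : 0 <= g x.
  rewrite subr_ge0; have := flow_monotone hflow u w x (a := 0) (b := 2^-1).
  by rewrite scale0r addr0; apply; rewrite invr_ge0.
have gfix x : g x = 0 -> phi (t *: w) x = x.
  move=> /eqP; rewrite subr_eq0 => /eqP gx.
  apply: (flow_rigid hflow (u := u) (a := 0) (b := 2^-1)); first by rewrite invr_gt0.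
  by rewrite scale0r addr0.
have mg : measurable_fun [set: BT] (g : BT -> R) by exact: continuous_borel.
have Ig : \int[nu]_x (g : BT -> R) x = 0.
  rewrite RintegralB//; [by rewrite e subrr| |]; apply: continuous_integrable => //; exact: hphic.
have Ig' : (\int[nu]_x `|((g : BT -> R) x)%:E| = 0)%E.
  rewrite -[RHS]/(0%:E) -Ig /Rintegral fineK.
    by apply: eq_integral => x _; rewrite gee0_abs// lee_fin.
  by apply: integrable_fin_num => //; exact: continuous_integrable.
have ae : ae_eq nu setT (EFin \o (g : BT -> R)) (cst 0%E).
  by apply/(ae_eq_integral_abs _ measurableT) => //; exact/measurable_EFinP.
apply: (is_pushP cM hM scM (@phic _)) => f cf.
have cff : continuous (f \o phi (t *: w)).
  by move=> x; apply: continuous_comp; [exact: phic|exact: cf].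
congr fine; apply: ae_eq_integral => //.
- by apply/measurable_EFinP; exact: continuous_borel.
- by apply/measurable_EFinP; exact: (continuous_borel (x0 := x0) cff).
by apply: filterS ae => x /= /(_ I) [gx] _; rewrite gfix.
Qed.

(** If the subgradient inequality from [u] to [v] is an equality, those between [u], [v] and the
    midpoint [m] force [T nu m] and [T nu u] to agree on [w]. The midpoint is the source of the step
    [2^-1] in [isotropy_rigid]. *)
Let isotropy_strict nu f u v :
  (forall u v, f u + dotv (T nu u) (v - u) <= f v) ->
  f v = f u + dotv (T nu u) (v - u) -> flow_isotropy nu (v - u).
Proof.
move=> sub; set w := v - u => e; apply: (isotropy_rigid (u := u)).
have ew : v = u + w by rewrite addrC subrK.
set m := u + 2^-1 *: w.
have em : m - u = 2^-1 *: w by rewrite /m addrAC subrr add0r.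
have emv : v - m = 2^-1 *: w.
  by rewrite ew /m; apply/rowP => i; rewrite !mxE; field.
have h1 := sub u m; have h2 := sub m u; have h3 := sub m v.
rewrite -(opprB m u) em dotvNr dotvZr in h2; rewrite em dotvZr in h1.
rewrite emv dotvZr in h3; apply/eqP; rewrite eq_le; apply/andP; split; lra.
Qed.

Theorem flow_orbit_image nu :
  (exists2 O : set V, open O & row_mean @` flow_orbit nu =
     O `&` [set row_mean nu + v | v in
       [set v | forall w, flow_isotropy nu w -> dotv v w = 0]]) /\
  cvx (row_mean @` flow_orbit nu).
Proof.
have [f fsub] := potential nu; have [C TC] := T_bound nu.
have /choice[Cl TCl] := T_lip nu.
have lip u w e : 0 <= e -> dotv (T nu (u + e *: w)) w <= dotv (T nu u) w + e * Cl w.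
  by move=> e0; exact: TCl.
have st u v := isotropy_strict (u := u) (v := v) fsub.
have TW u v (Wv : flow_isotropy nu v) := T_isotropy u Wv.
rewrite row_mean0 -T_range; split.
  exact: (gradient_image_open fsub TC lip (isotropy_linear nu) st TW).
move=> _ _ t t0 t1 [u _ <-] [v _ <-].
have [w <-] := gradient_image_convex fsub TC lip (isotropy_linear nu) st TW u v t0 t1.
by exists w.
Qed.

Lemma row_mean_continuous : continuous (row_mean : weak_prob R x0 -> V).
Proof.
move=> s; apply: (@rV_cvg R k (weak_prob R x0) (nbhs s) (nbhs_filter s)) => i.
under eq_fun do rewrite mxE; rewrite mxE.
exact: (weak_prob_mean_continuous (x0 := x0) (@hci i)).
Qed.

(** Weak* continuity of pushforward: testing [P s] on [f] amounts to testing [s] on the continuous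
    function [f \o phi u]. *)
Lemma push_cvg u (sigma : weak_prob R x0) (P : weak_prob R x0 -> weak_prob R x0) tau :
  (forall s, is_push (phi u) s (P s)) -> is_push (phi u) sigma tau ->
  P @ sigma --> (tau : weak_prob R x0).
Proof.
move=> hP ht; apply: (@weak_prob_cvg _ _ _ x0 _ tau (@fmap_filter _ _ P _ (nbhs_filter sigma))) => f cf.
have cff : continuous (f \o phi u).
  by move=> x; apply: continuous_comp; [exact: phic|exact: cf].
rewrite (push_integral cM (@phic u) ht cf).
have hm : (fun Q : weak_prob R x0 => \int[Q]_x ((f \o phi u : BT -> R) x)) @ sigma -->
    (\int[sigma]_x ((f \o phi u : BT -> R) x) : R).
  exact: (@weak_prob_mean_continuous R _ _ x0 _ cff sigma).
have e : (fun s : weak_prob R x0 => \int[P s]_x ((f : BT -> R) x)) =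
    (fun Q : weak_prob R x0 => \int[Q]_x ((f \o phi u : BT -> R) x)).
  by apply/funext => s; rewrite (push_integral cM (@phic u) (hP s) cf).
by rewrite -e in hm; exact: hm.
Qed.

Lemma closure_orbit_push nu u sigma tau : closure (flow_orbit nu) (sigma : weak_prob R x0) ->
  is_push (phi u) sigma tau -> closure (flow_orbit nu) (tau : weak_prob R x0).
Proof.
move=> cs ht.
have [P hP] : {P : weak_prob R x0 -> weak_prob R x0 & forall s, is_push (phi u) s (P s)}.
  apply: (@choice _ _ (fun s (t : weak_prob R x0) => is_push (phi u) s t)) => s.
  exact: push_exists.
move=> B nB; have [s [[v hv] Bs]] := cs _ (push_cvg hP ht nB).
by exists (P s); split => //; exists (u + v); exact: is_push_comp hv (hP s).
Qed.

(** The image of the orbit of [sigma] lies in [C] and is open in its affine space. So the component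
    [v] of any [u] orthogonal to the isotropy directions is a face direction of [C] at
    [row_mean sigma], hence zero, and [u] itself is an isotropy direction. *)
Lemma fixed_row_mean nu sigma (C : set V) : cvx C ->
  (forall u tau, is_push (phi u) sigma tau -> C (row_mean tau)) ->
  (forall v, face_dir C (row_mean sigma) v -> v = 0) -> flow_fixed sigma.
Proof.
move=> Ccv Cpush ext.
have [ [ O oO imO] _] := flow_orbit_image sigma.
set W := flow_isotropy sigma in imO.
suff WT u : W u by move=> u; have := WT u 1; rewrite scale1r.
have [w Ww uw] := orth_decomp u (isotropy_linear sigma).
suff : u - w = 0 by move=> /eqP; rewrite subr_eq0 => /eqP ->.
apply: ext; set v := u - w in uw.
have Orb : O (row_mean sigma).
  have : (row_mean @` flow_orbit sigma) (row_mean sigma).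
    exists sigma => //; exists 0 => E mE; rewrite /pushforward; congr (sigma _).
    by apply/seteqP; split=> x /=; rewrite phi0.
  by rewrite imO => -[].
have [e e0 eO] : exists2 e : R, 0 < e & forall t : R, `|t| <= e -> O (row_mean sigma + t *: v).
  have /nbhs_ballP[d d0 dO] := open_nbhs_nbhs (conj oO Orb).
  have K1 : 0 < 2 * (`|v| + 1) by rewrite mulr_gt0// ltr_wpDl.
  (* The factor 2 keeps the point strictly inside the ball of radius [d], and the summand 1 covers
     [v = 0]. *)
  exists (d / (2 * (`|v| + 1))); first exact: divr_gt0.
  move=> t td; apply: dO; rewrite -ball_normE/= opprD addrA subrr add0r normrN normrZ.
  have h1 : `|t| * (2 * (`|v| + 1)) <= d by rewrite -ler_pdivlMr.
  have h2 := mulr_ge0 (normr_ge0 t) (normr_ge0 v).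
  have h3 := normr_ge0 t.
  have : 0 < d by [].
  have [->|t0] := eqVneq t 0; first by rewrite normr0 mul0r.
  have : 0 < `|t| by rewrite normr_gt0.
  nra.
have inC t : `|t| <= e -> C (row_mean sigma + t *: v).
  move=> te; have : (row_mean @` flow_orbit sigma) (row_mean sigma + t *: v).
    rewrite imO; split; first exact: eO.
    exists (t *: v) => // w' Ww'; by rewrite dotvZl uw// mulr0.
  by move=> [tau [u' hu'] <-]; exact: Cpush hu'.
exists e => //; split; first by apply: inC; rewrite ger0_norm// ltW.
by rewrite -scaleNr; apply: inC; rewrite normrN ger0_norm// ltW.
Qed.

(** [C] is compact and lies between the convex image of the orbit and its closure, so it is that
    closure and convex. The hull is expressed through arbitrary convex [D], a form that passes
    through linear maps by preimage. *)
Theorem flow_closure_image nu (K := closure (flow_orbit nu)) :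
  cvx (row_mean @` K) /\
  forall D : set V, cvx D -> row_mean @` (K `&` flow_fixed) `<=` D ->
    row_mean @` K `<=` D.
Proof.
have cK : compact K.
  have cP := weak_prob_compact (R := R) (x0 := x0) cM hM scM.
  exact: subclosed_compact (@closed_closure _ _) cP (@subsetT _ _).
set C := row_mean @` K.
have cC : compact C.
  apply: continuous_compact => //; apply: continuous_subspaceT.
  exact: row_mean_continuous.
have clC : closed C by apply: compact_closed => //; exact: norm_hausdorff.
have [_ Ocv] := flow_orbit_image nu.
have OC : row_mean @` flow_orbit nu `<=` C.
  by apply: image_subset; exact: subset_closure.
have CO : C `<=` closure (row_mean @` flow_orbit nu).
  move=> _ [s Ks <-] B nB.
  have [t [Ot Bt]] := Ks _ (row_mean_continuous nB).
  by exists (row_mean t); split => //; exists t.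
have Ccv : cvx C.
  move=> x y t t0 t1 /CO cx /CO cy.
  have := closure_cvx Ocv t0 t1 cx cy; have := closureS OC.
  by move=> /[apply]; rewrite -(closure_id C).1.
split=> // D Dcv KD.
apply: (minkowski_extreme clC _ Ccv Dcv); first exact: compact_bounded.
move=> _ [sigma Ks <-] ext; apply: KD; exists sigma => //; split => //.
apply: (fixed_row_mean nu Ccv _ ext) => u tau ht.
by exists tau => //; exact: closure_orbit_push Ks ht.
Qed.

End FlowMeasures.

(** * Curves and holomorphic maps in charts *)

Section Calculus.
Context {R : realType}.
Implicit Types (V W : normedModType R) (t s : R).

Lemma is_derive_unique V W (x v : V) (f : V -> W) (a b : W) :
  is_derive x v f a -> is_derive x v f b -> a = b.
Proof. by move=> [_ <-] [_ <-]. Qed.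

Lemma is_derive_differentiable V (g : R -> V) t v :
  is_derive t 1 g v -> differentiable g t /\ 'd g t 1 = v.
Proof.
move=> [dg <-]; have h := (derivable1_diffP g t).1 dg.
by split; rewrite ?deriveE.
Qed.

Lemma is_derive_curve_comp V W (f : V -> W) (g : R -> V) t v :
  is_derive t 1 g v -> differentiable f (g t) ->
  is_derive t 1 (fun s => f (g s)) ('d f (g t) v).
Proof.
move=> /is_derive_differentiable[dg <-] df.
have dfg : differentiable (f \o g) t by exact: differentiable_comp.
apply: DeriveDef; first exact/derivable1_diffP.
by rewrite deriveE// diff_comp.
Qed.

Lemma is_derive_curve_pair V W (f : R -> V) (g : R -> W) t v w :
  is_derive t 1 f v -> is_derive t 1 g w ->
  is_derive t 1 (fun s => (f s, g s)) (v, w).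
Proof.
move=> /is_derive_differentiable[df <-] /is_derive_differentiable[dg <-].
have dfg : differentiable (fun s => (f s, g s)) t by exact: differentiable_pair.
apply: DeriveDef; first exact/derivable1_diffP.
by rewrite deriveE// diff_pair.
Qed.

Lemma is_derive_reparam V (g : R -> V) (a b t : R) v :
  is_derive (a * t + b) 1 g v -> is_derive t 1 (fun s => g (a * s + b)) (a *: v).
Proof.
move=> /is_derive_differentiable[dg <-].
have h : is_derive t 1 (fun s => a * s + b) a.
  apply: is_derive_eq; rewrite /GRing.scale/=; ring.
have := is_derive_curve_comp h dg.
by rewrite -[X in 'd g _ X](mulr1 a) linearZ.
Qed.

(** Used for one-parameter groups, where the group law reduces the velocity at time [t] to one at
    time 0. *)
Lemma is_derive_translate V (g : R -> V) t v :
  is_derive (0 : R) 1 (fun s => g (t + s)) v -> is_derive t 1 g v.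
Proof.
move=> h; have := @is_derive_reparam _ (fun s => g (t + s)) 1 (- t) t v.
rewrite mul1r subrr scale1r => /(_ h).
by under [X in is_derive _ _ X _]eq_fun do rewrite mul1r addrCA subrr addr0.
Qed.

Lemma is_derive_opp V (g : R -> V) v :
  is_derive (0 : R) 1 g v -> is_derive (0 : R) 1 (fun s => g (- s)) (- v).
Proof.
move=> h; have := @is_derive_reparam _ g (-1) 0 0 v.
rewrite mulr0 addr0 scaleN1r => /(_ h).
by under [X in is_derive _ _ X _]eq_fun do rewrite mulN1r addr0.
Qed.

Lemma near_is_derive V (f g : R -> V) t v : (\forall s \near t, f s = g s) ->
  is_derive t 1 f v -> is_derive t 1 g v.
Proof. by move=> fg; exact: near_eq_is_derive. Qed.

Lemma linear_diff V W (f : V -> W) x : linear f -> continuous f ->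
  differentiable f x /\ ('d f x : V -> W) = f.
Proof.
move=> lf cf.
pose F : {linear V -> W} := HB.pack f (GRing.isLinear.Build R V W *:%R f lf).
by split; [exact: (linear_differentiable (f := F))|exact: (diff_lin (f := F))].
Qed.

Lemma zero_derive_real (f : R -> R) (a b : R) : a <= b ->
  (forall t, a <= t -> t <= b -> is_derive t 1 f 0) -> f b = f a.
Proof.
move=> ab H; have [| |c _ /eqP] := @MVT_segment _ f (fun=> 0) a b ab.
- by move=> t; rewrite in_itv/= => /andP[/ltW ? /ltW ?]; exact: H.
- apply: derivable_within_continuous => t; rewrite in_itv/= => /andP[? ?].
  by have [] := H t _ _.
by rewrite mul0r subr_eq0 => /eqP.
Qed.

End Calculus.

Section ComplexSpace.
Context {R : realType} {n : nat}.
Notation V := (Cn R n).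

Definition unitl (i : 'I_n) : V := (delta_mx ord0 i, 0).
Definition unitr (i : 'I_n) : V := (0, delta_mx ord0 i).

Lemma Cn_sum (v : V) :
  v = \sum_i v.1 ord0 i *: unitl i + \sum_i v.2 ord0 i *: unitr i.
Proof.
have f1 (F : 'I_n -> V) : (\sum_i F i).1 = \sum_i (F i).1.
  by apply: (big_morph fst).
have f2 (F : 'I_n -> V) : (\sum_i F i).2 = \sum_i (F i).2.
  by apply: (big_morph snd).
rewrite [LHS]surjective_pairing [RHS]surjective_pairing /=; congr pair.
  rewrite f1 f1 [X in _ + X]big1 ?addr0 => [|i _]; last by rewrite /= scaler0.
  exact: row_sum_delta.
rewrite f2 f2 [X in X + _]big1 ?add0r => [|i _]; last by rewrite /= scaler0.
exact: row_sum_delta.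
Qed.

Lemma coordl_continuous (i : 'I_n) : continuous (fun v : V => v.1 ord0 i).
Proof.
move=> v; apply: (@continuous_comp _ _ _ (fun v : V => v.1) (fun w : 'rV[R]_n => w ord0 i)).
  exact: cvg_fst.
exact: coord_continuous.
Qed.

Lemma coordr_continuous (i : 'I_n) : continuous (fun v : V => v.2 ord0 i).
Proof.
move=> v; apply: (@continuous_comp _ _ _ (fun v : V => v.2) (fun w : 'rV[R]_n => w ord0 i)).
  exact: cvg_snd.
exact: coord_continuous.
Qed.

Lemma coordl_linear (i : 'I_n) : linear (fun v : V => v.1 ord0 i : R^o).
Proof. by move=> a u v /=; rewrite !mxE. Qed.

Lemma coordr_linear (i : 'I_n) : linear (fun v : V => v.2 ord0 i : R^o).
Proof. by move=> a u v /=; rewrite !mxE. Qed.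

(** Expansion in the real basis formed by [unitl] and [unitr] reduces the claim to continuity of the
    coordinates. *)
Lemma Cn_linear_continuous {W : normedModType R} (f : V -> W) : linear f -> continuous f.
Proof.
move=> lf.
pose F : {linear V -> W} := HB.pack f (GRing.isLinear.Build R V W *:%R f lf).
have -> : f = fun v => \sum_i v.1 ord0 i *: f (unitl i) + \sum_i v.2 ord0 i *: f (unitr i).
  apply/funext => v; rewrite {1}(Cn_sum v) -[f]/(F : V -> W) linearD !linear_sum.
  by congr (_ + _); apply: eq_bigr => i _; rewrite linearZ.
have cs (c : 'I_n -> V -> R) (w : 'I_n -> W) : (forall i, continuous (c i)) ->
    continuous (fun v => \sum_i c i v *: w i).
  move=> cc v; elim: (index_enum _) => [|i r IH].
    by under eq_fun do rewrite big_nil; exact: cst_continuous.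
  under eq_fun do rewrite big_cons.
  apply: (@continuousD _ _ _ (fun v => c i v *: w i) (fun v => \sum_(j <- r) c j v *: w j)) => //.
  by apply: continuousZr_tmp; exact: cc.
have c1 := cs _ (fun i => f (unitl i)) coordl_continuous.
have c2 := cs _ (fun i => f (unitr i)) coordr_continuous.
by move=> v; exact: (continuousD (c1 v) (c2 v)).
Qed.

Lemma zero_derive_cst (g : R -> V) (a b : R) : a <= b ->
  (forall t, a <= t -> t <= b -> is_derive t 1 g 0) -> g b = g a.
Proof.
move=> ab H.
have coord (l : V -> R) : linear (l : V -> R^o) -> continuous l -> l (g b) = l (g a).
  move=> ll cl; apply: (@zero_derive_real _ (fun t => l (g t)) a b ab) => t at_ tb.
  have [dl _] := linear_diff (g t) ll cl.
  by have := is_derive_curve_comp (H t at_ tb) dl; rewrite linear0.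
rewrite [LHS]surjective_pairing [RHS]surjective_pairing; congr pair.
  apply/rowP => i; apply: (coord (fun v => v.1 ord0 i)); first exact: coordl_linear.
  exact: coordl_continuous.
apply/rowP => i; apply: (coord (fun v => v.2 ord0 i)); first exact: coordr_linear.
exact: coordr_continuous.
Qed.

End ComplexSpace.

Section ChartCurves.
Context {R : realType}.

Lemma chart_near {S T : topologicalType} {V : normedModType R} (c : chart T V)
    (g : S -> T) t : is_chart c -> {for t, continuous g} -> cdom c (g t) ->
  \forall s \near t, cdom c (g s).
Proof. by move=> [oc _ _ _ _] cg ct; apply: cg; exact: open_nbhs_nbhs. Qed.

(* A continuous curve with zero velocity in all charts is locally constant,
   hence constant because R is connected. *)
Lemma curve_cst {T : topologicalType} {n : nat} (A : set (chart T (Cn R n)))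
    (hA : complex_manifold A) (g : R -> T) : continuous g ->
  (forall t c, A c -> cdom c (g t) -> is_derive t 1 (fun s => cmap c (g s)) 0) ->
  forall t, g t = g 0.
Proof.
move=> cg H t; have [hT _ chA cov _] := hA.
have loc s : \forall s' \near s, g s' = g s.
  have [c Ac cs] := cov (g s).
  have [oc _ K _ _] := chA c Ac.
  have /nbhs_ballP[e e0 He] := chart_near (chA c Ac) (cg s) cs.
  apply/nbhs_ballP; exists e => // s' ss'.
  (* The curve stays in one chart between [s] and [s'], so the zero derivative can be integrated in
     coordinates. *)
  have ball_in r : (s <= r <= s') || (s' <= r <= s) -> cdom c (g r).
    move=> h; apply: He; move: ss'; rewrite -!ball_normE/= !ltr_norml.
    by move=> /andP[? ?]; apply/andP; case/orP: h => /andP[? ?]; split; lra.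
  have e1 : cmap c (g s') = cmap c (g s).
    have [ss|ss] := leP s s'.
      apply: (@zero_derive_cst _ _ (fun s => cmap c (g s)) _ _ ss) => r r1 r2; apply: H => //.
      by apply: ball_in; rewrite r1 r2.
    apply/esym/(@zero_derive_cst _ _ (fun s => cmap c (g s)) _ _ (ltW ss)) => r r1 r2; apply: H => //.
    by apply: ball_in; rewrite r1 r2 orbT.
  rewrite -(K _ cs) -e1 K//; apply: ball_in.
  by rewrite !lexx !andbT le_total.
pose E := [set s | g s = g 0].
have oE : open E.
  by rewrite openE => s; rewrite /E/= => <-; exact: loc.
have cE : closed E.
  rewrite -openC openE => s nE; apply: filterS (loc s) => s' ss'.
  by rewrite /E/= => e; apply: nE; rewrite /E/= -ss'.
have : E = setT.
  have : connected [set: R].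
    rewrite (_ : setT = [set` `]-oo, +oo[%R]); last by apply/seteqP; split.
    apply/connected_intervalP; exact: interval_is_interval.
  move/(_ E); apply; first by exists 0.
  - by exists E; rewrite ?setTI.
  - by exists E; rewrite ?setTI.
by move=> ET; have : E t by rewrite ET.
Qed.

End ChartCurves.

(** * Holomorphic maps of two variables along curves *)

Section HolomorphicMap2.
Context {R : realType}.
Context {T1 T2 T' : topologicalType} {n1 n2 n' : nat}.
Variables (A1 : set (chart T1 (Cn R n1))) (A2 : set (chart T2 (Cn R n2)))
  (A' : set (chart T' (Cn R n'))).
Hypothesis m1 : complex_manifold A1.
Hypothesis m2 : complex_manifold A2.
Variable f : T1 -> T2 -> T'.
Hypothesis hf : holo_map2 A1 A2 A' f.

Definition chart_rep2 c1 c2 c' (v : Cn R n1 * Cn R n2) : Cn R n' :=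
  cmap c' (f (cinv c1 v.1) (cinv c2 v.2)).

Let dom c1 c2 (c' : chart T' (Cn R n')) : set (Cn R n1 * Cn R n2) := [set v |
  [/\ ccod c1 v.1, ccod c2 v.2 & cdom c' (f (cinv c1 v.1) (cinv c2 v.2))]].

Let rep_smooth c1 c2 c' : A1 c1 -> A2 c2 -> A' c' ->
  holo_on Jc2 Jc (dom c1 c2 c') (chart_rep2 c1 c2 c').
Proof. by case: hf => _; exact. Qed.

Let dom_at c1 c2 c' x y : A1 c1 -> A2 c2 -> A' c' -> cdom c1 x -> cdom c2 y ->
  cdom c' (f x y) -> dom c1 c2 c' (cmap c1 x, cmap c2 y).
Proof.
move=> h1 h2 h' x1 y2 fxy.
have [_ _ ch1 _ _] := m1; have [_ _ ch2 _ _] := m2.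
have [_ _ K1 _ _] := ch1 _ h1; have [_ _ K2 _ _] := ch2 _ h2.
by split => /=; [exists x|exists y|rewrite K1// K2].
Qed.

Section At.
Variables (c1 : chart T1 (Cn R n1)) (c2 : chart T2 (Cn R n2)) (c' : chart T' (Cn R n')).
Variables (x : T1) (y : T2).
Hypotheses (h1 : A1 c1) (h2 : A2 c2) (h' : A' c').
Hypotheses (x1 : cdom c1 x) (y2 : cdom c2 y) (fxy : cdom c' (f x y)).

Lemma chart_rep2_diff : differentiable (chart_rep2 c1 c2 c') (cmap c1 x, cmap c2 y).
Proof.
have [sm _] := rep_smooth h1 h2 h'; have [+ _] := sm 1%N.
by apply; exact: dom_at.
Qed.

Lemma chart_rep2_Jc v : 'd (chart_rep2 c1 c2 c') (cmap c1 x, cmap c2 y) (Jc2 v) =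
  Jc ('d (chart_rep2 c1 c2 c') (cmap c1 x, cmap c2 y) v).
Proof.
by have [_ H] := rep_smooth h1 h2 h'; apply: H; exact: dom_at.
Qed.

(** Second-order smoothness, needed to differentiate [Ad] and to see that fundamental fields are
    continuous. *)
Lemma chart_rep2_D_diff w :
  differentiable ('D_w (chart_rep2 c1 c2 c')) (cmap c1 x, cmap c2 y).
Proof.
have [sm _] := rep_smooth h1 h2 h'; have [_ +] := sm 2%N.
by move=> /(_ w) [+ _]; apply; exact: dom_at.
Qed.

End At.

Lemma map2_curve c1 c2 c' (g1 : R -> T1) (g2 : R -> T2) (t : R) v1 v2 :
  A1 c1 -> A2 c2 -> A' c' ->
  {for t, continuous g1} -> {for t, continuous g2} ->
  cdom c1 (g1 t) -> cdom c2 (g2 t) -> cdom c' (f (g1 t) (g2 t)) ->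
  is_derive t 1 (fun s => cmap c1 (g1 s)) v1 ->
  is_derive t 1 (fun s => cmap c2 (g2 s)) v2 ->
  is_derive t 1 (fun s => cmap c' (f (g1 s) (g2 s)))
    ('d (chart_rep2 c1 c2 c') (cmap c1 (g1 t), cmap c2 (g2 t)) (v1, v2)).
Proof.
move=> h1 h2 h' cg1 cg2 d1 d2 d' i1 i2.
have [_ _ ch1 _ _] := m1; have [_ _ ch2 _ _] := m2.
have [_ _ K1 _ _] := ch1 _ h1; have [_ _ K2 _ _] := ch2 _ h2.
apply: near_is_derive (is_derive_curve_comp (is_derive_curve_pair i1 i2)
  (chart_rep2_diff h1 h2 h' d1 d2 d')).
have n1' := chart_near (ch1 _ h1) cg1 d1.
have n2' := chart_near (ch2 _ h2) cg2 d2.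
by apply: filterS2 n1' n2' => s s1 s2; rewrite /chart_rep2/= K1// K2.
Qed.

Lemma map2_continuous : continuous (fun x : T1 * T2 => f x.1 x.2).
Proof. by case: hf. Qed.

Lemma map2_curve_continuous {S : topologicalType} (g1 : S -> T1) (g2 : S -> T2) t :
  {for t, continuous g1} -> {for t, continuous g2} ->
  {for t, continuous (fun s => f (g1 s) (g2 s))}.
Proof.
move=> c1 c2; apply: (@continuous_comp _ _ _ (fun s => (g1 s, g2 s)) (fun x => f x.1 x.2)).
  exact: cvg_pair.
exact: map2_continuous.
Qed.

End HolomorphicMap2.

(** * Lie groups *)

Lemma is_derive_scale_curve {R : realType} {W : normedModType R} (a : R -> R) (g : R -> W)
    (t a' : R) (g' : W) :
  is_derive t 1 a a' -> is_derive t 1 g g' ->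
  is_derive t 1 (fun s => a s *: g s) (a t *: g' + a' *: g t).
Proof.
move=> da dg.
have bl : bilinear_for (GRing.Scale.Law.clone _ _ *:%R _) (GRing.Scale.Law.clone _ _ *:%R _)
    (@GRing.scale R W : R^o -> W -> W).
  split=> [u'|u] c x y /=; first by rewrite scalerDl scalerA.
  by rewrite scalerDr !scalerA mulrC.
pose F : {bilinear R^o -> W -> W} := HB.pack (@GRing.scale R W : R^o -> W -> W)
  (bilinear_isBilinear.Build R R^o W W _ _ (@GRing.scale R W : R^o -> W -> W) bl).
have Fc : continuous (fun p : R^o * W => F p.1 p.2) by exact: scale_continuous.
have dF := differentiable_bilin (a t, g t) Fc.
have := is_derive_curve_comp (is_derive_curve_pair (da : is_derive t 1 (a : R -> R^o) a') dg) dF.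
by rewrite diff_bilin.
Qed.

Section PartialLinear.
Context {R : realType}.

Lemma linear_inl (V W E : normedModType R) (D : V * W -> E) : linear D -> linear (fun v => D (v, 0)).
Proof.
move=> lD a u v; rewrite -lD; congr D.
by rewrite [RHS]surjective_pairing; congr pair; rewrite /= scaler0 addr0.
Qed.

Lemma linear_inr (V W E : normedModType R) (D : V * W -> E) : linear D -> linear (fun w => D (0, w)).
Proof.
move=> lD a u v; rewrite -lD; congr D.
by rewrite [RHS]surjective_pairing; congr pair; rewrite /= scaler0 addr0.
Qed.

Lemma linear_add (V W : lmodType R) (f : V -> W) : linear f ->
  forall x y, f (x + y) = f x + f y.
Proof. by move=> lf x y; have := lf 1 x y; rewrite !scale1r. Qed.

Lemma linear_zero (V W : lmodType R) (f : V -> W) : linear f -> f 0 = 0.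
Proof.
by move=> lf; apply: (@addrI _ (f 0)); rewrite -(linear_add lf) !addr0.
Qed.

Lemma linear_scale (V W : lmodType R) (f : V -> W) : linear f ->
  forall a x, f (a *: x) = a *: f x.
Proof.
by move=> lf a x; have := lf a x 0; rewrite (linear_zero lf) !addr0.
Qed.

Lemma linear_compose (V W E : normedModType R) (f : W -> E) (g : V -> W) :
  linear f -> linear g -> linear (fun v => f (g v)).
Proof. by move=> lf lg a u v; rewrite lg lf. Qed.

Lemma diff_linear (V W : normedModType R) (f : V -> W) x : linear ('d f x : V -> W).
Proof. exact: linearP. Qed.

End PartialLinear.

(** * One-parameter subgroups, adjoint action and bracket *)

Section LieGroup.
Context {R : realType} {G : topGroupType} {m : nat}.
Variable A : set (chart G (Cn R m)).
Hypothesis hG : complex_Lie_group A.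
Variable e : chart G (Cn R m).
Hypothesis Ae : A e.
Hypothesis e1 : cdom e 1%g.
Variable exp : Cn R m -> G.
Hypothesis hexp : is_exp e exp.
Notation V := (Cn R m).
Implicit Types (g h : G) (xi eta zeta v w : V) (t s : R).

Let hA : complex_manifold A. Proof. by case: hG. Qed.
Let hm : holo_map2 A A A (fun x y : G => (x * y)%g). Proof. by case: hG. Qed.
Let hi : holo_map A A (fun x : G => (x^-1)%g). Proof. by case: hG. Qed.
Let o := cmap e 1%g.
Let M (c1 c2 c3 : chart G V) := chart_rep2 (fun x y : G => (x * y)%g) c1 c2 c3.

Let cover g : exists2 c, A c & cdom c g. Proof. by have [_ _ _ + _] := hA; apply. Qed.

Let cst_der (c : chart G V) g t : is_derive t 1 (fun _ : R => cmap c g) 0.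
Proof. exact: is_derive_cst. Qed.

Lemma expZD xi s t : exp ((s + t) *: xi) = (exp (s *: xi) * exp (t *: xi))%g.
Proof. by have [+ _ _] := hexp xi; apply. Qed.

Lemma exp_continuous xi : continuous (fun t => exp (t *: xi)).
Proof. by have [_ + _] := hexp xi. Qed.

Lemma exp_is_derive xi : is_derive (0 : R) 1 (fun t => cmap e (exp (t *: xi))) xi.
Proof. by have [_ _] := hexp xi. Qed.

Lemma exp0 : exp 0 = 1%g.
Proof.
have := expZD 0 0 0; rewrite !scaler0 => h.
by apply: (@mulgI _ (exp 0)); rewrite mulg1 -h.
Qed.

Lemma expN xi : exp (- xi) = (exp xi)^-1%g.
Proof.
have := expZD xi 1 (-1); rewrite subrr scale0r exp0 scaleN1r scale1r => h.
by apply: (@mulgI _ (exp xi)); rewrite -h mulgV.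
Qed.

Lemma mulg_curve c1 c2 c' (g1 g2 : R -> G) t v1 v2 : A c1 -> A c2 -> A c' ->
  {for t, continuous g1} -> {for t, continuous g2} ->
  cdom c1 (g1 t) -> cdom c2 (g2 t) -> cdom c' (g1 t * g2 t)%g ->
  is_derive t 1 (fun s => cmap c1 (g1 s)) v1 ->
  is_derive t 1 (fun s => cmap c2 (g2 s)) v2 ->
  is_derive t 1 (fun s => cmap c' (g1 s * g2 s)%g)
    ('d (M c1 c2 c') (cmap c1 (g1 t), cmap c2 (g2 t)) (v1, v2)).
Proof. exact: (map2_curve hA hA hm). Qed.

Lemma mulg_curve_continuous {S : topologicalType} (g1 g2 : S -> G) (p : S) :
  {for p, continuous g1} -> {for p, continuous g2} ->
  {for p, continuous (fun x : S => g1 x * g2 x)%g}.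
Proof. exact: (map2_curve_continuous hm). Qed.

Let cstc {S : topologicalType} g (p : S) : {for p, continuous (fun _ : S => g)}.
Proof. exact: cst_continuous. Qed.

(** Each partial derivative is computed along a one-parameter subgroup, the other factor being
    constantly 1. *)
Lemma dmul11 v w : 'd (M e e e) (o, o) (v, w) = v + w.
Proof.
have -> : (v, w) = (v, 0) + (0, w) :> V * V by rewrite /GRing.add/= /add_pair/= addr0 add0r.
rewrite linearD; congr (_ + _).
  have := @mulg_curve e e e (fun t => exp (t *: v)) (fun=> 1%g) 0 v 0 Ae Ae Ae.
  rewrite scale0r exp0 mulg1 => /(_ (@exp_continuous v 0) (@cstc _ 1%g _) e1 e1 e1).
  move=> /(_ (exp_is_derive v) (cst_der e _ _)).
  under [X in is_derive _ _ X _ -> _]eq_fun do rewrite mulg1.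
  by move=> h; exact: (is_derive_unique h (exp_is_derive v)).
have := @mulg_curve e e e (fun=> 1%g) (fun t => exp (t *: w)) 0 0 w Ae Ae Ae.
rewrite scale0r exp0 mulg1 => /(_ (@cstc _ 1%g _) (@exp_continuous w 0) e1 e1 e1).
move=> /(_ (cst_der e _ _) (exp_is_derive w)).
under [X in is_derive _ _ X _ -> _]eq_fun do rewrite mul1g.
by move=> h; exact: (is_derive_unique h (exp_is_derive w)).
Qed.

Definition one_param (a : R -> G) xi := [/\ forall s t, a (s + t) = (a s * a t)%g,
  continuous a & is_derive (0 : R) 1 (fun t => cmap e (a t)) xi].

Lemma one_param0 a xi : one_param a xi -> a 0 = 1%g.
Proof.
move=> [h _ _]; apply: (@mulgI _ (a 0)).
by rewrite -h addr0 mulg1.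
Qed.

Lemma exp_one_param xi : one_param (fun t => exp (t *: xi)) xi.
Proof. by split; [exact: expZD|exact: exp_continuous|exact: exp_is_derive]. Qed.

Let translate_zero c c' (p q : G) (g : R -> G) : A c -> A c' -> cdom c (g 0) ->
  cdom c' (p * g 0 * q)%g -> {for 0, continuous g} ->
  is_derive (0 : R) 1 (fun s => cmap c (g s)) 0 ->
  is_derive (0 : R) 1 (fun s => cmap c' (p * g s * q)%g) 0.
Proof.
move=> Ac Ac' cg0 c'0 cg ig.
have [cp Acp cpp] := cover p; have [cq Acq cqq] := cover q.
have [c1 Ac1 c1p] := cover (p * g 0)%g.
have h1 := mulg_curve Acp Ac Ac1 (@cstc _ p _) cg cpp cg0 c1p (cst_der cp p 0) ig.
rewrite linear0 in h1.
have cpg : {for 0, continuous (fun s => p * g s)%g}.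
  exact: (mulg_curve_continuous (@cstc _ p _) cg).
have h2 := mulg_curve Ac1 Acq Ac' cpg (@cstc _ q _) c1p cqq c'0 h1 (cst_der cq q 0).
by rewrite linear0 in h2.
Qed.

(** The quotient [dl t = a (- t) * b t] has velocity [- xi + xi = 0] at 0. As
    [dl (s + r) = a (- s) * dl r * b s], its velocity vanishes at every time, so [dl] is constantly
    1. *)
Lemma one_param_unique a b xi : one_param a xi -> one_param b xi -> a =1 b.
Proof.
move=> ha hb t; have a0 := one_param0 ha; have b0 := one_param0 hb.
have [aD ac ad] := ha; have [bD bc bd] := hb.
pose dl t := (a (- t) * b t)%g.
have anc : continuous (fun t => a (- t)).
  by move=> s; apply: (@continuous_comp _ _ _ -%R a); [exact: opp_continuous|exact: ac].
have dlc : continuous dl by move=> s; apply: mulg_curve_continuous; [exact: anc|exact: bc].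
have rho0 : is_derive (0 : R) 1 (fun s => cmap e (dl s)) 0.
  have := mulg_curve (t := 0) Ae Ae Ae (@anc 0) (@bc 0) _ _ _ (is_derive_opp ad) bd.
  by rewrite oppr0 a0 b0 mulg1 => /(_ e1 e1 e1); rewrite dmul11 addNr.
have dlS s r : dl (s + r) = (a (- s) * dl r * b s)%g.
  by rewrite /dl opprD aD [s + r]addrC bD !mulgA.
have d0 : dl 0 = 1%g by rewrite /dl oppr0 a0 b0 mulg1.
have := curve_cst hA dlc _ t; rewrite d0 => h.
have : dl t = 1%g.
  apply: h => s c Ac cs; apply: is_derive_translate.
  under [X in is_derive _ _ X _]eq_fun do rewrite dlS.
  apply: (translate_zero Ae Ac _ _ _ rho0); rewrite ?d0//; last exact: dlc.
  by rewrite -d0 -dlS addr0.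
rewrite /dl => /(congr1 (fun x => a t * x)%g).
by rewrite mulgA -aD subrr a0 mul1g mulg1.
Qed.

(** Conjugation is a left followed by a right multiplication, each read in charts. The result
    depends on the curve only through its velocity [v], so [Ad] may be computed along any curve
    tangent to [v]. *)
Lemma Ad_chart c ci g v : A c -> A ci -> cdom c g -> cdom ci g^-1%g ->
  forall gm : R -> G, gm 0 = 1%g -> {for 0, continuous gm} ->
  is_derive (0 : R) 1 (fun t => cmap e (gm t)) v ->
  is_derive (0 : R) 1 (fun t => cmap e (g * gm t * g^-1)%g)
   ('d (M c ci e) (cmap c g, cmap ci g^-1%g) ('d (M c e c) (cmap c g, o) (0, v), 0)).
Proof.
move=> Ac Aci cg cig gm gm0 gmc gmd.
have h1 := mulg_curve (t := 0) Ac Ae Ac (@cstc _ g _) gmc cg _ _ (cst_der c g 0) gmd.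
rewrite gm0 mulg1 in h1; have {}h1 := h1 e1 cg.
have cgg : {for 0, continuous (fun s => g * gm s)%g}.
  exact: (mulg_curve_continuous (@cstc _ g _) gmc).
have := mulg_curve (t := 0) Ac Aci Ae cgg (@cstc _ g^-1%g _) _ cig _ h1 (cst_der ci _ 0).
by rewrite gm0 mulg1 mulgV; apply.
Qed.

Let Ad_form c ci g v : A c -> A ci -> cdom c g -> cdom ci g^-1%g ->
  Ad e exp g v =
  'd (M c ci e) (cmap c g, cmap ci g^-1%g) ('d (M c e c) (cmap c g, o) (0, v), 0).
Proof.
move=> Ac Aci cg cig.
have := Ad_chart Ac Aci cg cig _ (@exp_continuous v 0) (exp_is_derive v).
by rewrite scale0r exp0 => /(_ erefl) [_ <-]; rewrite /Ad derive1E.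
Qed.

Lemma Ad_curve g v (gm : R -> G) : gm 0 = 1%g -> {for 0, continuous gm} ->
  is_derive (0 : R) 1 (fun t => cmap e (gm t)) v ->
  is_derive (0 : R) 1 (fun t => cmap e (g * gm t * g^-1)%g) (Ad e exp g v).
Proof.
move=> gm0 gmc gmd; have [c Ac cg] := cover g; have [ci Aci cig] := cover g^-1%g.
by rewrite (Ad_form v Ac Aci cg cig); exact: Ad_chart.
Qed.

Lemma Ad_linear g : linear (Ad e exp g).
Proof.
have [c Ac cg] := cover g; have [ci Aci cig] := cover g^-1%g.
have l1 := linear_inr (diff_linear (M c e c) (cmap c g, o)).
have l2 := linear_inl (diff_linear (M c ci e) (cmap c g, cmap ci g^-1%g)).
have l := linear_compose l2 l1.
have eA : Ad e exp g = _ := funext (fun v => Ad_form v Ac Aci cg cig).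
by rewrite eA; exact: l.
Qed.

Lemma Jc0 : Jc (0 : V) = 0.
Proof. by rewrite /Jc /= oppr0. Qed.

Lemma Ad_Jc g v : Ad e exp g (Jc v) = Jc (Ad e exp g v).
Proof.
have [c Ac cg] := cover g; have [ci Aci cig] := cover g^-1%g.
have eA : Ad e exp g = _ := funext (fun v => Ad_form v Ac Aci cg cig).
have cg1 : cdom c (g * 1)%g by rewrite mulg1.
have cgi : cdom e (g * g^-1)%g by rewrite mulgV.
have j1 := chart_rep2_Jc hA hA hm Ac Ae Ac cg e1 cg1.
have j2 := chart_rep2_Jc hA hA hm Ac Aci Ae cg cig cgi.
have comp (D1 D2 : V * V -> V) : (forall w : V * V, D1 (Jc2 w) = Jc (D1 w)) ->
    (forall w : V * V, D2 (Jc2 w) = Jc (D2 w)) -> D2 (D1 (0, Jc v), 0) = Jc (D2 (D1 (0, v), 0)).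
  move=> k1 k2; rewrite -k2 /Jc2 /= Jc0 -k1 /Jc2/= Jc0.
  by [].
by rewrite eA; exact: (comp _ _ j1 j2).
Qed.

Lemma conj_exp_continuous g v : continuous (fun t => g * exp (t *: v) * g^-1)%g.
Proof.
move=> t; suff : {for t, continuous (fun t => g * exp (t *: v) * g^-1)%g} by [].
apply: mulg_curve_continuous (@cstc _ _ _).
exact: mulg_curve_continuous (@cstc _ _ _) (@exp_continuous v t).
Qed.

Lemma Ad_mul g h v : Ad e exp (g * h)%g v = Ad e exp g (Ad e exp h v).
Proof.
have h1 := Ad_curve (g * h)%g _ (@exp_continuous v 0) (exp_is_derive v).
have h2 := Ad_curve h _ (@exp_continuous v 0) (exp_is_derive v).
rewrite scale0r exp0 in h1 h2.
have h3 := Ad_curve g _ _ (h2 erefl).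
have {}h1 := h1 erefl.
suff h4 : is_derive (0 : R) 1 (fun t => cmap e (g * h * exp (t *: v) * (g * h)^-1)%g)
    (Ad e exp g (Ad e exp h v)) by exact: is_derive_unique h1 h4.
under [X in is_derive _ _ X _]eq_fun do rewrite invgM !mulgA.
have h3c : {for 0, continuous (fun t => h * exp (t *: v) * h^-1)%g}.
  exact: conj_exp_continuous.
have := h3 _ h3c; rewrite scale0r exp0 mulg1 mulgV => /(_ erefl).
by under [X in is_derive _ _ X _ -> _]eq_fun do rewrite !mulgA.
Qed.

Lemma Ad_exp g xi : exp (Ad e exp g xi) = (g * exp xi * g^-1)%g.
Proof.
rewrite -{1}[Ad e exp g xi]scale1r -{2}[xi]scale1r.
apply: (one_param_unique (exp_one_param _) (b := fun t => (g * exp (t *: xi) * g^-1)%g)).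
split.
- by move=> s t; rewrite expZD !mulgA mulgVK.
- exact: conj_exp_continuous.
- by apply: Ad_curve; [rewrite scale0r exp0|exact: exp_continuous|exact: exp_is_derive].
Qed.

Lemma AdZ g a v : Ad e exp g (a *: v) = a *: Ad e exp g v.
Proof. exact: (linear_scale (@Ad_linear g)). Qed.

Lemma AdD g u v : Ad e exp g (u + v) = Ad e exp g u + Ad e exp g v.
Proof. exact: (linear_add (@Ad_linear g)). Qed.

Lemma Ad_continuous g : continuous (Ad e exp g).
Proof. exact: Cn_linear_continuous (@Ad_linear g). Qed.

Lemma Ad_comp_curve g (c : R -> V) t c' : is_derive t 1 c c' ->
  is_derive t 1 (fun s => Ad e exp g (c s)) (Ad e exp g c').
Proof.
move=> dc; have [dA eA] := linear_diff (c t) (@Ad_linear g) (@Ad_continuous g).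
by have := is_derive_curve_comp dc dA; rewrite eA.
Qed.

Lemma Ad_self xi t : Ad e exp (exp (t *: xi)) xi = xi.
Proof.
have h := Ad_curve (exp (t *: xi)) _ (@exp_continuous xi 0) (exp_is_derive xi).
rewrite scale0r exp0 in h; apply: (is_derive_unique (h erefl)).
under [X in is_derive _ _ X _]eq_fun => s.
  rewrite -expZD -expN -scaleNr -expZD addrAC subrr add0r; over.
exact: exp_is_derive.
Qed.

Let inv1 : cinv e o = 1%g.
Proof. by have [_ _ ch _ _] := hA; have [_ _ K _ _] := ch _ Ae; rewrite K. Qed.

Let inv_chart (x : V) : V := cmap e (cinv e x)^-1%g.

Let inv_chart_o : inv_chart o = o.
Proof. by rewrite /inv_chart inv1 invg1. Qed.

Let inv_chart_diff : differentiable inv_chart o.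
Proof.
have [_ /(_ e e Ae Ae) [sm _]] := hi; have [+ _] := sm 1%N; apply.
by split; [exists 1%g|rewrite inv1 invg1].
Qed.

(** [L eta x] is the left translate of [eta] to the point with coordinates [x], and [P w x] below
    the right translate of [w] from there back to 1. Thus [Ad] is [P w x] at [w = L eta x];
    expanding [w] in the real basis leaves only functions of [x] to differentiate. *)
Let L eta (x : V) : V := 'D_(0, eta) (M e e e) (x, o).
Let P w (x : V) : V := 'D_(w, 0) (M e e e) (x, inv_chart x).

Let L_diff eta : differentiable (L eta) o.
Proof.
have D := chart_rep2_D_diff hA hA hm Ae Ae Ae e1 e1 (_ : cdom e (1 * 1)%g) (0, eta).
rewrite mulg1 in D; have {}D := D e1.
have dp : differentiable (fun x : V => (x, o)) o by exact: differentiable_pair.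
exact: (differentiable_comp dp D).
Qed.

Let P_diff w : differentiable (P w) o.
Proof.
have D := chart_rep2_D_diff hA hA hm Ae Ae Ae e1 e1 (_ : cdom e (1 * 1)%g) (w, 0).
rewrite mulg1 in D; have {}D := D e1.
have dp : differentiable (fun x : V => (x, inv_chart x)) o by exact: differentiable_pair.
have {}D : differentiable ('D_(w, 0) (M e e e)) (o, inv_chart o) by rewrite inv_chart_o.
exact: (differentiable_comp dp D).
Qed.

(* The derivative of Ad(exp(t xi)) eta at 0, in coordinates. *)
Let ad xi eta : V :=
  \sum_i ((L eta o).1 ord0 i *: 'd (P (unitl i)) o xi +
          ('d (L eta) o xi).1 ord0 i *: P (unitl i) o) +
  \sum_i ((L eta o).2 ord0 i *: 'd (P (unitr i)) o xi +
          ('d (L eta) o xi).2 ord0 i *: P (unitr i) o).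

Let adD xi xi' eta : ad (xi + xi') eta = ad xi eta + ad xi' eta.
Proof.
have gen (f : V -> V) (p q : 'I_m -> V -> V) (a b : 'I_m -> R) (r s : 'I_m -> V) :
    linear f -> (forall i, linear (p i)) -> (forall i, linear (q i)) ->
    let F x := \sum_i (a i *: p i x + (f x).1 ord0 i *: r i) +
               \sum_i (b i *: q i x + (f x).2 ord0 i *: s i) in F (xi + xi') = F xi + F xi'.
  move=> lf lp lq F; rewrite /F [RHS]addrACA; congr (_ + _); rewrite -big_split /=; apply: eq_bigr => i _;
    by rewrite linear_add// (linear_add lf)/= mxE scalerDr scalerDl addrACA.
exact: (gen _ _ _ _ _ _ _ (diff_linear (L eta) o) (fun i => diff_linear (P (unitl i)) o)
  (fun i => diff_linear (P (unitr i)) o)).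
Qed.

Let Ad_expand g eta : cdom e g -> cdom e g^-1%g ->
  Ad e exp g eta =
   \sum_i (L eta (cmap e g)).1 ord0 i *: P (unitl i) (cmap e g) +
   \sum_i (L eta (cmap e g)).2 ord0 i *: P (unitr i) (cmap e g).
Proof.
move=> cg cgi; rewrite (Ad_form eta Ae Ae cg cgi).
have [_ _ ch _ _] := hA; have [_ _ K _ _] := ch _ Ae.
have d1 : differentiable (M e e e) (cmap e g, o).
  by apply: (chart_rep2_diff hA hA hm Ae Ae Ae cg e1); rewrite mulg1.
have d2 : differentiable (M e e e) (cmap e g, cmap e g^-1%g).
  by apply: (chart_rep2_diff hA hA hm Ae Ae Ae cg cgi); rewrite mulgV.
have ig : inv_chart (cmap e g) = cmap e g^-1%g by rewrite /inv_chart K.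
have gen (D : V * V -> V) (l : V) (p : V -> V) : linear D -> (forall w, p w = D (w, 0)) ->
    D (l, 0) = \sum_i l.1 ord0 i *: p (unitl i) + \sum_i l.2 ord0 i *: p (unitr i).
  move=> lD ep.
  pose F : {linear V -> V} := HB.pack (fun w => D (w, 0))
    (GRing.isLinear.Build R V V *:%R (fun w => D (w, 0)) (linear_inl lD)).
  rewrite -[LHS]/(F l) {1}(Cn_sum l) linearD !linear_sum.
  by congr (_ + _); apply: eq_bigr => i _; rewrite linearZ ep.
have el : L eta (cmap e g) = _ := deriveE (0, eta) d1.
have eP w : P w (cmap e g) = 'd (M e e e) (cmap e g, cmap e g^-1%g) (w, 0).
  by rewrite /P ig; exact: (deriveE (w, 0) d2).
exact: (etrans (congr1 (fun z => 'd (M e e e) (cmap e g, cmap e g^-1%g) (z, 0)) (esym el))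
  (gen _ _ (P^~ (cmap e g)) (diff_linear _ _) eP)).
Qed.

Let near_chart xi : \forall t \near (0 : R), cdom e (exp (t *: xi)).
Proof.
have [_ _ ch _ _] := hA.
by apply: (chart_near (ch _ Ae) (@exp_continuous xi 0)); rewrite scale0r exp0.
Qed.

Let Ad_derive0 xi eta :
  is_derive (0 : R) 1 (fun t => Ad e exp (exp (t *: xi)) eta) (ad xi eta).
Proof.
pose x t := cmap e (exp (t *: xi)).
have x0 : x 0 = o by rewrite /x scale0r exp0.
pose E t := \sum_i (L eta (x t)).1 ord0 i *: P (unitl i) (x t) +
            \sum_i (L eta (x t)).2 ord0 i *: P (unitr i) (x t).
apply: (@near_is_derive _ _ E).
  have ni : \forall t \near (0 : R), cdom e (exp (t *: xi))^-1%g.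
    apply: filterS (near_chart (- xi)) => t.
    by rewrite scalerN expN.
  apply: filterS2 (near_chart xi) ni => t c1 c2.
  by rewrite Ad_expand.
have dx : is_derive (0 : R) 1 x xi by exact: exp_is_derive.
have dL : is_derive (0 : R) 1 (fun t => L eta (x t)) ('d (L eta) o xi).
  by have := is_derive_curve_comp dx (_ : differentiable (L eta) (x 0)); rewrite x0; apply; exact: L_diff.
have dP w : is_derive (0 : R) 1 (fun t => P w (x t)) ('d (P w) o xi).
  by have := is_derive_curve_comp dx (_ : differentiable (P w) (x 0)); rewrite x0; apply; exact: P_diff.
have coord (l : V -> R) : linear (l : V -> R^o) -> continuous l ->
    is_derive (0 : R) 1 (fun t => l (L eta (x t))) (l ('d (L eta) o xi)).
  move=> ll cl; have [dl dle] := linear_diff (L eta (x 0)) ll cl.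
  by have := is_derive_curve_comp dL dl; rewrite dle.
have dlr i := is_derive_scale_curve (coord _ (@coordl_linear _ _ i) (@coordl_continuous _ _ i)) (dP (unitl i)).
have drr i := is_derive_scale_curve (coord _ (@coordr_linear _ _ i) (@coordr_continuous _ _ i)) (dP (unitr i)).
rewrite x0 in dlr drr.
have d1 := @is_derive_sum _ _ _ _ (fun i t => (L eta (x t)).1 ord0 i *: P (unitl i) (x t)) 0 1 _ dlr.
have d2 := @is_derive_sum _ _ _ _ (fun i t => (L eta (x t)).2 ord0 i *: P (unitr i) (x t)) 0 1 _ drr.
have eS (F : 'I_m -> R -> V) t : (\sum_i F i) t = \sum_i F i t by rewrite fct_sumE.
have eE : _ + _ = E := funext (fun t => congr2 +%R (eS (fun i t => (L eta (x t)).1 ord0 i *: P (unitl i) (x t)) t)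
  (eS (fun i t => (L eta (x t)).2 ord0 i *: P (unitr i) (x t)) t)).
by rewrite -eE; exact: (is_deriveD d1 d2).
Qed.

Lemma bracket_derive xi eta :
  is_derive (0 : R) 1 (fun t => Ad e exp (exp (t *: xi)) eta) (bracket e exp xi eta).
Proof. by have h := Ad_derive0 xi eta; have [_ e2] := h; rewrite /bracket derive1E e2. Qed.

(** Not visible on [exp (t *: xi)], but clear on the coordinate formula [ad], where [xi] occurs only
    inside differentials. *)
Lemma bracketDl xi xi' eta :
  bracket e exp (xi + xi') eta = bracket e exp xi eta + bracket e exp xi' eta.
Proof.
have be x : bracket e exp x eta = ad x eta.
  by exact: (is_derive_unique (bracket_derive x eta) (Ad_derive0 x eta)).
by rewrite !be adD.
Qed.

Lemma bracketDr xi eta eta' :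
  bracket e exp xi (eta + eta') = bracket e exp xi eta + bracket e exp xi eta'.
Proof.
apply: (is_derive_unique (bracket_derive xi _)).
under [X in is_derive _ _ X _]eq_fun do rewrite AdD.
exact: is_deriveD (bracket_derive _ _) (bracket_derive _ _).
Qed.

Lemma Jc_linear : linear (Jc : V -> V).
Proof.
move=> a u v; rewrite [RHS]surjective_pairing; congr pair.
by rewrite /= opprD scalerN.
Qed.

Lemma bracket_Jc xi eta : bracket e exp xi (Jc eta) = Jc (bracket e exp xi eta).
Proof.
apply: (is_derive_unique (bracket_derive xi _)).
under [X in is_derive _ _ X _]eq_fun do rewrite Ad_Jc.
have [d1 d2] := linear_diff (Ad e exp (exp (0 *: xi)) eta) Jc_linear (Cn_linear_continuous Jc_linear).
by have := is_derive_curve_comp (bracket_derive xi eta) d1; rewrite d2.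
Qed.

Lemma bracket_self xi : bracket e exp xi xi = 0.
Proof.
apply: (is_derive_unique (bracket_derive xi _)).
under [X in is_derive _ _ X _]eq_fun do rewrite Ad_self.
exact: is_derive_cst.
Qed.

Lemma bracketC xi eta : bracket e exp xi eta = - bracket e exp eta xi.
Proof.
have gen (f : V -> V -> V) : (forall x y z, f (x + y) z = f x z + f y z) ->
    (forall x y z, f x (y + z) = f x y + f x z) -> (forall x, f x x = 0) ->
    f xi eta = - f eta xi.
  move=> fl fr f0; have := f0 (xi + eta); rewrite fl !fr !f0 add0r addr0.
  by move=> /eqP; rewrite addr_eq0 => /eqP.
exact: (gen _ bracketDl bracketDr bracket_self).
Qed.

Lemma bracket_JcJc xi eta : bracket e exp (Jc xi) (Jc eta) = bracket e exp eta xi.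
Proof.
have gen (f : V -> V -> V) : (forall x y, f x (Jc y) = Jc (f x y)) ->
    (forall x y, f x y = - f y x) -> f (Jc xi) (Jc eta) = f eta xi.
  move=> fJ fC; rewrite fJ fC fJ.
  by rewrite /Jc /= !opprK -surjective_pairing.
exact: (gen _ bracket_Jc bracketC).
Qed.

(** By multiplicativity of [Ad], the derivative at time [t] is the image under [Ad] of the
    derivative at 0, which is the bracket. *)
Lemma Ad_exp_fix xi eta : bracket e exp xi eta = 0 ->
  forall t, Ad e exp (exp (t *: xi)) eta = eta.
Proof.
move=> b0.
have d t : is_derive t 1 (fun t => Ad e exp (exp (t *: xi)) eta) 0.
  apply: is_derive_translate.
  under [X in is_derive _ _ X _]eq_fun do rewrite expZD Ad_mul.
  have := Ad_comp_curve (exp (t *: xi)) (bracket_derive xi eta).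
  by rewrite b0 (linear_zero (@Ad_linear _)).
have A0 : Ad e exp (exp (0 *: xi)) eta = eta.
  have h := Ad_curve 1%g _ (@exp_continuous eta 0) (exp_is_derive eta).
  rewrite scale0r exp0 in h; have {}h := h erefl.
  rewrite scale0r exp0.
  suff h' : is_derive (0 : R) 1 (fun t => cmap e (1 * exp (t *: eta) * 1^-1)%g) eta.
    exact: is_derive_unique h h'.
  under [X in is_derive _ _ X _]eq_fun do rewrite mul1g invg1 mulg1.
  exact: exp_is_derive.
move=> t; rewrite -[RHS]A0; have [t0|t0] := leP 0 t.
  by apply: (zero_derive_cst (g := fun t => Ad e exp (exp (t *: xi)) eta) t0) => s _ _; exact: d.
by apply/esym; apply: (zero_derive_cst (g := fun t => Ad e exp (exp (t *: xi)) eta) (ltW t0)) => s _ _; exact: d.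
Qed.

(** The two subgroups commute, so their product is a one-parameter subgroup; its velocity is
    [xi + eta] by [dmul11]. *)
Lemma exp_commute xi eta : bracket e exp xi eta = 0 ->
  exp (xi + eta) = (exp xi * exp eta)%g.
Proof.
move=> b0.
have comm s t : (exp (s *: xi) * exp (t *: eta) = exp (t *: eta) * exp (s *: xi))%g.
  have := Ad_exp (exp (s *: xi)) (t *: eta).
  by rewrite AdZ (Ad_exp_fix b0) => {2}->; rewrite mulgVK.
rewrite -[xi + eta]scale1r -{2}[xi]scale1r -{2}[eta]scale1r.
apply: (one_param_unique (exp_one_param _) (b := fun t => (exp (t *: xi) * exp (t *: eta))%g)).
split.
- move=> s t; rewrite !expZD !mulgA; congr (_ * _)%g.
  by rewrite -!mulgA comm.
- move=> t; exact: (mulg_curve_continuous (@exp_continuous xi t) (@exp_continuous eta t)).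
- have := mulg_curve (t := 0) Ae Ae Ae (@exp_continuous xi 0) (@exp_continuous eta 0) _ _ _
    (exp_is_derive xi) (exp_is_derive eta).
  by rewrite !scale0r exp0 mulg1 dmul11; apply.
Qed.

End LieGroup.

(** * Commutativity of [a] *)

Section AbelianSubalgebra.
Context {R : realType} {UC : topGroupType} {m : nat}.
Variable AU : set (chart UC (Cn R m)).
Hypothesis hUC : complex_Lie_group AU.
Variable e : chart UC (Cn R m).
Hypothesis AUe : AU e.
Hypothesis e1 : cdom e 1%g.
Variable exp : Cn R m -> UC.
Hypothesis hexp : is_exp e exp.
Variable U : set UC.
Hypothesis Usubgroup : subgroup U.
Hypothesis hcartan : cartan_decomposition exp U.
Variable B : Cn R m -> Cn R m -> R.
Hypothesis hB : invariant_form e exp U B.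
Notation V := (Cn R m).
Notation u := (lie_algebra exp U).
Implicit Types (xi eta zeta : V).

Let lu : linear_subspace u. Proof. by case: hcartan. Qed.

Lemma form_linear zeta : linear (fun xi => B xi zeta : R^o).
Proof. by move=> a x y; have [ [+ _] _ _ _ _] := hB; apply. Qed.

Lemma form_symmetric xi zeta : B xi zeta = B zeta xi.
Proof. by have [ [_ +] _ _ _ _] := hB; apply. Qed.

Lemma form_continuous zeta : continuous (fun xi => B xi zeta : R^o).
Proof. exact: Cn_linear_continuous (form_linear zeta). Qed.

Lemma subgroup_mul (H : set UC) x y : subgroup H -> H x -> H y -> H (x * y)%g.
Proof.
move=> [H1 HV] Hx Hy; have := HV x y^-1%g Hx; rewrite invgK; apply.
by have := HV 1%g y H1 Hy; rewrite mul1g.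
Qed.

Lemma Ad_lie_algebra g eta : U g -> u eta -> u (Ad e exp g eta).
Proof.
move=> Ug ueta t; rewrite -(AdZ hUC AUe e1 hexp) (Ad_exp hUC AUe e1 hexp).
by apply: Usubgroup.2 => //; apply: subgroup_mul => //; exact: ueta.
Qed.

(** Write the bracket as [w1 + Jc w2]. The curve of [Ad (exp (t *: xi)) eta] stays in [u],
    orthogonal to [Jc w2], and so does its derivative. Hence [B (Jc w2) (Jc w2) = 0], and positivity
    gives [w2 = 0]. *)
Lemma bracket_lie_algebra xi eta : u xi -> u eta -> u (bracket e exp xi eta).
Proof.
move=> uxi ueta; have [_ _ _ pos orth] := hB; have [_ dec _] := hcartan.
have [ [w1 w2] [ [/= u1 u2 ew] _]] := dec (bracket e exp xi eta).
have B0 zeta : u zeta -> B (bracket e exp xi eta) (Jc zeta) = 0.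
  move=> uz.
  have [d1 d2] := linear_diff (Ad e exp (exp (0 *: xi)) eta) (form_linear (Jc zeta))
    (@form_continuous (Jc zeta)).
  have h := is_derive_curve_comp (bracket_derive hUC AUe e1 hexp xi eta) d1.
  have B0 t : B (Ad e exp (exp (t *: xi)) eta) (Jc zeta) = 0.
    by apply: orth => //; apply: Ad_lie_algebra => //; exact: uxi.
  rewrite d2 in h; apply: (is_derive_unique h).
  under [X in is_derive _ _ X _]eq_fun do rewrite B0.
  exact: is_derive_cst.
have Bw : B (w1 + Jc w2) (Jc w2) = B w1 (Jc w2) + B (Jc w2) (Jc w2).
  exact: (linear_add (form_linear (Jc w2))).
rewrite ew; have := B0 _ u2; rewrite ew Bw orth// add0r => B2.
have [-> | w20] := eqVneq w2 0; first by rewrite Jc0 addr0.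
by have [+ _] := pos _ u2 w20; rewrite B2 ltxx.
Qed.

Lemma lie_algebra_Jc_disjoint xi zeta : u xi -> u zeta -> xi = Jc zeta -> xi = 0.
Proof.
move=> uxi uz exi; have [_ dec _] := hcartan.
have [w [_ wu]] := dec xi.
have w1 : w = (xi, 0) by apply: wu; split => //=; [exact: lu.1|rewrite Jc0 addr0].
have w2 : w = (0, zeta) by apply: wu; split => //=; [exact: lu.1|rewrite add0r].
by have := congr1 fst w1; rewrite w2.
Qed.

Section Commutation.
Variables (G : set UC) (a : set V).
Hypothesis ha : lie_subalgebra_of e exp (cartan_p exp U G) a.

Lemma abelian_bracket xi eta : a xi -> a eta -> bracket e exp xi eta = 0.
Proof.
have [_ ap abr] := ha; move=> axi aeta.
have [_ [xi' ux exi]] := ap _ axi; have [_ [eta' ue eeta]] := ap _ aeta.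
have [_ [z uz ez]] := ap _ (abr _ _ axi aeta).
apply: (lie_algebra_Jc_disjoint _ uz) => //.
rewrite -exi -eeta (bracket_JcJc hUC AUe e1 hexp).
exact: bracket_lie_algebra.
Qed.

Lemma abelian_expD xi eta : a xi -> a eta -> exp (xi + eta) = (exp xi * exp eta)%g.
Proof.
by move=> axi aeta; apply: (exp_commute hUC AUe e1 hexp); exact: abelian_bracket.
Qed.

Lemma abelian_scalar_product : scalar_product_on a B.
Proof.
have [_ ap _] := ha; have [ [h1 h2] _ _ pos _] := hB.
split; first by split=> [c x y z _ _ _|x y _ _]; [exact: h1|exact: h2].
move=> x ax x0; have [_ [y uy ey]] := ap _ ax.
rewrite -ey; apply: (pos y uy _).1.
by apply: contra_neq x0 => y0; rewrite -ey y0 Jc0.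
Qed.

End Commutation.

End AbelianSubalgebra.

(** * The gradient flow of the Abelian subalgebra *)

Lemma near_eq_continuous_at {S T : topologicalType} (f g : S -> T) z :
  (\forall x \near z, f x = g x) -> {for z, continuous f} -> {for z, continuous g}.
Proof.
move=> fg cf; rewrite /prop_for /continuous_at -(nbhs_singleton fg).
by apply: cvg_trans cf; apply: near_eq_cvg; apply: filterS fg => x ->.
Qed.

Lemma pair_continuous_at {S T1 T2 : topologicalType} (g1 : S -> T1) (g2 : S -> T2) s :
  {for s, continuous g1} -> {for s, continuous g2} -> {for s, continuous (fun x => (g1 x, g2 x))}.
Proof. by move=> c1 c2; exact: cvg_pair. Qed.

(** Meant for [om c] evaluated on fundamental fields. Linearity is asked only near [z], as [om c] is
    controlled only on the domain of [c]. *)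
Lemma linear_family_continuous {R : realType} {n : nat} {T : topologicalType} (z : T)
    (F : T -> Cn R n -> R) (v : T -> Cn R n) :
  (\forall x \near z, linear (F x : Cn R n -> R^o)) ->
  (forall w, {for z, continuous (F ^~ w)}) -> {for z, continuous v} ->
  {for z, continuous (fun x => F x (v x))}.
Proof.
move=> lF cF cv.
pose E x := \sum_i (v x).1 ord0 i * F x (unitl i) + \sum_i (v x).2 ord0 i * F x (unitr i).
have FE x : linear (F x : Cn R n -> R^o) -> F x (v x) = E x.
  move=> lx.
  pose G : {linear Cn R n -> R^o} := HB.pack (F x : Cn R n -> R^o)
    (GRing.isLinear.Build R (Cn R n) R^o *:%R _ lx).
  rewrite -[LHS]/(G (v x)) {1}(Cn_sum (v x)) linearD !linear_sum.
  by congr (_ + _); apply: eq_bigr => i _; rewrite linearZ.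
have cs (c w : 'I_n -> T -> R) : (forall i, {for z, continuous (c i)}) ->
    (forall i, {for z, continuous (w i)}) -> {for z, continuous (fun x => \sum_i c i x * w i x)}.
  move=> hc hw; elim: (index_enum _) => [|i r IH].
    have -> : (fun x => \sum_(i <- [::]) c i x * w i x) = fun=> 0.
      by apply/funext => x; rewrite big_nil.
    exact: cst_continuous.
  have -> : (fun x => \sum_(j <- i :: r) c j x * w j x) =
      fun x => c i x * w i x + \sum_(j <- r) c j x * w j x.
    by apply/funext => x; rewrite big_cons.
  apply: (@continuousD _ _ _ (fun x => c i x * w i x) (fun x => \sum_(j <- r) c j x * w j x)) => //.
  by apply: (@continuousM _ _ (c i) (w i)).
have cE : {for z, continuous E}.
  apply: (@continuousD _ _ _ (fun x => \sum_i (v x).1 ord0 i * F x (unitl i))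
    (fun x => \sum_i (v x).2 ord0 i * F x (unitr i))).
    apply: (cs (fun i x => (v x).1 ord0 i) (fun i x => F x (unitl i))) => i; last exact: cF.
    exact: (@continuous_comp _ _ _ v (fun w : Cn R n => w.1 ord0 i) z cv (@coordl_continuous _ _ i _)).
  apply: (cs (fun i x => (v x).2 ord0 i) (fun i x => F x (unitr i))) => i; last exact: cF.
  exact: (@continuous_comp _ _ _ v (fun w : Cn R n => w.2 ord0 i) z cv (@coordr_continuous _ _ i _)).
by apply: near_eq_continuous_at cE; apply: filterS lF => x lx; rewrite FE.
Qed.

(** * The metric pairing of fundamental fields *)

Section GradientFlow.
Context {R : realType} {UC : topGroupType} {m : nat} {Z : topologicalType} {n : nat}.
Variable AZ : set (chart Z (Cn R n)).
Variable om : chart Z (Cn R n) -> Z -> Cn R n -> Cn R n -> R.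
Hypothesis hZ : complex_manifold AZ.
Hypothesis hom : kahler_form AZ om.
Variable AU : set (chart UC (Cn R m)).
Hypothesis hUC : complex_Lie_group AU.
Variable e : chart UC (Cn R m).
Hypothesis AUe : AU e.
Hypothesis e1 : cdom e 1%g.
Variable exp : Cn R m -> UC.
Hypothesis hexp : is_exp e exp.
Variable act : UC -> Z -> Z.
Hypothesis hact : holomorphic_action AZ act AU.
Notation g_ := (Cn R m).
Implicit Types (xi beta : g_) (z : Z) (t s : R) (c : chart Z (Cn R n)).

Let hU : complex_manifold AU. Proof. by case: hUC. Qed.
Let act1 z : act 1%g z = z. Proof. by have [+ _ _] := hact; apply. Qed.
Let actM g h z : act (g * h)%g z = act g (act h z).
Proof. by have [_ + _] := hact; apply. Qed.
Let hact2 : holo_map2 AU AZ AZ act. Proof. by case: hact. Qed.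
Let chZ c : AZ c -> is_chart c. Proof. by have [_ _ + _ _] := hZ; apply. Qed.
Let coverZ z : exists2 c, AZ c & cdom c z. Proof. by have [_ _ _ + _] := hZ; apply. Qed.
Let cK c z : AZ c -> cdom c z -> cinv c (cmap c z) = z.
Proof. by move=> /chZ[_ _ + _ _]; apply. Qed.
Let cmapc c z : AZ c -> cdom c z -> {for z, continuous (cmap c)}.
Proof. by move=> /chZ[_ _ _ + _]; apply. Qed.
Let near_dom c z : AZ c -> cdom c z -> \forall x \near z, cdom c x.
Proof. by move=> /chZ[oc _ _ _ _] cz; exact: open_nbhs_nbhs. Qed.
Let exp00 xi : exp (0 *: xi) = 1%g. Proof. by rewrite scale0r (exp0 hexp). Qed.

Let expc xi t : {for t, continuous (fun t => exp (t *: xi))}.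
Proof. exact: (exp_continuous hexp). Qed.
Let cstc {T : topologicalType} (y : T) t : {for t, continuous (fun _ : R => y)}.
Proof. exact: cst_continuous. Qed.

Let cst_der {W : normedModType R} (y : W) t : is_derive t 1 (fun _ : R => y) 0.
Proof. exact: is_derive_cst. Qed.

Lemma act_exp_continuous xi z : continuous (fun t => act (exp (t *: xi)) z).
Proof.
move=> t; apply: (map2_curve_continuous hact2 (g1 := fun t => exp (t *: xi)) (g2 := fun=> z)).
  exact: (exp_continuous hexp).
exact: cst_continuous.
Qed.

Lemma act_continuous g : continuous (act g).
Proof.
move=> z; apply: (map2_curve_continuous hact2 (g1 := fun=> g) (g2 := fun z => z)).
  exact: cst_continuous.
exact: cvg_id.
Qed.

Let act0_is_derive xi c z : AZ c -> cdom c z ->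
  is_derive (0 : R) 1 (fun s => cmap c (act (exp (s *: xi)) z))
    ('d (chart_rep2 act e c c) (cmap e 1%g, cmap c z) (xi, 0)).
Proof.
move=> Ac cz.
have := map2_curve hU hZ hact2 AUe Ac Ac (@expc xi 0)
  (@cstc _ z 0) _ cz _ (exp_is_derive hexp xi) (@cst_der _ (cmap c z) 0).
by rewrite exp00 act1; apply.
Qed.

Lemma fund_fieldE xi c z : AZ c -> cdom c z ->
  fund_field exp act c xi z = 'd (chart_rep2 act e c c) (cmap e 1%g, cmap c z) (xi, 0).
Proof.
by move=> Ac cz; rewrite /fund_field derive1E; have [_ ->] := act0_is_derive xi Ac cz.
Qed.

Lemma act_exp_is_derive xi c z t : AZ c -> cdom c (act (exp (t *: xi)) z) ->
  is_derive t 1 (fun s => cmap c (act (exp (s *: xi)) z))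
    (fund_field exp act c xi (act (exp (t *: xi)) z)).
Proof.
move=> Ac ct; apply: is_derive_translate.
under [X in is_derive _ _ X _]eq_fun do rewrite addrC (expZD hexp) actM.
by rewrite (fund_fieldE _ Ac ct); exact: act0_is_derive.
Qed.

(** In a chart the field is a directional derivative of the action at the identity, which is itself
    differentiable. *)
Lemma fund_field_continuous xi c z : AZ c -> cdom c z ->
  {for z, continuous (fun x => fund_field exp act c xi x)}.
Proof.
move=> Ac cz; pose E x := 'D_(xi, 0) (chart_rep2 act e c c) (cmap e 1%g, cmap c x).
have dif x : cdom c x -> differentiable (chart_rep2 act e c c) (cmap e 1%g, cmap c x).
  by move=> cx; apply: (chart_rep2_diff hU hZ hact2 AUe Ac Ac e1 cx); rewrite act1.
have FE x : cdom c x -> fund_field exp act c xi x = E x.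
  move=> cx; rewrite fund_fieldE//.
  exact: (esym (deriveE (xi, 0) (dif x cx))).
have cE : {for z, continuous E}.
  apply: (@continuous_comp _ _ _ (fun x => (cmap e 1%g, cmap c x)) ('D_(xi, 0) (chart_rep2 act e c c))).
    have k1 : {for z, continuous (fun _ : Z => cmap e 1%g)} by exact: cst_continuous.
    have k2 := cmapc Ac cz.
    exact: pair_continuous_at k1 k2.
  apply: differentiable_continuous.
  by apply: (chart_rep2_D_diff hU hZ hact2 AUe Ac Ac e1 cz); rewrite act1.
by apply: near_eq_continuous_at cE; apply: filterS (near_dom Ac cz) => x cx; rewrite FE.
Qed.

(* The velocity at time t is the image of the velocity at time 0 under the
   differential of act (exp (t xi)). *)
Lemma fund_field_zero xi c z : AZ c -> cdom c z -> fund_field exp act c xi z = 0 ->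
  forall t, act (exp (t *: xi)) z = z.
Proof.
move=> Ac cz f0 t.
have := curve_cst hZ (@act_exp_continuous xi z) _ t.
rewrite exp00 act1; apply => s c' Ac' cs; apply: is_derive_translate.
under [X in is_derive _ _ X _]eq_fun do rewrite (expZD hexp) actM.
have [cg AUg gg] : exists2 cg, AU cg & cdom cg (exp (s *: xi)).
  by have [_ _ _ + _] := hU; apply.
have d0 : is_derive (0 : R) 1 (fun s => cmap c (act (exp (s *: xi)) z)) 0.
  by rewrite -f0 (fund_fieldE _ Ac cz); exact: act0_is_derive.
have := map2_curve hU hZ hact2 AUg Ac Ac' (@cstc _ (exp (s *: xi)) 0)
  (@act_exp_continuous xi z 0) gg _ _ (@cst_der _ (cmap cg (exp (s *: xi))) 0) d0.
rewrite exp00 act1 => /(_ cz cs).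
by rewrite (linear_zero (diff_linear _ _)).
Qed.

Variable p : set g_.
Variable B : g_ -> g_ -> R.
Variable mup : Z -> g_.
Hypothesis hgrad : is_gradient exp AZ om act p B mup.


Lemma gradient_component_continuous beta : p beta -> continuous (fun z => B (mup z) beta).
Proof.
move=> pb z; have [c Ac cz] := coverZ z; have [df _] := hgrad pb Ac cz.
have cc : {for z, continuous (fun x => B (mup (cinv c (cmap c x))) beta)}.
  apply: (@continuous_comp _ _ _ (cmap c) (fun x => B (mup (cinv c x)) beta : R^o)).
    exact: cmapc.
  exact: differentiable_continuous.
apply: (near_eq_continuous_at _ cc); apply: filterS (near_dom Ac cz) => x cx.
by rewrite cK.
Qed.

Let rate_at xi beta c z t : p beta -> AZ c -> cdom c (act (exp (t *: xi)) z) ->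
  is_derive t 1 (fun s => B (mup (act (exp (s *: xi)) z)) beta : R^o)
    (om c (act (exp (t *: xi)) z) (fund_field exp act c xi (act (exp (t *: xi)) z))
       (Jc (fund_field exp act c beta (act (exp (t *: xi)) z)))).
Proof.
move=> pb Ac cz; have [df ed] := hgrad pb Ac cz.
have := is_derive_curve_comp (act_exp_is_derive Ac cz) df.
rewrite ed; apply: near_is_derive.
apply: filterS (chart_near (chZ Ac) (@act_exp_continuous xi z t) cz) => s cs.
by rewrite cK.
Qed.

(* The metric pairing of the two fundamental fields, expressed without charts. *)
Definition flow_rate z xi beta : R :=
  derive1 (fun t => B (mup (act (exp (t *: xi)) z)) beta : R^o) 0.

Lemma flow_rateE c z xi beta : p beta -> AZ c -> cdom c z ->
  flow_rate z xi beta = om c z (fund_field exp act c xi z) (Jc (fund_field exp act c beta z)).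
Proof.
move=> pb Ac cz; have := @rate_at xi beta c z 0 pb Ac.
by rewrite exp00 act1 => /(_ cz)[_ e']; rewrite /flow_rate derive1E.
Qed.

Lemma flow_rate_is_derive xi beta z t : p beta ->
  is_derive t 1 (fun s => B (mup (act (exp (s *: xi)) z)) beta : R^o)
    (flow_rate (act (exp (t *: xi)) z) xi beta).
Proof.
move=> pb; have [c Ac cz] := coverZ (act (exp (t *: xi)) z).
by rewrite (flow_rateE _ pb Ac cz); exact: rate_at.
Qed.

Let om_lin c z w : AZ c -> cdom c z -> linear (fun v => om c z v w : R^o).
Proof. by have [+ _ _ _ _] := hom => /[apply] /[apply] -[+ _] a x y; apply. Qed.

Let om_anti c z v w : AZ c -> cdom c z -> om c z v w = - om c z w v.
Proof. by have [+ _ _ _ _] := hom => /[apply] /[apply] -[_]; apply. Qed.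

Let om_linr c z v : AZ c -> cdom c z -> linear (fun w => om c z v w : R^o).
Proof.
move=> Ac cz a x y; rewrite om_anti// (om_lin v Ac cz) opprD -scalerN.
by congr (_ *: _ + _); rewrite [RHS]om_anti.
Qed.

Let om_cont c z v w : AZ c -> cdom c z -> {for z, continuous (fun x => om c x v w)}.
Proof.
move=> Ac cz; have [_ _ sm _ _] := hom.
have /(_ 0%N) /= ck := sm c Ac v w.
have cc : {for z, continuous (fun x => om c (cinv c (cmap c x)) v w)}.
  apply: (@continuous_comp _ _ _ (cmap c) (fun x => om c (cinv c x) v w : R^o)).
    exact: cmapc.
  by apply: ck; exists z.
apply: (near_eq_continuous_at _ cc); apply: filterS (near_dom Ac cz) => x cx.
by rewrite cK.
Qed.

Lemma flow_rate_continuous xi beta : p beta -> continuous (fun z => flow_rate z xi beta).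
Proof.
move=> pb z; have [c Ac cz] := coverZ z.
pose w x := Jc (fund_field exp act c beta x).
have cw : {for z, continuous w}.
  apply: (@continuous_comp _ _ _ (fund_field exp act c beta) Jc); first exact: fund_field_continuous.
  exact: Cn_linear_continuous (@Jc_linear _ _) _.
have cR v : {for z, continuous (fun x => om c x v (w x))}.
  apply: (linear_family_continuous (F := fun x => om c x v)) => //.
    by apply: filterS (near_dom Ac cz) => x cx; exact: om_linr.
  by move=> w'; exact: om_cont.
have cE : {for z, continuous (fun x => om c x (fund_field exp act c xi x) (w x))}.
  have l : \forall x \near z, linear ((fun v => om c x v (w x)) : Cn R n -> R^o).
    by apply: filterS (near_dom Ac cz) => x cx; exact: om_lin.
  exact: (linear_family_continuous (F := fun x v => om c x v (w x)) l cR
    (@fund_field_continuous xi c z Ac cz)).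
apply: (near_eq_continuous_at _ cE); apply: filterS (near_dom Ac cz) => x cx.
by rewrite (flow_rateE _ pb Ac cx).
Qed.

(** Symmetry of the Kaehler metric: [om v (Jc w) = om (Jc v) (- w) = om w (Jc v)], by invariance
    under [Jc] and antisymmetry. *)
Lemma flow_rate_sym z xi beta : p xi -> p beta -> flow_rate z xi beta = flow_rate z beta xi.
Proof.
move=> px pb; have [c Ac cz] := coverZ z.
have [_ _ _ _ /(_ c z Ac cz)[oJ _]] := hom.
rewrite (flow_rateE _ pb Ac cz) (flow_rateE _ px Ac cz).
have gen (f : Cn R n -> Cn R n -> R) v w : (forall w, linear (f^~ w : Cn R n -> R^o)) ->
    (forall v w, f v w = - f w v) -> (forall v w, f (Jc v) (Jc w) = f v w) ->
    f v (Jc w) = f w (Jc v).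
  move=> fl fa fJ; rewrite -fJ fa (_ : Jc (Jc w) = - 1 *: w); last by rewrite scaleN1r.
  by rewrite (linear_scale (fl _)) scaleN1r opprK.
by apply: gen => [w|v w|//]; [exact: om_lin|exact: om_anti].
Qed.

Lemma flow_rate_ge0 z xi : p xi -> 0 <= flow_rate z xi xi.
Proof.
move=> px; have [c Ac cz] := coverZ z.
have [_ _ _ _ /(_ c z Ac cz)[_ pos]] := hom.
rewrite (flow_rateE _ px Ac cz).
have [->|f0] := eqVneq (fund_field exp act c xi z) 0; last exact/ltW/pos.
by rewrite (linear_zero (om_lin _ Ac cz)).
Qed.

Lemma flow_rate_eq0 z xi t : p xi -> flow_rate z xi xi = 0 -> act (exp (t *: xi)) z = z.
Proof.
move=> px; have [c Ac cz] := coverZ z.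
have [_ _ _ _ /(_ c z Ac cz)[_ pos]] := hom.
rewrite (flow_rateE _ px Ac cz) => r0; apply: (fund_field_zero Ac cz).
by apply/eqP/negPn/negP => /pos; rewrite r0 ltxx.
Qed.

End GradientFlow.

Section SubtypeTopology.
Context {X : topologicalType} (A : set X).

Lemma set_val_continuous : continuous (set_val : A -> X).
Proof. exact: initial_continuous. Qed.

Lemma set_type_compact : compact A -> compact [set: A].
Proof.
move=> cA; rewrite compact_ultra => F UF _.
have FA : (set_val @ F) A.
  by apply: (@filterS _ F _ setT); [move=> x _; exact: set_valP|exact: filterT].
have [x [Ax Fx]] := cA _ (fmap_proper_filter set_val _) FA.
exists (SigSub (mem_set Ax)); split => //; apply: cvg_initial => W nW; rewrite /fmap /=.
have [//|nF] := in_ultra_setVsetC (set_val @^-1` W) UF.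
by have [y [/= ny Wy]] := Fx (~` W) W nF nW.
Qed.

Lemma set_type_hausdorff : hausdorff_space X -> hausdorff_space A.
Proof.
move=> hX p q pq; apply: val_inj; apply: hX => P Q nP nQ.
have [y [Py Qy]] := pq _ _ (set_val_continuous nP) (set_val_continuous nQ).
by exists (set_val y).
Qed.

Lemma set_type_second_countable : @second_countable X -> @second_countable A.
Proof.
move=> [Bs cB [oB bB]]; exists [set set_val @^-1` C | C in Bs]; first exact: (sub_countable (card_image_le _ _)).
split=> [_ [C BC <-]|x P].
  by apply: open_comp; [move=> y _; exact: set_val_continuous|exact: oB].
move=> /= [_ [[W oW <-] Wx WP]].
have [C [BC Cx] CW] := bB (set_val x) W (open_nbhs_nbhs (conj oW Wx)).
exists (set_val @^-1` C); first by split => //; exists C.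
by move=> y Cy; apply: WP; exact: CW.
Qed.

End SubtypeTopology.

(** * Transfer between [a] and its coordinate space *)

Section AbelianFlow.
Context {R : realType} {UC : topGroupType} {m : nat} {Z : topologicalType} {n : nat}.
Variable AZ : set (chart Z (Cn R n)).
Variable om : chart Z (Cn R n) -> Z -> Cn R n -> Cn R n -> R.
Hypothesis hZ : complex_manifold AZ.
Hypothesis hom : kahler_form AZ om.
Variable AU : set (chart UC (Cn R m)).
Hypothesis hUC : complex_Lie_group AU.
Variable e : chart UC (Cn R m).
Hypothesis AUe : AU e.
Hypothesis e1 : cdom e 1%g.
Variable exp : Cn R m -> UC.
Hypothesis hexp : is_exp e exp.
Variable act : UC -> Z -> Z.
Hypothesis hact : holomorphic_action AZ act AU.
Variables (G : set UC) (p a : set (Cn R m)) (B : Cn R m -> Cn R m -> R) (mup : Z -> Cn R m).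
Hypothesis hgrad : is_gradient exp AZ om act p B mup.
Hypothesis aG : a `<=` lie_algebra exp G.
Hypothesis ap : a `<=` p.
Hypothesis la : linear_subspace a.
Hypothesis expD : forall xi eta, a xi -> a eta -> exp (xi + eta) = (exp xi * exp eta)%g.
Hypothesis Blin : forall eta, linear (fun xi => B xi eta : R^o).
Hypothesis Bsym : forall xi eta, B xi eta = B eta xi.
Hypothesis Bpos : scalar_product_on a B.
Variables (M : set Z) (x0 : M).
Hypothesis Mcompact : compact M.
Hypothesis Mstable : stable act G M.
Variables (k : nat) (b : 'I_k -> Cn R m).
Hypothesis ab : forall i, a (b i).
Hypothesis Bb : forall i j, B (b i) (b j) = (i == j)%:R.
Hypothesis bspan : forall x, a x -> x = \sum_i B x (b i) *: b i.
Notation V := 'rV[R]_k.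
Notation g_ := (Cn R m).
Implicit Types (u v w : V) (xi eta : g_).

Definition basis_comb u : g_ := \sum_i u ord0 i *: b i.
Definition basis_coord xi : V := \row_i B xi (b i).
Notation L := basis_comb.
Notation P := basis_coord.

Lemma basis_comb_linear : linear L.
Proof.
move=> c u v; rewrite /L scaler_sumr -big_split /=; apply: eq_bigr => i _.
by rewrite !mxE scalerDl scalerA.
Qed.

Lemma basis_coord_linear : linear P.
Proof. by move=> c x y; apply/rowP => i; rewrite !mxE; exact: (Blin (b i)). Qed.

Lemma basis_comb_sub u : a (L u).
Proof. by apply: subspace_sum => // i; exact: subspace_scale. Qed.

Lemma basis_combK u : P (L u) = u.
Proof. by apply/rowP => i; rewrite !mxE (orthonormal_coord la Bpos). Qed.

Lemma basis_coordK xi : a xi -> L (P xi) = xi.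
Proof.
by move=> axi; rewrite [RHS](bspan axi); apply: eq_bigr => i _; rewrite mxE.
Qed.

Lemma basis_coord_dot xi u : B xi (L u) = dotv (P xi) u.
Proof.
rewrite Bsym; pose F : {linear g_ -> R^o} := HB.pack (fun x => B x xi : R^o)
  (GRing.isLinear.Build R g_ R^o *:%R (fun x => B x xi : R^o) (Blin xi)).
rewrite -[LHS]/(F (L u)) linear_sum /dotv; apply: eq_bigr => i _.
by rewrite linearZ /= mxE Bsym mulrC.
Qed.

(** [orth_proj] picks some element with the defining property, so uniqueness is needed too: the
    coordinates of such an element are forced by orthogonality to the [b i]. *)
Lemma orth_proj_coord xi : orth_proj B a xi = L (P xi).
Proof.
have h : a (L (P xi)) /\ forall s, a s -> B (xi - L (P xi)) s = 0.
  split=> [|s as_]; first exact: basis_comb_sub.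
  rewrite -(basis_coordK as_) basis_coord_dot.
  have Pl := basis_coord_linear.
  rewrite (linear_add Pl) -scaleN1r (linear_scale Pl) scaleN1r basis_combK subrr.
  exact: dotv0l.
apply: xget_unique => // y [ay yo].
rewrite -(basis_coordK ay); congr L; apply/rowP => i.
have Pl := basis_coord_linear.
have : B (xi - y) (b i) = 0 by exact: yo.
have -> : B (xi - y) (b i) = P (xi - y) ord0 i by rewrite mxE.
rewrite (linear_add Pl) -scaleN1r (linear_scale Pl) scaleN1r.
by rewrite !mxE => /eqP; rewrite subr_eq0 => /eqP.
Qed.

Definition flow u : M -> M := act_on act (exp (L u)).
Definition moment (x : M) : V := P (mup (val x)).
Definition rate (x : M) v w : R := flow_rate exp act B mup (val x) (L v) (L w).

Lemma flow_val u (x : M) : val (flow u x) = act (exp (L u)) (val x).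
Proof.
rewrite /flow /act_on; apply: insubdK; apply/mem_set; apply: Mstable; last exact: set_valP.
by have := aG (basis_comb_sub u) 1; rewrite scale1r.
Qed.

Let LZ t u : L (t *: u) = t *: L u.
Proof. exact: (linear_scale basis_comb_linear). Qed.

Lemma flow_is_gradient : flow_gradient flow moment rate.
Proof.
have hpv w : p (L w) by apply: ap; exact: basis_comb_sub.
have [act1 actM _] := hact.
split; split.
- move=> x; apply: val_inj; rewrite flow_val.
  by rewrite (linear_zero basis_comb_linear) (exp0 hexp) act1.
- move=> u v x; apply: val_inj; rewrite !flow_val -actM.
  by rewrite -expD ?(linear_add basis_comb_linear)//; exact: basis_comb_sub.
- move=> u; apply: continuous_comp_initial.
  have -> : set_val \o flow u = act (exp (L u)) \o (set_val : M -> Z).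
    by apply/funext => x; exact: flow_val.
  move=> x; apply: continuous_comp; first exact: set_val_continuous.
  exact: (act_continuous hact).
- move=> u x; apply: continuous_comp_initial.
  have -> : set_val \o (fun t : R => flow (t *: u) x) = fun t : R => act (exp (t *: L u)) (val x).
    by apply/funext => t; rewrite /= -LZ; exact: flow_val.
  exact: (act_exp_continuous hexp hact).
- move=> w; have -> : (fun x => dotv (moment x) w) = (fun z => B (mup z) (L w)) \o (set_val : M -> Z).
    by apply/funext => x; rewrite /= basis_coord_dot.
  move=> x; apply: continuous_comp; first exact: set_val_continuous.
  exact: (gradient_component_continuous hZ hgrad (hpv w)).
- move=> x u w t.
  have -> : (fun t : R => dotv (moment (flow (t *: u) x)) w) =
      fun t : R => B (mup (act (exp (t *: L u)) (val x))) (L w).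
    by apply/funext => s; rewrite /moment flow_val LZ basis_coord_dot.
  rewrite /rate flow_val LZ.
  exact: (flow_rate_is_derive hZ hUC AUe e1 hexp hact hgrad _ _ _ (hpv w)).
- move=> u w x.
  apply: (@continuous_comp _ _ _ (set_val : M -> Z) (fun z => flow_rate exp act B mup z (L u) (L w))).
    exact: set_val_continuous.
  exact: (flow_rate_continuous hZ hom hUC AUe e1 hexp hact hgrad (hpv w)).
- move=> x u w; exact: (flow_rate_sym hZ hom hUC AUe e1 hexp hact hgrad).
- by move=> x u; exact: (flow_rate_ge0 hZ hom hUC AUe e1 hexp hact hgrad).
- move=> x u S0 t; apply: val_inj; rewrite flow_val LZ.
  exact: (flow_rate_eq0 hZ hom hUC AUe e1 hexp hact hgrad _ (hpv u)).
Qed.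

Notation BT := (borel_sub M x0).
Notation orbit_map := (fun x : M => orth_proj B a (mup (val x))).
Implicit Types (sigma : probability BT R) (nu : probability BT R).

Let Mc : compact [set: M]. Proof. exact: set_type_compact. Qed.
Let Mh : hausdorff_space M.
Proof. by apply: set_type_hausdorff; case: hZ. Qed.
Let Ms : @second_countable M.
Proof. by apply: set_type_second_countable; case: hZ. Qed.

Let momentc i : continuous (fun x => moment x ord0 i).
Proof.
have -> : (fun x => moment x ord0 i) = (fun z => B (mup z) (b i)) \o (set_val : M -> Z).
  by apply/funext => x; rewrite /= mxE.
move=> x; apply: continuous_comp; first exact: set_val_continuous.
exact: (gradient_component_continuous hZ hgrad (ap (ab i))).
Qed.

(** [mean] integrates the coordinates of [Cn R m], [row_mean] those in the basis [b]; taking for [l]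
    each coordinate of [Cn R m] reconciles the two. *)
Let functional_mean (l : g_ -> R) sigma : linear (l : g_ -> R^o) ->
  \int[sigma]_(x in [set: BT]) l (L (moment x)) = l (L (row_mean moment sigma)).
Proof.
move=> ll; have lL u : l (L u) = \sum_i u ord0 i * l (b i).
  pose F : {linear g_ -> R^o} := HB.pack (l : g_ -> R^o)
    (GRing.isLinear.Build R g_ R^o *:%R (l : g_ -> R^o) ll).
  by rewrite -[LHS]/(F (L u)) linear_sum; apply: eq_bigr => i _; rewrite linearZ.
rewrite lL; under eq_Rintegral do rewrite lL.
have [addI scaleI _ _] := mean_positive_functional (R := R) (x0 := x0) Mc sigma.
have c0 : continuous (fun _ : M => 0 : R) by exact: cst_continuous.
have I0 : \int[sigma]_(x in [set: BT]) (0 : R) = 0.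
  by have := scaleI 0 _ c0; rewrite !mul0r.
pose T (r : seq 'I_k) (x : M) := \sum_(i <- r) moment x ord0 i * l (b i).
have ci i : continuous (fun x => l (b i) * moment x ord0 i).
  by move=> x; apply: continuousM; [exact: cst_continuous|exact: momentc].
suff [_] : continuous (T (index_enum 'I_k)) /\ \int[sigma]_(x in [set: BT]) T (index_enum 'I_k) x =
  \sum_i row_mean moment sigma ord0 i * l (b i) by [].
elim: (index_enum 'I_k) => [|i r [Tc IH]].
  rewrite /T big_nil; have -> : (fun x : M => \sum_(i <- [::]) moment x ord0 i * l (b i)) = fun=> 0.
    by apply/funext => x; rewrite big_nil.
  by [].
have eT : T (i :: r) = fun x => l (b i) * moment x ord0 i + T r x.
  by apply/funext => x; rewrite /T big_cons mulrC.
rewrite eT; split.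
  by move=> x; apply: (@continuousD _ _ _ (fun x => l (b i) * moment x ord0 i) (T r)); [exact: ci|exact: Tc].
by rewrite addI// IH big_cons scaleI// mxE mulrC.
Qed.

Lemma mean_moment sigma : mean orbit_map sigma = L (row_mean moment sigma).
Proof.
have e1' x : orbit_map x = L (moment x) by exact: orth_proj_coord.
rewrite /mean [RHS]surjective_pairing; congr pair; apply/rowP => j; rewrite mxE.
  under eq_Rintegral do rewrite e1'.
  by have := functional_mean sigma (@coordl_linear _ _ j).
under eq_Rintegral do rewrite e1'.
by have := functional_mean sigma (@coordr_linear _ _ j).
Qed.

Lemma measure_orbit_flow nu : measure_orbit act (exp @` a) nu = flow_orbit flow nu.
Proof.
apply/seteqP; split => [sigma [_ [xi axi <-]] h|sigma [u h]].
  by exists (P xi); rewrite /flow basis_coordK.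
by exists (exp (L u)) => //; exists (L u) => //; exact: basis_comb_sub.
Qed.

Lemma fixed_measures_flow : fixed_measures act (exp @` a) = flow_fixed flow (x0 := x0) (R := R).
Proof.
apply/seteqP; split => [sigma h u|sigma h _ [xi axi <-]].
  by apply: h; exists (L u) => //; exact: basis_comb_sub.
by have := h (P xi); rewrite /flow basis_coordK.
Qed.

Lemma isotropy_flow nu :
  lie_algebra_in exp a (measure_isotropy act (exp @` a) nu) = L @` flow_isotropy flow nu.
Proof.
apply/seteqP; split => [xi [axi h]|_ [v h <-]].
  exists (P xi); last exact: basis_coordK.
  by move=> t; have [_] := h t; rewrite /flow LZ basis_coordK.
split; first exact: basis_comb_sub.
move=> t; split; last by have := h t; rewrite /flow LZ.
by rewrite -LZ; exists (L (t *: v)) => //; exact: basis_comb_sub.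
Qed.

Lemma orth_compl_flow (W : set V) :
  orth_compl_in B a (L @` W) = L @` [set v | forall w, W w -> dotv v w = 0].
Proof.
apply/seteqP; split => [xi [axi h]|_ [v h <-]].
  exists (P xi); last exact: basis_coordK.
  by move=> w Ww; rewrite -basis_coord_dot; apply: h; exists w.
split; first exact: basis_comb_sub.
by move=> _ [w Ww <-]; rewrite basis_coord_dot basis_combK; exact: h.
Qed.

Let cvx_image (D : set V) : cvx D -> cvx (L @` D).
Proof.
move=> cD _ _ t t0 t1 [x Dx <-] [y Dy <-]; exists (t *: x + (1 - t) *: y); first exact: cD.
have ll := basis_comb_linear.
by rewrite (linear_add ll) !(linear_scale ll).
Qed.

Let cvx_preimage (D : set g_) : cvx D -> cvx (L @^-1` D).
Proof.
move=> cD x y t t0 t1 Dx Dy; have ll := basis_comb_linear.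
by rewrite /preimage/= (linear_add ll) !(linear_scale ll); exact: cD.
Qed.

Let mean_image (D : set (weak_prob R x0)) :
  (mean orbit_map : weak_prob R x0 -> g_) @` D = L @` (row_mean moment @` D).
Proof.
apply/seteqP; split => [_ [s Ds <-]|_ [_ [s Ds <-] <-]].
  by exists (row_mean moment s); [exists s|rewrite mean_moment].
by exists s => //; exact: mean_moment.
Qed.

Theorem abelian_orbit_image nu :
  open_convex_in_affine a
    (orth_compl_in B a (lie_algebra_in exp a (measure_isotropy act (exp @` a) nu)))
    ((mean orbit_map : weak_prob R x0 -> g_) @` measure_orbit act (exp @` a) nu).
Proof.
rewrite mean_image measure_orbit_flow isotropy_flow orth_compl_flow.
have [ [Q oQ imQ] cv] := flow_orbit_image Mc Mh Ms flow_is_gradient nu.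
have ll := basis_comb_linear.
split; first by apply/convex_setP; exact: cvx_image.
(* The open set has to live in all of [Cn R m]; [P] is defined and continuous there and inverts [L]
   on [a]. *)
exists (L (row_mean moment nu)), (P @^-1` Q); split; first exact: basis_comb_sub.
  apply: open_comp oQ => x _; exact: Cn_linear_continuous basis_coord_linear _.
rewrite imQ; apply/seteqP; split => [_ [y [Qy [v Wv ey]] <-]|x [Qx [_ [v Wv <-] ex]]].
  split; first by rewrite /preimage/= basis_combK.
  by exists (L v); [exists v|rewrite -ey (linear_add ll)].
exists (row_mean moment nu + v); last by rewrite (linear_add ll).
split; last by exists v.
by have := Qx; rewrite /preimage/= -ex -(linear_add ll) basis_combK.
Qed.

Theorem abelian_closure_image nu (F : weak_prob R x0 -> g_ := mean orbit_map)
    (K := closure (measure_orbit act (exp @` a) nu)) :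
  F @` K = convex_hull (F @` (K `&` fixed_measures act (exp @` a))).
Proof.
rewrite /K /F measure_orbit_flow fixed_measures_flow !mean_image.
have [cv hull] := flow_closure_image Mc Mh Ms flow_is_gradient nu.
apply/seteqP; split => [_ [y Ky <-] D [/convex_setP cD SD]|].
  apply: (hull _ (cvx_preimage cD)) => // z Sz.
  by apply: SD; exists z.
apply: smallest_sub; first by apply/convex_setP; exact: cvx_image.
by do 2 apply: image_subset; exact: subIsetl.
Qed.

End AbelianFlow.

Theorem mainTheorem1 (R : realType)
  (* the compact connected Kähler manifold Z *)
  (n : nat) (Z : topologicalType) (AZ : set (chart Z (Cn R n)))
  (om : chart Z (Cn R n) -> Z -> Cn R n -> Cn R n -> R)
  (hZ : complex_manifold AZ)
  (Zcompact : compact [set: Z]) (Zconnected : connected [set: Z])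
  (hom : kahler_form AZ om)
  (* the compact connected Lie group U and its complexification UC *)
  (m : nat) (UC : topGroupType) (AU : set (chart UC (Cn R m)))
  (hUC : complex_Lie_group AU)
  (e : chart UC (Cn R m)) (AUe : AU e) (e1 : cdom e 1%g)
  (exp : Cn R m -> UC) (hexp : is_exp e exp)
  (U : set UC) (Usubgroup : subgroup U)
  (Ucompact : compact U) (Uconnected : connected U)
  (hU : complexification AU U) (hcartan : cartan_decomposition exp U)
  (B : Cn R m -> Cn R m -> R) (hB : invariant_form e exp U B)
  (* the Hamiltonian action *)
  (act : UC -> Z -> Z) (hact : holomorphic_action AZ act AU)
  (Uom : preserves_form AZ om act U)
  (q : Cn R m -> Cn R m -> R) (mu : Z -> Cn R m)
  (hmu : momentum_map e exp AZ om act U q mu)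
  (* the compatible subgroup G and its gradient map *)
  (G : set UC) (hG : compatible_subgroup e exp U G)
  (hgrad : is_gradient exp AZ om act (cartan_p exp U G) B
             (gradient_map exp U G q mu))
  (* the G-stable submanifold M *)
  (d : nat) (M : set Z) (Mcompact : compact M) (hM : submanifold AZ d M)
  (Mstable : stable act G M) (x0 : M)
  (* the Abelian subalgebra a *)
  (a : set (Cn R m)) (ha : lie_subalgebra_of e exp (cartan_p exp U G) a)
  (nu : probability (borel_sub M x0) R) :
  let A := exp @` a in
  let mu_a := fun x : M => orth_proj B a (gradient_map exp U G q mu (val x)) in
  let F : weak_prob R x0 -> Cn R m := mean mu_a in
  let a_nu := lie_algebra_in exp a (measure_isotropy act A nu) in
  open_convex_in_affine a (orth_compl_in B a a_nu) (F @` measure_orbit act A nu) /\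
  F @` closure (measure_orbit act A nu) =
    convex_hull (F @` (closure (measure_orbit act A nu) `&` fixed_measures act A)).
Proof.
move=> A mu_a F a_nu.
have [la ap _] := ha.
have aG : a `<=` lie_algebra exp G by move=> x /ap[].
have Bpos := abelian_scalar_product hB ha.
have expD := abelian_expD hUC AUe e1 hexp Usubgroup hcartan hB ha.
(* A [B]-orthonormal basis turns [B] on [a] into [dotv], so orthogonal complements in [a] match
   those in coordinates. *)
have [k [b [ab Bb bspan]]] := orthonormal_basis la Bpos.
split.
  exact: (abelian_orbit_image hZ hom hUC AUe e1 hexp hact hgrad aG ap la expD
    (form_linear hB) (form_symmetric hB) Bpos Mcompact Mstable ab Bb bspan).
exact: (abelian_closure_image hZ hom hUC AUe e1 hexp hact hgrad aG ap la expD
  (form_linear hB) (form_symmetric hB) Bpos Mcompact Mstable ab Bb bspan).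
Qed.
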